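(* For every integer $r\ge 2$, $$\lim_{n\to\infty}\frac{s(r,n)}{\operatorname{CR}\left(\bigvee^{r}\overline{K_n}\right)}=\zeta(r),\qquad\text{where } \zeta(r)=\frac{3(r^2-r)}{8(r^2+r-3)}.$$ Here $s(r,n)$ is the expected number of crossings in a random geodesic spherical drawing of the balanced complete $r$-partite graph $\bigvee^{r}\overline{K_n}$, and $\operatorname{CR}$ denotes the maximum crossing number.
   Context: $\bigvee^{r}\overline{K_n}$ denotes the balanced complete $r$-partite graph $K_{n,\dots,n}$ with $r$ partite sets, each of size $n$ (the join of $r$ copies of the complement of $K_n$). A plane drawing of a graph is a good drawing if no more than two edges intersect at any point that is not a vertex, edges incident with a common vertex do not cross, no pair of edges cross more than once, and edges that intersect at a non-vertex must cross. The crossing number $\operatorname{cr}(D)$ of a good drawing $D$ is the number of non-vertex edge intersections in $D$. The maximum crossing number of a graph $G$ is $\operatorname{CR}(G)=\max\{\operatorname{cr}(D): D\text{ is a good drawing of } G\}$. A geodesic spherical drawing of $G$ is a good drawing of $G$ obtained by placing the vertices of $G$ on a sphere, drawing edges as geodesics (the shorter great circle arcs between their endpoints), and projecting onto the plane. In a random geodesic spherical drawing, the vertices are placed on the sphere independently and uniformly at random. *)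

(* Defs.v *)
From mathcomp Require Import all_boot all_order all_algebra finmap.
From mathcomp Require Import all_classical all_reals all_analysis.

Set Implicit Arguments.
Unset Strict Implicit.
Unset Printing Implicit Defensive.

Import Order.TTheory GRing.Theory Num.Theory.
Import numFieldNormedType.Exports.

Local Open Scope classical_set_scope.
Local Open Scope ring_scope.

Section Drawings.
Variable R : realType.

Local Notation plane := (R * R)%type.

(* An edge is the point set of its curve; [dedge D u v] is only meaningful when
   u and v are adjacent. *)
Record drawing (V : finType) := Drawing {
  dvertex : V -> plane;
  dedge : V -> V -> set plane }.

Definition is_arc (A : set plane) (a b : plane) : Prop :=
  exists g : R -> plane,
    [/\ {within `[0, 1], continuous g},
        {in `[0, 1] &, injective g},
        g 0 = a, g 1 = b & A = g @` `[0, 1]].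

Definition plane_drawing (V : finType) (e : rel V) (D : drawing V) : Prop :=
  [/\ injective (dvertex D),
      forall u v, e u v -> dedge D u v = dedge D v u,
      forall u v, e u v -> is_arc (dedge D u v) (dvertex D u) (dvertex D v) &
      forall u v w, e u v -> dedge D u v (dvertex D w) -> w = u \/ w = v].

(* A and B cross at p (as opposed to merely touching there): some homeomorphism
   h from a neighbourhood U of p onto the open square ]-1, 1[^2, with inverse k,
   sends p to the origin, A to the horizontal and B to the vertical axis. *)
Definition cross_at (A B : set plane) (p : plane) : Prop :=
  exists (U : set plane) (h k : plane -> plane),
    let Q := [set y : plane | `|y.1| < 1 /\ `|y.2| < 1] in
    [/\ open U /\ U p,
        {within U, continuous h} /\ {within Q, continuous k},
        (forall x, U x -> Q (h x) /\ k (h x) = x) /\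
        (forall y, Q y -> U (k y) /\ h (k y) = y),
        h p = (0, 0) &
        forall x, U x -> (A x <-> (h x).2 = 0) /\ (B x <-> (h x).1 = 0)].

Section Counting.
Variables (V : finType) (e : rel V) (D : drawing V).

Definition nonvertex (p : plane) : Prop := forall v, dvertex D v <> p.

Definition distinct_edges (u v w z : V) : Prop :=
  [/\ e u v, e w z & [set u; v]%SET != [set w; z]%SET].

Definition good_drawing : Prop :=
  [/\ plane_drawing e D,
      forall p u v u' v' u'' v'', nonvertex p ->
        distinct_edges u v u' v' -> distinct_edges u v u'' v'' ->
        distinct_edges u' v' u'' v'' ->
        ~ [/\ dedge D u v p, dedge D u' v' p & dedge D u'' v'' p],
      forall u v w p, distinct_edges u v u w ->
        ~ cross_at (dedge D u v) (dedge D u w) p,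
      forall u v w z p q, distinct_edges u v w z ->
        cross_at (dedge D u v) (dedge D w z) p ->
        cross_at (dedge D u v) (dedge D w z) q -> p = q &
      forall u v w z p, distinct_edges u v w z -> nonvertex p ->
        dedge D u v p -> dedge D w z p ->
        cross_at (dedge D u v) (dedge D w z) p].

Definition crossings : set plane :=
  [set p | nonvertex p /\ exists u v w z,
     [/\ distinct_edges u v w z, dedge D u v p & dedge D w z p]].

(* [fset_set] sends infinite sets to the empty one; [crossings] is finite for
   every good drawing. *)
Definition cr : nat := #|` fset_set crossings |.

End Counting.

(* The junk value 0 is taken only if the maximum does not exist. *)
Definition CR (V : finType) (e : rel V) : nat :=
  xget 0%N [set m | (exists2 D, good_drawing e D & cr e D = m) /\
                    (forall D, good_drawing e D -> (cr e D <= m)%N)].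

End Drawings.

Section SphericalDrawings.
Variable R : realType.

Local Notation plane := (R * R)%type.
Local Notation space := (R * R * R)%type.

Definition enorm (x : space) : R :=
  Num.sqrt (x.1.1 ^+ 2 + x.1.2 ^+ 2 + x.2 ^+ 2).

Definition sphere : set space := [set x | enorm x = 1].

(* For u, v on the sphere and not antipodal, the shorter great circle arc: the
   part of the sphere inside the convex cone spanned by u and v. *)
Definition geodesic (u v : space) : set space :=
  [set x | sphere x /\ exists s t : R, [/\ 0 <= s, 0 <= t & x = s *: u + t *: v]].

(* Stereographic projection from the pole (0, 0, 1). *)
Definition stereographic (x : space) : plane :=
  (x.1.1 / (1 - x.2), x.1.2 / (1 - x.2)).

Definition geodesic_drawing (V : finType) (f : V -> space) : drawing R V :=
  Drawing (fun v => stereographic (f v))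
          (fun u v => stereographic @` geodesic (f u) (f v)).

Definition volume : set space -> \bar R :=
  ((@lebesgue_measure R \x @lebesgue_measure R) \x @lebesgue_measure R)%E.

Definition ball3 : set space := [set x | 0 < enorm x <= 1].

(* Normalized surface measure of the sphere: by polar coordinates, the area of
   A is proportional to the volume of the cone { t a | a in A, 0 < t <= 1 }. *)
Definition uniform_sphere (A : set space) : \bar R :=
  (volume [set x | ball3 x /\ A ((enorm x)^-1 *: x)] / volume ball3)%E.

Definition uniform_independent (V : finType) (d : measure_display)
    (T : measurableType d) (P : probability T R) (X : V -> T -> space) : Prop :=
  [/\ forall v, measurable_fun setT (X v),
      forall v A, measurable A -> P (X v @^-1` A) = uniform_sphere A &
      forall A : V -> set space, (forall v, measurable (A v)) ->
        P (\bigcap_(v in [set: V]) (X v @^-1` A v)) =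
        (\prod_(v : V) P (X v @^-1` A v))%E].

(* Almost surely the placement is in general position, so that [geodesic_drawing]
   is a good drawing; degenerate placements do not contribute. *)
Definition expected_crossings (V : finType) (e : rel V) (d : measure_display)
    (T : measurableType d) (P : probability T R) (X : V -> T -> space) : \bar R :=
  'E_P[fun w => (cr e (geodesic_drawing (X ^~ w)))%:R].

End SphericalDrawings.

Definition balanced_multipartite (r n : nat) : rel ('I_r * 'I_n) :=
  fun u v => u.1 != v.1.
Arguments balanced_multipartite : clear implicits.

Definition zeta (R : realType) (r : nat) : R :=
  3 * (r%:R ^+ 2 - r%:R) / (8 * (r%:R ^+ 2 + r%:R - 3)).

(* Main.v *)
(* In a good drawing the opposite edges of a 4-cycle u, v, w, z cannot cross in
   both pairs: if uv and wz cross at p, then u and z lie on the same side of the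
   closed curve p, v, w, p (follow uv to p, then wz), whereas the winding number of
   this curve would change where zu crosses vw. Hence four vertices contribute at
   most one crossing, and none if three of them lie in the same part. A drawing on
   generic points of a parabola, with the parts consecutive, attains this bound, so
   CR is the number of 4-sets of vertices that have no three in one part.
   Whether the geodesics uv and wz cross is decided by the signs of
   det(v,w,z) det(u,w,z), det(u,v,z) det(u,v,w) and det(v,w,z) det(u,v,z). By the
   antipodal symmetry of the uniform law (reflecting v, or z, or both w and z) the
   eight sign patterns are equally likely, so two disjoint edges cross with
   probability 1/8. Both counts are of order n^4 and the ratio of the leading
   coefficients is zeta(r). *)
Require Import Defs.
From mathcomp Require Import all_boot all_order all_algebra.
From mathcomp Require Import all_classical all_reals all_analysis.
From mathcomp Require Import measurable_realfun ring lra zify.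

Set Implicit Arguments.
Unset Strict Implicit.
Unset Printing Implicit Defensive.

Import Order.TTheory GRing.Theory Num.Theory.
Import numFieldNormedType.Exports.

Local Open Scope classical_set_scope.
Local Open Scope ring_scope.

(** * Winding numbers *)

Section Turning.
Variable R : realType.
Local Notation plane := (R * R)%type.
Implicit Types u v w : plane.

(** Edges are arbitrary continuous arcs, and the only local information at a crossing is a
    homeomorphism of unknown orientation. Signs of intersections are therefore avoided: it suffices
    that the winding number about a point moving along an edge jumps by something nonzero. The jump
    is the turn of (s, t) -> f s - g t around a small rectangle, evaluated by homotopies inside the
    chart; turns come from explicit lifts of the argument.

    All counting is over ordered quadruples of vertices: a crossing is seen by 8 of them (reverse
    either edge, exchange the edges) and a 4-set by 24. This is the 24 of [CR_spread]. A quadruple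
    of [edge_quads] contributes 1/8 * 1/8 = 1/64 to the expectation, and 24/64 is the 3/8 in [zeta].

    On the random side only the joint law of the placement matters: families with the same product
    law are interchangeable. This yields both the reflections and the null sets, the latter by
    redrawing one vertex and applying Fubini. The crossing number enters the integral through its
    almost everywhere equality with a finite sum of indicators. *)

Definition dotp u v : R := u.1 * v.1 + u.2 * v.2.
Definition crossp u v : R := u.1 * v.2 - u.2 * v.1.
(** The signed angle from [u] to [v], but only where [dotp u v] is positive: there the tangent
    determines it and [atan] needs no branch correction. *)
Definition ang u v : R := atan (crossp u v / dotp u v).
Definition has_angle (th : R) v : Prop :=
  exists2 rho, 0 < rho & v = (rho * cos th, rho * sin th).

Lemma dotp_gt0 u : u != 0 -> 0 < dotp u u.
Proof.
case: u => a b; rewrite -pair_eqE /pair_eq /= negb_and /dotp /= => /orP[] h.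
- by rewrite ltr_pwDl// -expr2 ?sqr_ge0 // exprn_even_gt0.
- by rewrite ltr_wpDl// -expr2 ?sqr_ge0 // exprn_even_gt0.
Qed.

Lemma has_angle_neq0 th v : has_angle th v -> v != 0.
Proof.
move=> [rho r0 ->]; apply/negP => /eqP[/eqP + /eqP].
rewrite !mulf_eq0 gt_eqF//= => /eqP c0 /eqP s0.
by have := cos2Dsin2 th; rewrite c0 s0 expr0n addr0 => /eqP; rewrite eq_sym oner_eq0.
Qed.

Lemma has_angle_step th u v : has_angle th u -> 0 < dotp u v ->
  has_angle (th + ang u v) v.
Proof.
move=> [rho r0 ->]; set D := dotp _ v => D0.
set z := crossp (rho * cos th, rho * sin th) v / D.
have s0 : 0 < Num.sqrt (1 + z ^+ 2) by rewrite sqrtr_gt0 ltr_pwDl// sqr_ge0.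
exists (D / rho * Num.sqrt (1 + z ^+ 2)).
  by rewrite mulr_gt0// divr_gt0.
have sz : sin (atan z) = z / Num.sqrt (1 + z ^+ 2).
  have c0 : cos (atan z) != 0 by rewrite cos_atan invr_neq0// gt_eqF.
  by rewrite -{2}(atanK z) /tan -cos_atan divfK.
rewrite cosD sinD /ang -/D -/z sz cos_atan.
have zE : z * D = rho * (cos th * v.2 - sin th * v.1).
  by rewrite /z divfK ?gt_eqF// /crossp /=; ring.
have DE : D = rho * (cos th * v.1 + sin th * v.2) by rewrite /D /dotp /=; ring.
have cs := cos2Dsin2 th.
move: (Num.sqrt _) s0 => s s0.
have r0' := lt0r_neq0 r0; have s0' := lt0r_neq0 s0.
rewrite {1}(surjective_pairing v); congr (_, _).
- apply/esym; have -> : D / rho * s * (cos th * s^-1 - sin th * (z / s)) =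
     (D * cos th - z * D * sin th) / rho by field; rewrite s0' r0'.
  rewrite zE DE.
  have -> : rho * (cos th * v.1 + sin th * v.2) * cos th -
     rho * (cos th * v.2 - sin th * v.1) * sin th =
     rho * v.1 * (cos th ^+ 2 + sin th ^+ 2) by ring.
  by rewrite cs mulr1 mulrC mulKf.
- apply/esym; have -> : D / rho * s * (sin th * s^-1 + cos th * (z / s)) =
     (D * sin th + z * D * cos th) / rho by field; rewrite s0' r0'.
  rewrite zE DE.
  have -> : rho * (cos th * v.1 + sin th * v.2) * sin th +
     rho * (cos th * v.2 - sin th * v.1) * cos th =
     rho * v.2 * (cos th ^+ 2 + sin th ^+ 2) by ring.
  by rewrite cs mulr1 mulrC mulKf.
Qed.

(** One of the four axis directions makes an acute angle with [v], and a single [has_angle_step]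
    from it reaches [v]. *)
Lemma exists_angle v : v != 0 -> exists th, has_angle th v.
Proof.
move=> v0.
have axis c s th : cos th = c -> sin th = s -> 0 < dotp (c, s) v ->
    exists th', has_angle th' v.
  move=> ct st d; exists (th + ang (c, s) v); apply: has_angle_step => //.
  by exists 1 => //; rewrite !mul1r ct st.
have [a|a|a] := ltgtP v.1 0.
- by apply: (axis _ _ pi (@cospi _) (@sinpi _)); rewrite /dotp /=; lra.
- by apply: (axis _ _ 0 (@cos0 _) (@sin0 _)); rewrite /dotp /=; lra.
- have [b|b|b] := ltgtP v.2 0.
  + by apply: (axis 0 (-1) (- (pi / 2))); rewrite ?cosN ?sinN ?cos_pihalf ?sin_pihalf// /dotp /=; lra.
  + by apply: (axis _ _ (pi / 2) (@cos_pihalf _) (@sin_pihalf _)); rewrite /dotp /=; lra.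
  + by move: v0; rewrite (surjective_pairing v) a b eqxx.
Qed.

Lemma continuous_pair (T U W : topologicalType) (f : T -> U) (g : T -> W) (t : T) :
  {for t, continuous f} -> {for t, continuous g} ->
  {for t, continuous (fun x => (f x, g x))}.
Proof. by move=> cf cg; exact: (cvg_pair cf cg). Qed.

Lemma continuous_fst (T U : topologicalType) : continuous (@fst T U).
Proof. by move=> x; exact: cvg_fst. Qed.

Lemma continuous_snd (T U : topologicalType) : continuous (@snd T U).
Proof. by move=> x; exact: cvg_snd. Qed.

Lemma continuous_dotp (T : topologicalType) (f g : T -> plane) (t : T) :
  {for t, continuous f} -> {for t, continuous g} ->
  {for t, continuous (fun x => dotp (f x) (g x))}.
Proof.
move=> cf cg.
have c1 (h : T -> plane) : {for t, continuous h} -> {for t, continuous (fst \o h)}.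
  by move=> ch; apply: (continuous_comp ch); exact: continuous_fst.
have c2 (h : T -> plane) : {for t, continuous h} -> {for t, continuous (snd \o h)}.
  by move=> ch; apply: (continuous_comp ch); exact: continuous_snd.
by apply: continuousD; apply: continuousM; [exact: c1|exact: c1|exact: c2|exact: c2].
Qed.

Lemma continuous_crossp (T : topologicalType) (f g : T -> plane) (t : T) :
  {for t, continuous f} -> {for t, continuous g} ->
  {for t, continuous (fun x => crossp (f x) (g x))}.
Proof.
move=> cf cg.
have -> : (fun x => crossp (f x) (g x)) =
   (fun x => dotp (f x) ((g x).2, - (g x).1)).
  by apply/funext => x; rewrite /crossp /dotp /= mulrN.
apply: continuous_dotp => //; apply: continuous_pair.
  by apply: (continuous_comp cg); exact: continuous_snd.
by apply: continuousN; apply: (continuous_comp cg); exact: continuous_fst.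
Qed.

Lemma continuous_ang (T : topologicalType) (f g : T -> plane) (t : T) :
  {for t, continuous f} -> {for t, continuous g} -> 0 < dotp (f t) (g t) ->
  {for t, continuous (fun x => ang (f x) (g x))}.
Proof.
move=> cf cg d0.
apply: (@continuous_comp _ _ _ (fun x => crossp (f x) (g x) / dotp (f x) (g x)) atan).
  apply: continuousM; first exact: continuous_crossp.
  by apply: continuousV; [rewrite gt_eqF|exact: continuous_dotp].
exact: continuous_atan.
Qed.

(** The retraction of the line onto [0, 1]. Composing with it turns data given on [0, 1] into
    globally continuous maps and lets paths be concatenated by closed formulas. *)
Definition clamp (t : R) : R := Num.max 0 (Num.min 1 t).

Lemma continuous_clamp : continuous clamp.
Proof.
move=> t.
have c (a : R) : {for t, continuous (fun=> a : R^o)} by exact: cst_continuous.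
exact: (continuous_max (c 0) (continuous_min (c 1) (fun _ h => h))).
Qed.

Lemma clampE (t : R) : 0 <= t <= 1 -> clamp t = t.
Proof. by move=> /andP[t0 t1]; rewrite /clamp (min_r t1) (max_r t0). Qed.

Lemma clamp01 (t : R) : 0 <= clamp t <= 1.
Proof. by rewrite /clamp le_max lexx /= ge_max ler01 /= ge_min lexx. Qed.

Lemma clamp0 (t : R) : t <= 0 -> clamp t = 0.
Proof. by move=> t0; rewrite /clamp max_l// ge_min t0 orbT. Qed.

Lemma clamp1 (t : R) : 1 <= t -> clamp t = 1.
Proof. by move=> t1; rewrite /clamp (min_l t1) max_r. Qed.

(** At step length 0 the product is the positive [dotp (F y) (F y)]; compactness makes one positive
    step length work for all rays at once, so that [F] turns by less than a right angle per step. *)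
Lemma near_uniform_dotp (F : plane -> plane) :
  continuous F -> (forall x, F x != 0) ->
  exists N : nat, forall l (x : plane), 0 <= l <= 1 -> 0 <= x.1 <= 1 -> 0 <= x.2 <= 1 ->
    0 < dotp (F (l *: x)) (F ((l + N.+1%:R^-1) *: x)).
Proof.
move=> cF F0.
pose I := [set` `[0, 1 : R]].
pose K : set (R * plane) := I `*` (I `*` I).
have cK : compact K.
  by apply: compact_setX; [|apply: compact_setX]; exact: segment_compact.
have : \forall n \near \oo, K `<=`
   (fun y => 0 < dotp (F (y.1 *: y.2)) (F ((y.1 + n.+1%:R^-1) *: y.2))).
  apply: (iffLR (compact_near_coveringP K) cK _ _
    (fun n (y : R * plane) => 0 < dotp (F (y.1 *: y.2)) (F ((y.1 + n.+1%:R^-1) *: y.2)))).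
  move=> y Ky.
  pose G (z : (R * plane) * R) := dotp (F (z.1.1 *: z.1.2)) (F ((z.1.1 + z.2) *: z.1.2)).
  have c11 : continuous (fun z : (R * plane) * R => z.1.1).
    by move=> z; apply: (continuous_comp (@continuous_fst _ _ z)); exact: continuous_fst.
  have c12 : continuous (fun z : (R * plane) * R => z.1.2).
    by move=> z; apply: (continuous_comp (@continuous_fst _ _ z)); exact: continuous_snd.
  have cG : continuous G.
    move=> z; apply: continuous_dotp.
      apply: (@continuous_comp _ _ _ (fun z : (R * plane) * R => z.1.1 *: z.1.2) F).
        by apply: continuousZ; [exact: c11|exact: c12].
      exact: cF.
    apply: (@continuous_comp _ _ _ (fun z : (R * plane) * R => (z.1.1 + z.2) *: z.1.2) F).
      apply: continuousZ; last exact: c12.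
      by apply: continuousD; [exact: c11|exact: continuous_snd].
    exact: cF.
  have G0 : 0 < G (y, 0) by rewrite /G /= addr0 dotp_gt0.
  have := cvgr_gt _ (cG (y, 0)) _ G0.
  case=> -[/= A B] [nA nB] AB.
  exists (A, [set n | B n.+1%:R^-1]) => /=.
    split => //.
    exact: (@cvg_harmonic R _ nB).
  by move=> [z n] [/= Az Bn]; apply: (AB (z, n.+1%:R^-1)).
case=> N _ /(_ N (leqnn N)) H; exists N => l x l01 x1 x2.
have Kx : K (l, x) by split; [|split]; rewrite /I /= in_itv.
exact: (H _ Kx).
Qed.

Definition unit_square : set plane := [set x | 0 <= x.1 <= 1 /\ 0 <= x.2 <= 1].

(* Adding up the small angles along the ray from the origin to [x] gives a
   continuous branch of the argument. *)
Lemma angle_lift (F : plane -> plane) :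
  continuous F -> (forall x, F x != 0) ->
  exists2 Th : plane -> R, continuous Th &
    forall x, unit_square x -> has_angle (Th x) (F x).
Proof.
move=> cF F0; have [N HN] := near_uniform_dotp cF F0.
have [th0 Hth0] := exists_angle (F0 0).
pose cl (x : plane) : plane := (clamp x.1, clamp x.2).
have ccl : continuous cl.
  move=> x; apply: (@continuous_pair _ _ _ (clamp \o fst) (clamp \o snd)).
  - by apply: (continuous_comp (@continuous_fst _ _ x)); exact: continuous_clamp.
  - by apply: (continuous_comp (@continuous_snd _ _ x)); exact: continuous_clamp.
pose c (i : nat) : R := i%:R * N.+1%:R^-1.
have cS i : c i.+1 = c i + N.+1%:R^-1 by rewrite /c -natr1 mulrDl mul1r.
have c01 i : (i <= N.+1)%N -> 0 <= c i <= 1.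
  move=> iN; rewrite /c divr_ge0 ?ler0n//=.
  by rewrite ler_pdivrMr ?ltr0n// mul1r ler_nat.
have pos i x : (i < N.+1)%N -> 0 < dotp (F (c i *: cl x)) (F (c i.+1 *: cl x)).
  by move=> iN; rewrite cS; apply: HN; [exact: c01 (ltnW iN)|exact: clamp01|exact: clamp01].
pose Th n x := th0 + \sum_(i < n) ang (F (c i *: cl x)) (F (c i.+1 *: cl x)).
exists (Th N.+1).
  move=> x; have : forall n, (n <= N.+1)%N -> {for x, continuous (Th n)}.
    elim=> [_|n IHn nN].
      have -> : Th 0%N = fun=> th0 by apply/funext => y; rewrite /Th big_ord0 addr0.
      exact: cst_continuous.
    have -> : Th n.+1 = fun y => Th n y + ang (F (c n *: cl y)) (F (c n.+1 *: cl y)).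
      by apply/funext => y; rewrite /Th big_ord_recr /= addrA.
    have cFc m : {for x, continuous (fun y => F (c m *: cl y))}.
      apply: (@continuous_comp _ _ _ (fun y => c m *: cl y) F); last exact: cF.
      by apply: continuousZ; [exact: cst_continuous|exact: ccl].
    apply: continuousD; first exact: IHn (ltnW nN).
    by apply: continuous_ang; [exact: cFc|exact: cFc|exact: pos].
  by move=> /(_ N.+1 (leqnn _)).
move=> x [x1 x2]; have -> : x = c N.+1 *: cl x.
  rewrite /c divff ?pnatr_eq0// scale1r /cl !clampE//.
  by case: x {x1 x2}.
have : forall n, (n <= N.+1)%N -> has_angle (Th n x) (F (c n *: cl x)).
  elim=> [_|n IHn nN].
    by rewrite /Th big_ord0 addr0 /c mul0r scale0r.
  rewrite /Th big_ord_recr /= addrA; apply: has_angle_step; last exact: pos.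
  by apply: IHn; exact: ltnW.
move=> /(_ N.+1 (leqnn _)).
by rewrite {2}/Th /c divff ?pnatr_eq0// scale1r /Th /cl /= !(clampE (clamp01 _)).
Qed.

Lemma angle_lift_square (F : plane -> plane) :
  (forall x, unit_square x -> {for x, continuous F}) ->
  (forall x, unit_square x -> F x != 0) ->
  exists2 Th : plane -> R, continuous Th &
    forall x, unit_square x -> has_angle (Th x) (F x).
Proof.
move=> cF F0; pose cl (x : plane) : plane := (clamp x.1, clamp x.2).
have ccl : continuous cl.
  move=> x; apply: (@continuous_pair _ _ _ (clamp \o fst) (clamp \o snd)).
  - by apply: (continuous_comp (@continuous_fst _ _ x)); exact: continuous_clamp.
  - by apply: (continuous_comp (@continuous_snd _ _ x)); exact: continuous_clamp.
have scl x : unit_square (cl x) by split; exact: clamp01.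
have [||Th cTh HTh] := @angle_lift (F \o cl).
- by move=> x; apply: (continuous_comp (ccl x)); exact: cF.
- by move=> x; exact: F0.
exists Th => // x sx; have := HTh x sx; rewrite /= /cl.
by case: sx => x1 x2; rewrite !clampE//; case: x {x1 x2}.
Qed.

Lemma has_angle_inj th1 th2 v : has_angle th1 v -> has_angle th2 v ->
  cos (th1 - th2) = 1 /\ sin (th1 - th2) = 0.
Proof.
move=> [p p0 ->] [q q0 [E1 E2]].
have pq : p ^+ 2 = q ^+ 2.
  rewrite -[LHS]mulr1 -(cos2Dsin2 th1) -[RHS]mulr1 -(cos2Dsin2 th2).
  by rewrite !mulrDr -!exprMn E1 E2.
have {}pq : p = q by apply/eqP; rewrite -(eqrXn2 (n := 2))// ?pq ?ltW.
subst q; have p0' := lt0r_neq0 p0.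
have [c s] : cos th1 = cos th2 /\ sin th1 = sin th2.
  by split; apply: (mulfI p0').
rewrite cosB sinB c s -!expr2 cos2Dsin2; split => //.
by rewrite [cos _ * _]mulrC subrr.
Qed.

(** The values of [phi] are multiples of 2 pi. If two differed, the intermediate value theorem would
    give a value lying above such a multiple by at most 1, where the sine is positive because 1 <
    pi. *)
Lemma circle_lift_const (phi : R -> R) (a b : R) : continuous phi ->
  (forall t, 0 <= t <= 1 -> cos (phi t) = 1 /\ sin (phi t) = 0) ->
  0 <= a <= 1 -> 0 <= b <= 1 -> phi a = phi b.
Proof.
move=> cphi H.
wlog ab : a b / a <= b.
  move=> W a01 b01; have [ab|/ltW ab] := leP a b; first exact: W.
  by apply/esym; exact: W.
move=> /andP[a0 a1] /andP[b0 b1].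
have cont : {within `[a, b], continuous phi} by exact: continuous_subspaceT.
have key (v w : R) : sin w = 0 -> cos w = 1 ->
    Num.min (phi a) (phi b) <= v <= Num.max (phi a) (phi b) ->
    w < v -> v - w <= 1 -> False.
  move=> sw cw vI wv vw; have [t tab tv] := IVT ab cont vI.
  have /H[_] : 0 <= t <= 1.
    by move: tab; rewrite in_itv /= => /andP[? ?]; apply/andP; split; lra.
  rewrite tv => sv.
  have : sin (v - w) = 0 by rewrite sinB sv sw mul0r mulr0 subrr.
  apply/eqP; rewrite gt_eqF//; apply: sin_gt0_pi.
  by have := pi_ge2 R; lra.
have [ca sa] : cos (phi a) = 1 /\ sin (phi a) = 0 by apply: H; rewrite a0 a1.
have [cb sb] : cos (phi b) = 1 /\ sin (phi b) = 0 by apply: H; rewrite b0 b1.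
have [lt|lt|//] := ltgtP (phi a) (phi b); exfalso.
- apply: (key (Num.min (phi b) (phi a + 1)) _ sa ca).
  + rewrite (min_l (ltW lt)) (max_r (ltW lt)) le_min (ltW lt) /= ge_min lexx.
    by rewrite andbT lerDl ler01.
  + by rewrite lt_min lt ltrDl ltr01.
  + by rewrite lerBlDl ge_min lexx orbT.
- apply: (key (Num.min (phi a) (phi b + 1)) _ sb cb).
  + rewrite (min_r (ltW lt)) (max_l (ltW lt)) le_min (ltW lt) /= ge_min lexx.
    by rewrite andbT lerDl ler01.
  + by rewrite lt_min lt ltrDl ltr01.
  + by rewrite lerBlDl ge_min lexx orbT.
Qed.

(** The total change of the argument along [f], read off from any lift over [0, 1]; [turnE] shows
    that the lift does not matter. The default 0 is taken only when there is no lift. *)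
Definition turn (f : R -> plane) (a b : R) : R :=
  xget 0 [set d | exists th : R -> R, [/\ continuous th,
    forall t, 0 <= t <= 1 -> has_angle (th t) (f t) & d = th b - th a]].

Implicit Types (f g : R -> plane) (F : plane -> plane) (a b c d : R).

Lemma turnE f (th : R -> R) a b : continuous th ->
  (forall t, 0 <= t <= 1 -> has_angle (th t) (f t)) ->
  0 <= a <= 1 -> 0 <= b <= 1 -> turn f a b = th b - th a.
Proof.
move=> cth Hth a01 b01; rewrite /turn; case: xgetP => [d _ [th' [cth' Hth' ->]]|].
  have : (th' \- th) a = (th' \- th) b.
    apply: circle_lift_const => //.
      by move=> t; apply: continuousB; [exact: cth'|exact: cth].
    by move=> t t01; apply: has_angle_inj; [exact: Hth'|exact: Hth].
  by move=> /= E; lra.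
by move=> /(_ (th b - th a))[]; exists th.
Qed.

Definition nonzero_path (f : R -> plane) : Prop :=
  forall t, 0 <= t <= 1 -> {for t, continuous f} /\ f t != 0.

Lemma path_lift f : nonzero_path f -> exists2 th : R -> R, continuous th &
  forall t, 0 <= t <= 1 -> has_angle (th t) (f t).
Proof.
move=> nf.
have [||Th cTh HTh] := @angle_lift_square (fun x => f x.1).
- move=> x [x1 _]; apply: (continuous_comp (@continuous_fst _ _ x)).
  by case: (nf _ x1).
- by move=> x [x1 _]; case: (nf _ x1).
exists (fun t => Th (t, 0)).
  move=> t; apply: (@continuous_comp _ _ _ (fun t : R => (t, 0 : R)) Th); last exact: cTh.
  by apply: continuous_pair => //; exact: cst_continuous.
by move=> t t01; apply: (HTh (t, 0)); split => //=; rewrite lexx ler01.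
Qed.

Lemma turn_cat f a b c : nonzero_path f -> 0 <= a <= 1 -> 0 <= b <= 1 -> 0 <= c <= 1 ->
  turn f a b + turn f b c = turn f a c.
Proof.
move=> nf a01 b01 c01; have [th cth Hth] := path_lift nf.
by rewrite !(turnE cth Hth)//; ring.
Qed.

Lemma turn_reparam f (phi : R -> R) a b : nonzero_path f -> continuous phi ->
  (forall t, 0 <= t <= 1 -> 0 <= phi t <= 1) -> 0 <= a <= 1 -> 0 <= b <= 1 ->
  turn (f \o phi) a b = turn f (phi a) (phi b).
Proof.
move=> nf cphi phi01 a01 b01; have [th cth Hth] := path_lift nf.
rewrite (turnE cth Hth (phi01 _ a01) (phi01 _ b01)).
rewrite (@turnE _ (th \o phi))//.
  by move=> t; apply: (continuous_comp (cphi t)); exact: cth.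
by move=> t t01; exact: (Hth _ (phi01 _ t01)).
Qed.

Lemma turn_ext f g a b : nonzero_path f -> 0 <= a <= 1 -> 0 <= b <= 1 ->
  (forall t, 0 <= t <= 1 -> g t = f t) -> turn g a b = turn f a b.
Proof.
move=> nf a01 b01 gf; have [th cth Hth] := path_lift nf.
rewrite (turnE cth Hth)// (@turnE _ th)// => t t01.
by rewrite gf//; exact: Hth.
Qed.

(** In the open half-plane around [e] the argument has the closed form [th0 + ang e (f t)], so only
    the ends of the path count. *)
Lemma turn_halfplane f (e : plane) a b : nonzero_path f -> 0 <= a <= 1 -> 0 <= b <= 1 ->
  (forall t, 0 <= t <= 1 -> 0 < dotp e (f t)) ->
  turn f a b = ang e (f b) - ang e (f a).
Proof.
move=> nf a01 b01 He.
have e0 : e != 0.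
  apply/eqP => e0; have := He 0; rewrite lexx ler01 => /(_ isT).
  by rewrite /dotp e0 !mul0r addr0 ltxx.
have [th0 Hth0] := exists_angle e0.
pose th t := th0 + ang e (f (clamp t)).
rewrite (@turnE _ th)// /th; first by rewrite !clampE//; ring.
- move=> t; apply: (@continuousD _ R^o _ (fun=> th0) (fun t => ang e (f (clamp t)))).
    exact: cst_continuous.
  apply: (@continuous_ang _ (fun=> e) (f \o clamp)); first exact: cst_continuous.
    apply: (continuous_comp (@continuous_clamp t)).
    by case: (nf _ (clamp01 t)).
  exact: He (clamp01 t).
- by move=> t t01; rewrite clampE//; apply: has_angle_step => //; exact: He.
Qed.

Definition nonzero_square (F : plane -> plane) : Prop :=
  forall x, unit_square x -> {for x, continuous F} /\ F x != 0.

(** The argument of [F] lifts over the whole square, so each turn is a difference of the lift at two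
    corners and both routes telescope. *)
Lemma turn_rectangle F a b c d : nonzero_square F ->
  0 <= a <= 1 -> 0 <= b <= 1 -> 0 <= c <= 1 -> 0 <= d <= 1 ->
  turn (fun t => F (t, c)) a b + turn (fun t => F (b, t)) c d =
  turn (fun t => F (a, t)) c d + turn (fun t => F (t, d)) a b.
Proof.
move=> nF a01 b01 c01 d01.
have [||Th cTh HTh] := @angle_lift_square F.
- by move=> x sx; case: (nF x sx).
- by move=> x sx; case: (nF x sx).
have hor e : 0 <= e <= 1 -> turn (fun t => F (t, e)) a b = Th (b, e) - Th (a, e).
  move=> e01; apply: (@turnE _ (fun t => Th (t, e))) => //.
    move=> t; apply: (@continuous_comp _ _ _ (fun t : R => (t, e)) Th); last exact: cTh.
    by apply: continuous_pair => //; exact: cst_continuous.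
  by move=> t t01; exact: HTh.
have ver e : 0 <= e <= 1 -> turn (fun t => F (e, t)) c d = Th (e, d) - Th (e, c).
  move=> e01; apply: (@turnE _ (fun t => Th (e, t))) => //.
    move=> t; apply: (@continuous_comp _ _ _ (fun t : R => (e, t)) Th); last exact: cTh.
    by apply: continuous_pair => //; exact: cst_continuous.
  by move=> t t01; exact: HTh.
by rewrite !hor// !ver//; ring.
Qed.

Lemma turn_homotopy F : nonzero_square F -> (forall s, F (s, 0) = F (s, 1)) ->
  turn (fun t => F (0, t)) 0 1 = turn (fun t => F (1, t)) 0 1.
Proof.
move=> nF closed; have I0 : 0 <= (0 : R) <= 1 by rewrite lexx ler01.
have I1 : 0 <= (1 : R) <= 1 by rewrite lexx ler01.
have := turn_rectangle nF I0 I1 I0 I1.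
have -> : (fun t => F (t, 0)) = (fun t => F (t, 1)) by exact/funext.
by rewrite addrC => /addIr.
Qed.

(** * Local index of a crossing *)

Definition chart (U : set plane) (h k : plane -> plane) (p : plane) : Prop :=
  let Q := [set y : plane | `|y.1| < 1 /\ `|y.2| < 1] in
  [/\ open U /\ U p,
      (forall x, U x -> {for x, continuous h}) /\
      (forall y, Q y -> {for y, continuous k}),
      (forall x, U x -> Q (h x) /\ k (h x) = x) /\
      (forall y, Q y -> U (k y) /\ h (k y) = y) &
      h p = (0, 0)].

Lemma continuous_distp (p : plane) : continuous (fun x : plane => dotp (x - p) (x - p)).
Proof.
move=> x; have cB : {for x, continuous (fun x : plane => x - p)}.
  by apply: continuousB => //; exact: cst_continuous.
exact: (continuous_dotp cB cB).
Qed.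

Lemma open_euclidean_ball (U : set plane) (p : plane) : open U -> U p ->
  exists2 rho, 0 < rho & forall x, dotp (x - p) (x - p) < rho ^+ 2 -> U x.
Proof.
move=> oU Up; have /nbhs_ballP[e /= e0 He] : nbhs p U by exact: open_nbhs_nbhs.
exists e => // x; rewrite /dotp /= => d; apply: He.
have e1 : (x.1 - p.1) ^+ 2 < e ^+ 2.
  by apply: le_lt_trans d; rewrite expr2 lerDl -expr2 sqr_ge0.
have e2 : (x.2 - p.2) ^+ 2 < e ^+ 2.
  by apply: le_lt_trans d; rewrite expr2 lerDr -expr2 sqr_ge0.
have nlt (a : R) : a ^+ 2 < e ^+ 2 -> `|a| < e.
  by rewrite -(real_normK (num_real a)) ltr_sqr ?nnegrE// ltW.
by split; rewrite -ball_normE /= distrC; exact: nlt.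
Qed.

(* In polar coordinates around [p] the loop [k \o c] contracts inside the round
   ball, and [h] carries the contraction back to the chart. *)
Lemma chart_loop U h k p rho (c : R -> plane) : chart U h k p -> 0 < rho ->
  (forall x, dotp (x - p) (x - p) < rho ^+ 2 -> U x) ->
  (forall t, 0 <= t <= 1 -> {for t, continuous c}) ->
  (forall t, 0 <= t <= 1 -> [/\ `|(c t).1| < 1, `|(c t).2| < 1 & c t != 0]) ->
  (forall t, 0 <= t <= 1 -> dotp (k (c t) - p) (k (c t) - p) < rho ^+ 2) ->
  c 0 = c 1 -> turn (fun t => k (c t) - p) 0 1 = 0 -> turn c 0 1 = 0.
Proof.
move=> [[oU Up] [ch ck] [hk kh] hp] rho0 HU cc Hc Hrho c01 T0.
have I0 : 0 <= (0 : R) <= 1 by rewrite lexx ler01.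
have I1 : 0 <= (1 : R) <= 1 by rewrite lexx ler01.
have nck : nonzero_path (fun t => k (c t) - p).
  move=> t t01; have [c1 c2 c0] := Hc t t01; split.
    apply: continuousB; last exact: cst_continuous.
    by apply: (continuous_comp (cc t t01)); exact: ck.
  rewrite subr_eq0; apply: contra c0 => /eqP kc; apply/eqP.
  by have [_ <-] := kh (c t) (conj c1 c2); rewrite kc hp.
have [th cth Hth] := path_lift nck.
have th01 : th 1 = th 0.
  by move: T0; rewrite (turnE cth Hth)// => /eqP; rewrite subr_eq0 => /eqP.
set ga := (fun t => k (c t) - p) in nck Hth.
pose r t := dotp (ga t) (cos (th t), sin (th t)).
have ccs t : {for t, continuous (fun t => (cos (th t), sin (th t)))}.
  apply: continuous_pair.
  - by apply: (continuous_comp (cth t)); exact: continuous_cos.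
  - by apply: (continuous_comp (cth t)); exact: continuous_sin.
have cr t : 0 <= t <= 1 -> {for t, continuous r}.
  by move=> t01; apply: continuous_dotp => //; case: (nck t t01).
have rE t : 0 <= t <= 1 -> 0 < r t /\ ga t = (r t * cos (th t), r t * sin (th t)).
  move=> t01; have [q q0] := Hth t t01; rewrite -/(ga t) => E.
  have -> : r t = q; last by rewrite E.
  rewrite /r E /dotp /= -!mulrA -mulrDr -!expr2 cos2Dsin2 mulr1 //.
have rrho t : 0 <= t <= 1 -> r t < rho.
  move=> t01; have [r0 E] := rE t t01.
  rewrite -ltr_sqr ?nnegrE ?ltW//; apply: le_lt_trans (Hrho t t01).
  rewrite -/(ga t) E /dotp /= -!expr2 !exprMn -mulrDr cos2Dsin2 mulr1 //.
have ga01 : ga 0 = ga 1 by rewrite /ga c01.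
have r01 : r 1 = r 0 by rewrite /r ga01 th01.
(* Radius and angle are interpolated separately. The radius stays in (0, rho), so the homotopy
   remains in [U] and misses [p]; [r01] and [th01] keep every intermediate curve closed. The zero
   turn is used exactly in [th01]. *)
pose G (x : plane) : plane :=
  let q := (1 - x.1) * r x.2 + x.1 * r 0 in
  let al := (1 - x.1) * th x.2 + x.1 * th 0 in
  p + (q * cos al, q * sin al).
have c1 (x : plane) : {for x, continuous (fun x : plane => 1 - x.1)}.
  by apply: continuousB; [exact: cst_continuous|exact: continuous_fst].
have cmix (f : R -> R) (x : plane) : {for x.2, continuous f} ->
   {for x, continuous (fun x : plane => (1 - x.1) * f x.2 + x.1 * f 0)}.
  move=> cf; apply: cvgD; apply: cvgM.
  - exact: c1.
  - by apply: (continuous_comp (@continuous_snd _ _ x)).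
  - exact: continuous_fst.
  - exact: cvg_cst.
have cG x : unit_square x -> {for x, continuous G}.
  move=> [x1 x2]; apply: continuousD; first exact: cst_continuous.
  apply: continuous_pair; apply: continuousM.
  - by apply: cmix; exact: cr.
  - by apply: (continuous_comp (cmix th x (cth _))); exact: continuous_cos.
  - by apply: cmix; exact: cr.
  - by apply: (continuous_comp (cmix th x (cth _))); exact: continuous_sin.
have GU x : unit_square x -> U (G x) /\ G x != p.
  move=> [/andP[x10 x11] x2]; have [r2 _] := rE _ x2; have [r0 _] := rE _ I0.
  set q := (1 - x.1) * r x.2 + x.1 * r 0; set al := (1 - x.1) * th x.2 + x.1 * th 0.
  have x1E : 1 <= x.1 -> x.1 = 1 by move=> ?; lra.
  have q0 : 0 < q.
    rewrite /q; have [x1|/x1E ->] := ltP x.1 1; last by rewrite subrr mul0r add0r mul1r.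
    by rewrite ltr_pwDl ?mulr_gt0 ?subr_gt0// mulr_ge0// ltW.
  have qrho : q < rho.
    have := rrho _ x2; have := rrho _ I0 => a0 a2.
    rewrite /q; have [x1|/x1E ->] := ltP x.1 1; last by rewrite subrr mul0r add0r mul1r.
    have -> : rho = (1 - x.1) * rho + x.1 * rho by ring.
    by rewrite ltr_leD// ?ltr_pM2l ?subr_gt0// ler_wpM2l// ltW.
  have GE : G x - p = (q * cos al, q * sin al) by rewrite /G addrAC subrr add0r.
  split.
    apply: HU; rewrite GE /dotp /= -!expr2 !exprMn -mulrDr cos2Dsin2 mulr1.
    by rewrite ltr_sqr ?nnegrE ?ltW.
  rewrite -subr_eq0 GE; apply: (has_angle_neq0 (th := al)); by exists q.
have nF : nonzero_square (h \o G).
  move=> x sx; have [UG Gp] := GU x sx; split.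
    by apply: (continuous_comp (cG x sx)); exact: ch.
  apply: contra Gp => /eqP /= hG0; apply/eqP.
  by have [_ <-] := hk _ UG; have [_ <-] := hk _ Up; rewrite hG0 hp.
have := turn_homotopy nF; rewrite /= => /(_ _)/wrap[].
  by move=> s; rewrite /G /= r01 th01.
have -> : turn (fun t => h (G (0, t))) 0 1 = turn c 0 1.
  apply: turn_ext => // t t01; first by split; [exact: cc|case: (Hc t t01)].
  have [_ E] := rE t t01; have [a1 a2 _] := Hc t t01.
  rewrite /G /= subr0 !mul1r !mul0r !addr0 -E /ga addrC subrK.
  by case: (kh (c t)).
move=> ->; rewrite (@turn_ext (fun=> h (G (1, 0)))) //.
- have nc : nonzero_path (fun=> h (G (1, 0))).
    move=> t t01; split; first exact: cst_continuous.
    by have [|_] := nF (1, 0); first by [].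
  (* The turn from 0 to 0 vanishes by additivity, and the constant path is its own reparametrisation
     by the constant 0. *)
  by have := turn_cat nc I0 I0 I0; have := turn_cat nc I0 I0 I1;
    have [th' cth' Hth'] := path_lift nc; have := turn_reparam nc (@cst_continuous _ _ (0:R)) (fun _ _ => I0) I0 I1; rewrite /comp /=; lra.
- move=> t t01; split; first exact: cst_continuous.
  by have [|_] := nF (1, 0); first by [].
- by move=> t t01; rewrite /G /= subrr !mul0r !add0r !mul1r.
Qed.

(** The boundary of the unit square, counterclockwise from the origin, a quarter of the time per
    side. Sums of clamped ramps make it one continuous formula without gluing. *)
Definition square_loop (t : R) : plane :=
  (clamp (4 * t) - clamp (4 * t - 2), clamp (4 * t - 1) - clamp (4 * t - 3)).

Definition square_boundary (x : plane) : Prop :=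
  unit_square x /\ [\/ x.1 = 0, x.1 = 1, x.2 = 0 | x.2 = 1].

Lemma continuous_affine a b : continuous (fun t : R => a * t + b).
Proof.
move=> t; apply: cvgD; last exact: cvg_cst.
by apply: cvgM; [exact: cvg_cst|exact: cvg_id].
Qed.

Lemma continuous_square_loop : continuous square_loop.
Proof.
move=> t; have c a : {for t, continuous (fun t : R => clamp (4 * t - a))}.
  apply: (@continuous_comp _ _ _ (fun t : R => 4 * t - a) clamp).
    exact: continuous_affine.
  exact: continuous_clamp.
have c0 : {for t, continuous (fun t : R => clamp (4 * t))}.
  have -> : (fun t : R => clamp (4 * t)) = fun t => clamp (4 * t - 0).
    by apply/funext => s; rewrite subr0.
  exact: c.
apply: (@continuous_pair _ _ _ (fun t : R => clamp (4 * t) - clamp (4 * t - 2))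
  (fun t : R => clamp (4 * t - 1) - clamp (4 * t - 3))); apply: cvgB.
- exact: c0.
- exact: c.
- exact: c.
- exact: c.
Qed.

Lemma square_loopE (t : R) : 0 <= t <= 1 ->
  [/\ square_loop ((0 + t) / 4) = (t, 0), square_loop ((1 + t) / 4) = (1, t),
      square_loop ((2 + t) / 4) = (1 - t, 1) & square_loop ((3 + t) / 4) = (0, 1 - t)].
Proof.
move=> t01; have /andP[t0 t1] := t01; rewrite /square_loop.
have E (i : R) : 4 * ((i + t) / 4) = i + t by field.
rewrite !E; split; congr (_, _).
- by rewrite add0r clampE// clamp0 ?subr0//; lra.
- by rewrite !clamp0 ?subr0//; lra.
- by rewrite clamp1 ?clamp0 ?subr0//; lra.
- by rewrite addrAC subrr add0r clampE// clamp0 ?subr0//; lra.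
- by rewrite clamp1 ?[2 + t]addrC ?addrK ?clampE//; lra.
- by rewrite clamp1 ?clamp0 ?subr0//; lra.
- by rewrite clamp1 ?clamp1 ?subrr//; lra.
- by rewrite clamp1 ?[3 + t]addrC ?addrK ?clampE//; lra.
Qed.

Lemma square_loop_closed : square_loop 0 = square_loop 1.
Proof.
have [|+ _ _ _] := @square_loopE 0; first by rewrite lexx ler01.
have [|_ _ _] := @square_loopE 1; first by rewrite lexx ler01.
have -> : ((3 : R) + 1) / 4 = 1 by field.
by move=> ->; rewrite addr0 mul0r subrr => ->.
Qed.

Lemma square_loop_boundary (t : R) : 0 <= t <= 1 -> square_boundary (square_loop t).
Proof.
move=> /andP[t0 t1].
have q (i : R) : i <= 4 * t <= i + 1 -> exists2 s, 0 <= s <= 1 & t = (i + s) / 4.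
  by move=> /andP[? ?]; exists (4 * t - i); [apply/andP; split; lra|field].
have B (x : plane) : 0 <= x.1 <= 1 -> 0 <= x.2 <= 1 -> [\/ x.1 = 0, x.1 = 1, x.2 = 0 | x.2 = 1] ->
   square_boundary x by [].
have I0 : 0 <= (0 : R) <= 1 by rewrite lexx ler01.
have I1 : 0 <= (1 : R) <= 1 by rewrite lexx ler01.
have [t4|t4] := lerP (4 * t) 1.
  have [|s s01 ->] := q 0; first by apply/andP; split; lra.
  by have [-> _ _ _] := square_loopE s01; apply: B => //; apply: Or43.
have [t5|t5] := lerP (4 * t) 2.
  have [|s s01 ->] := q 1; first by apply/andP; split; lra.
  by have [_ -> _ _] := square_loopE s01; apply: B => //; apply: Or42.
have [t6|t6] := lerP (4 * t) 3.
  have [|s s01 ->] := q 2; first by apply/andP; split; lra.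
  have [_ _ -> _] := square_loopE s01; apply: B => //; last exact: Or44.
  by move: s01 => /andP[? ?] /=; apply/andP; split; lra.
have [|s s01 ->] := q 3; first by apply/andP; split; lra.
have [_ _ _ ->] := square_loopE s01; apply: B => //; last exact: Or41.
by move: s01 => /andP[? ?] /=; apply/andP; split; lra.
Qed.

Lemma turnN f a b : nonzero_path f -> 0 <= a <= 1 -> 0 <= b <= 1 ->
  turn f b a = - turn f a b.
Proof.
by move=> nf a01 b01; have [th c H] := path_lift nf; rewrite !(turnE c H)//; ring.
Qed.

Lemma turn_square_loop F :
  (forall x, square_boundary x -> {for x, continuous F} /\ F x != 0) ->
  turn (F \o square_loop) 0 1 =
  turn (fun t => F (t, 0)) 0 1 + turn (fun t => F (1, t)) 0 1
  - turn (fun t => F (t, 1)) 0 1 - turn (fun t => F (0, t)) 0 1.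
Proof.
move=> HF.
have nF : nonzero_path (F \o square_loop).
  move=> t t01; have [cF F0] := HF _ (square_loop_boundary t01); split => //.
  by apply: (continuous_comp (@continuous_square_loop t)).
have I0 : 0 <= (0 : R) <= 1 by rewrite lexx ler01.
have I1 : 0 <= (1 : R) <= 1 by rewrite lexx ler01.
have Iq (i : R) : 0 <= i <= 4 -> 0 <= i / 4 <= 1.
  by move=> /andP[? ?]; apply/andP; split; lra.
have piece (i : R) : 0 <= i -> i + 1 <= 4 -> turn (F \o square_loop) (i / 4) ((i + 1) / 4) =
    turn (fun t => F (square_loop ((i + t) / 4))) 0 1.
  move=> i0 i4.
  have cphi : continuous (fun t : R => (i + t) / 4).
    have -> : (fun t : R => (i + t) / 4) = fun t => 4^-1 * t + i / 4.
      by apply/funext => t; rewrite mulrDl addrC [t / 4]mulrC.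
    exact: continuous_affine.
  have Hphi t : 0 <= t <= 1 -> 0 <= (i + t) / 4 <= 1.
    by move=> /andP[? ?]; apply: Iq; apply/andP; split; lra.
  by have := turn_reparam nF cphi Hphi I0 I1; rewrite addr0 => <-.
have on_boundary (q : R -> plane) : (forall t, 0 <= t <= 1 -> square_boundary (q t)) ->
    continuous q -> nonzero_path (F \o q).
  move=> Bq cq t t01; have [cF F0] := HF _ (Bq _ t01); split; last exact: F0.
  by apply: (continuous_comp (cq t)); exact: cF.
have side (p q : R -> plane) : (forall t, 0 <= t <= 1 -> square_boundary (q t)) -> continuous q ->
    (forall t, 0 <= t <= 1 -> p t = q t) -> turn (F \o p) 0 1 = turn (F \o q) 0 1.
  move=> Bq cq pq; apply: (turn_ext (on_boundary _ Bq cq) I0 I1).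
  by move=> t t01; rewrite /= pq.
have back (p q : R -> plane) : (forall t, 0 <= t <= 1 -> square_boundary (q t)) -> continuous q ->
    (forall t, 0 <= t <= 1 -> p t = q (1 - t)) -> turn (F \o p) 0 1 = - turn (F \o q) 0 1.
  move=> Bq cq pq; have nq := on_boundary _ Bq cq.
  have c1 : continuous (fun t : R => 1 - t).
    have -> : (fun t : R => 1 - t) = fun t => -1 * t + 1.
      by apply/funext => t; rewrite mulN1r addrC.
    exact: continuous_affine.
  have i1 (t : R) : 0 <= t <= 1 -> 0 <= 1 - t <= 1.
    by move=> /andP[? ?]; apply/andP; split; lra.
  rewrite -(turnN nq I0 I1); have := turn_reparam nq c1 i1 I0 I1.
  rewrite subr0 subrr => <-.
  have nq1 : nonzero_path (F \o q \o (fun t => 1 - t)).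
    apply: (on_boundary (q \o (fun t => 1 - t))) => [t t01|t]; first exact: Bq (i1 _ t01).
    by apply: (continuous_comp (c1 t)); exact: cq.
  by apply: (turn_ext nq1 I0 I1) => t t01; rewrite /= pq.
have c_l e : continuous (fun t : R => (t, e : R)).
  by move=> t; apply: continuous_pair => //; exact: cst_continuous.
have c_r e : continuous (fun t : R => (e : R, t)).
  by move=> t; apply: continuous_pair => //; exact: cst_continuous.
have e0 : turn (fun t => F (square_loop ((0 + t) / 4))) 0 1 = turn (fun t => F (t, 0)) 0 1.
  apply: (side (fun t => square_loop ((0 + t) / 4)) (fun t => (t, 0))) => // t t01.
  - by split => //; apply: Or43.
  - by case: (square_loopE t01).
have e1 : turn (fun t => F (square_loop ((1 + t) / 4))) 0 1 = turn (fun t => F (1, t)) 0 1.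
  apply: (side (fun t => square_loop ((1 + t) / 4)) (fun t => (1, t))) => // t t01.
  - by split => //; apply: Or42.
  - by case: (square_loopE t01).
have e2 : turn (fun t => F (square_loop ((2 + t) / 4))) 0 1 = - turn (fun t => F (t, 1)) 0 1.
  apply: (back (fun t => square_loop ((2 + t) / 4)) (fun t => (t, 1))) => // t t01.
  - by split => //; apply: Or44.
  - by case: (square_loopE t01).
have e3 : turn (fun t => F (square_loop ((3 + t) / 4))) 0 1 = - turn (fun t => F (0, t)) 0 1.
  apply: (back (fun t => square_loop ((3 + t) / 4)) (fun t => (0, t))) => // t t01.
  - by split => //; apply: Or41.
  - by case: (square_loopE t01).
rewrite -e0 -e1 -e2 -e3 -!piece //; try lra.
have -> : (0 : R) / 4 = 0 by rewrite mul0r.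
have -> : (0 : R) + 1 = 1 by rewrite add0r.
have -> : (1 : R) + 1 = 2 by ring.
have -> : (2 : R) + 1 = 3 by ring.
have -> : ((3 : R) + 1) / 4 = 1 by field.
by rewrite !turn_cat// Iq//; apply/andP; split; lra.
Qed.

Lemma atan_gt0 (x : R) : 0 < x -> 0 < atan x.
Proof. by rewrite -{2}(@atan0 R); exact: lt_atan. Qed.

Lemma atan_lt0 (x : R) : x < 0 -> atan x < 0.
Proof. by rewrite -{2}(@atan0 R); exact: lt_atan. Qed.

Lemma mulr_lt0_cases (a b : R) : a * b < 0 -> (a < 0 /\ 0 < b) \/ (0 < a /\ b < 0).
Proof.
have [a0|a0|->] := ltgtP a 0; last by rewrite mul0r ltxx.
- by rewrite nmulr_rlt0//; left.
- by rewrite pmulr_rlt0//; right.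
Qed.

Lemma mulr_lt0_neq0 (a b : R) : a * b < 0 -> a != 0 /\ b != 0.
Proof. by move=> /ltr0_neq0; rewrite mulf_eq0 negb_or => /andP. Qed.

Lemma axes_neq0 (X Y : R -> R) (x : plane) : X 0 * X 1 < 0 -> Y 0 * Y 1 < 0 ->
  square_boundary x -> (X x.1, - Y x.2) != 0.
Proof.
move=> /mulr_lt0_neq0[X0 X1] /mulr_lt0_neq0[Y0 Y1] [_ Hx].
rewrite -pair_eqE /pair_eq /= oppr_eq0 negb_and.
by case: Hx => ->; rewrite ?X0 ?X1 ?Y0 ?Y1 ?orbT.
Qed.

(* All four sides of the rectangle turn around the origin in the same direction. *)
Lemma turn_axes_neq0 (X Y : R -> R) :
  (forall t, 0 <= t <= 1 -> {for t, continuous X} /\ {for t, continuous Y}) ->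
  X 0 * X 1 < 0 -> Y 0 * Y 1 < 0 ->
  turn ((fun x : plane => (X x.1, - Y x.2)) \o square_loop) 0 1 != 0.
Proof.
move=> cXY X01 Y01.
have I0 : 0 <= (0 : R) <= 1 by rewrite lexx ler01.
have I1 : 0 <= (1 : R) <= 1 by rewrite lexx ler01.
have [X0 X1] := mulr_lt0_neq0 X01; have [Y0 Y1] := mulr_lt0_neq0 Y01.
have HF (x : plane) : square_boundary x ->
    {for x, continuous (fun x : plane => (X x.1, - Y x.2))} /\ (X x.1, - Y x.2) != (0, 0).
  move=> [[x1 x2] Hx]; split.
    apply: continuous_pair.
      apply: (@continuous_comp _ _ _ fst X); first exact: continuous_fst.
      by case: (cXY _ x1).
    apply: continuousN; apply: (@continuous_comp _ _ _ snd Y); first exact: continuous_snd.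
    by case: (cXY _ x2).
  exact: axes_neq0.
rewrite (turn_square_loop HF) /=.
have Bl c : c = 0 \/ c = 1 -> forall t, 0 <= t <= 1 -> square_boundary (t, c).
  move=> cE t t01; split; first by split => //=; case: cE => ->.
  by case: cE => ->; [apply: Or43|apply: Or44].
have Br c : c = 0 \/ c = 1 -> forall t, 0 <= t <= 1 -> square_boundary (c, t).
  move=> cE t t01; split; first by split => //=; case: cE => ->.
  by case: cE => ->; [apply: Or41|apply: Or42].
(* A side of the rectangle has one constant nonzero coordinate, so it lies in an open half-plane and
   its turn is a difference of two arctangents. *)
have hor c : c = 0 \/ c = 1 ->
    turn (fun t => (X t, - Y c)) 0 1 = atan (X 1 / Y c) - atan (X 0 / Y c).
  move=> cE; have Yc : Y c != 0 by case: cE => ->.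
  have nf : nonzero_path (fun t => (X t, - Y c)).
    move=> t t01; have [_ n0] := HF _ (Bl c cE t t01); split => //.
    apply: continuous_pair; last exact: cst_continuous.
    by case: (cXY t t01).
  rewrite (turn_halfplane (e := (0, - Y c)) nf)//.
    rewrite /ang /crossp /dotp /= !mul0r !sub0r !add0r !mulNr mulrN !opprK.
    by congr (atan _ - atan _); field.
  by move=> t t01; rewrite /dotp /= mul0r add0r mulrNN -expr2 exprn_even_gt0.
have ver c : c = 0 \/ c = 1 ->
    turn (fun t => (X c, - Y t)) 0 1 = atan (- Y 1 / X c) - atan (- Y 0 / X c).
  move=> cE; have Xc : X c != 0 by case: cE => ->.
  have nf : nonzero_path (fun t => (X c, - Y t)).
    move=> t t01; have [_ n0] := HF _ (Br c cE t t01); split => //.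
    apply: continuous_pair; first exact: cst_continuous.
    by apply: continuousN; case: (cXY t t01).
  rewrite (turn_halfplane (e := (X c, 0)) nf)//.
    rewrite /ang /crossp /dotp /= !mul0r !subr0 !addr0.
    by congr (atan _ - atan _); field.
  by move=> t t01; rewrite /dotp /= mul0r addr0 -expr2 exprn_even_gt0.
rewrite !hor ?ver; try by [left|right].
have pp (a b : R) : 0 < a -> 0 < b -> 0 < atan (a / b).
  by move=> a0 b0; rewrite atan_gt0// divr_gt0.
have pn (a b : R) : 0 < a -> b < 0 -> atan (a / b) < 0.
  by move=> a0 b0; rewrite atan_lt0// pmulr_rlt0// invr_lt0.
have np (a b : R) : a < 0 -> 0 < b -> atan (a / b) < 0.
  by move=> a0 b0; rewrite atan_lt0// nmulr_rlt0// invr_gt0.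
have nn (a b : R) : a < 0 -> b < 0 -> 0 < atan (a / b).
  by move=> a0 b0; rewrite atan_gt0// nmulr_rgt0// invr_lt0.
rewrite ![- Y _ / _]mulNr !atanN.
case: (mulr_lt0_cases X01) => -[x0 x1]; case: (mulr_lt0_cases Y01) => -[y0 y1].
- have := nn _ _ x0 y0; have := pn _ _ x1 y0; have := np _ _ x0 y1; have := pp _ _ x1 y1.
  have := nn _ _ y0 x0; have := pn _ _ y1 x0; have := np _ _ y0 x1; have := pp _ _ y1 x1.
  by move=> *; apply/eqP; lra.
- have := np _ _ x0 y0; have := pp _ _ x1 y0; have := nn _ _ x0 y1; have := pn _ _ x1 y1.
  have := pn _ _ y0 x0; have := nn _ _ y1 x0; have := pp _ _ y0 x1; have := np _ _ y1 x1.
  by move=> *; apply/eqP; lra.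
- have := pn _ _ x0 y0; have := nn _ _ x1 y0; have := pp _ _ x0 y1; have := np _ _ x1 y1.
  have := np _ _ y0 x0; have := pp _ _ y1 x0; have := nn _ _ y0 x1; have := pn _ _ y1 x1.
  by move=> *; apply/eqP; lra.
- have := pp _ _ x0 y0; have := np _ _ x1 y0; have := pn _ _ x0 y1; have := nn _ _ x1 y1.
  have := pp _ _ y0 x0; have := np _ _ y1 x0; have := pn _ _ y0 x1; have := nn _ _ y1 x1.
  by move=> *; apply/eqP; lra.
Qed.

(* The boundary loop of [k (X, 0) - k (0, Y)] is deformed into that of
   [k (X, - Y) - k (0, 0)]. *)
Lemma crossing_index U h k p rho (X Y : R -> R) : chart U h k p -> 0 < rho ->
  (forall x, dotp (x - p) (x - p) < rho ^+ 2 -> U x) ->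
  (forall t, 0 <= t <= 1 -> {for t, continuous X} /\ {for t, continuous Y}) ->
  (forall t, 0 <= t <= 1 -> `|X t| < 1 /\ `|Y t| < 1) ->
  (forall s t, 0 <= s <= 1 -> 0 <= t <= 1 ->
     dotp (k (X s, - Y t) - p) (k (X s, - Y t) - p) < rho ^+ 2) ->
  X 0 * X 1 < 0 -> Y 0 * Y 1 < 0 ->
  turn ((fun x : plane => k (X x.1, 0) - k (0, Y x.2)) \o square_loop) 0 1 != 0.
Proof.
move=> ch rho0 HU cXY XY1 Hrho X01 Y01.
have [[oU Up] [chh chk] [hk kh] hp] := ch.
have [X0 X1] := mulr_lt0_neq0 X01; have [Y0 Y1] := mulr_lt0_neq0 Y01.
(* The parameter [x.1] shifts [Y] from the second term to the first. If the two values of [k] agree,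
   then X = 0 and -s Y = (1 - s) Y, hence X = Y = 0, which cannot happen on the boundary of the
   square. *)
pose H (x : plane) : plane := let y := square_loop x.2 in
  k (X y.1, - (x.1 * Y y.2)) - k (0, (1 - x.1) * Y y.2).
have small (a y : R) : 0 <= a <= 1 -> `|y| < 1 -> `|a * y| < 1.
  move=> /andP[a0 a1] y1; rewrite normrM (ger0_norm a0).
  by apply: le_lt_trans y1; rewrite ler_piMl.
have csq1 x : {for x, continuous (fun x : plane => (square_loop x.2).1)}.
  apply: (@continuous_comp _ _ _ (square_loop \o snd) fst); last exact: continuous_fst.
  by apply: (continuous_comp (@continuous_snd _ _ x)); exact: continuous_square_loop.
have csq2 x : {for x, continuous (fun x : plane => (square_loop x.2).2)}.
  apply: (@continuous_comp _ _ _ (square_loop \o snd) snd); last exact: continuous_snd.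
  by apply: (continuous_comp (@continuous_snd _ _ x)); exact: continuous_square_loop.
have nH : nonzero_square H.
  move=> x [x1 x2]; have [[y1 y2] By] := square_loop_boundary x2.
  have [aX _] := XY1 _ y1; have [_ aY] := XY1 _ y2.
  have x1' : 0 <= 1 - x.1 <= 1 by move: x1 => /andP[? ?]; apply/andP; split; lra.
  have Q1 : `|X (square_loop x.2).1| < 1 /\ `|- (x.1 * Y (square_loop x.2).2)| < 1.
    by rewrite normrN; split => //; exact: small.
  have Q2 : `|(0 : R)| < 1 /\ `|(1 - x.1) * Y (square_loop x.2).2| < 1.
    by rewrite normr0; split => //; exact: small.
  have cX : {for x, continuous (fun x : plane => X (square_loop x.2).1)}.
    by apply: (continuous_comp (csq1 x)); case: (cXY _ y1).
  have cY : {for x, continuous (fun x : plane => Y (square_loop x.2).2)}.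
    by apply: (continuous_comp (csq2 x)); case: (cXY _ y2).
  split.
    apply: continuousB.
    - apply: (@continuous_comp _ _ _ (fun x : plane =>
        (X (square_loop x.2).1, - (x.1 * Y (square_loop x.2).2))) k); last exact: chk.
      apply: (continuous_pair cX); apply: cvgN.
      by apply: cvgM; [exact: continuous_fst|exact: cY].
    - apply: (@continuous_comp _ _ _ (fun x : plane =>
        (0, (1 - x.1) * Y (square_loop x.2).2)) k); last exact: chk.
      apply: continuous_pair; first exact: cst_continuous.
      apply: cvgM; last exact: cY.
      by apply: cvgB; [exact: cvg_cst|exact: continuous_fst].
  rewrite /H subr_eq0; apply/eqP => /(congr1 h).
  have [_ ->] := kh (X (square_loop x.2).1, - (x.1 * Y (square_loop x.2).2)) Q1.
  have [_ ->] := kh (0, (1 - x.1) * Y (square_loop x.2).2) Q2; move=> [EX EY].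
  have EX' : X (square_loop x.2).1 = 0 := EX.
  have EY' : Y (square_loop x.2).2 = 0.
    by move: EY; rewrite -[clamp _ - clamp _]/((square_loop x.2).2); lra.
  by case: By => E; move: EX' EY'; rewrite E => /eqP + /eqP;
    rewrite ?(negPf X0) ?(negPf X1) ?(negPf Y0) ?(negPf Y1).
have closed s : H (s, 0) = H (s, 1).
  by rewrite /H square_loop_closed.
have T := turn_homotopy nH closed.
have E0 : turn (fun t => H (0, t)) 0 1 =
    turn ((fun x : plane => k (X x.1, 0) - k (0, Y x.2)) \o square_loop) 0 1.
  by congr (turn _ 0 1); apply/funext => t; rewrite /H /= mul0r oppr0 addr0 mul1r.
rewrite -E0 T.
have k0 : k (0, 0) = p by have [_ <-] := hk _ Up; rewrite hp.
(* A homeomorphism cannot unwind a loop: if the turn of [k (X, - Y) - p] were 0, [chart_loop] would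
   give turn 0 to (X, - Y) itself. *)
apply/eqP => T0; have := turn_axes_neq0 cXY X01 Y01; apply/negP; rewrite negbK; apply/eqP.
apply: (chart_loop ch rho0 HU).
- move=> t t01; have [[y1 y2] By] := square_loop_boundary t01.
  apply: (@continuous_comp _ _ _ square_loop (fun x : plane => (X x.1, - Y x.2))).
    exact: continuous_square_loop.
  apply: continuous_pair.
    apply: (@continuous_comp _ _ _ fst X); first exact: continuous_fst.
    by case: (cXY _ y1).
  apply: continuousN; apply: (@continuous_comp _ _ _ snd Y); first exact: continuous_snd.
  by case: (cXY _ y2).
- move=> t t01; have [[y1 y2] By] := square_loop_boundary t01.
  have [aX _] := XY1 _ y1; have [_ aY] := XY1 _ y2; split => //=.
    by rewrite normrN.
  exact: (axes_neq0 X01 Y01 (square_loop_boundary t01)).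
- by move=> t t01; have [[y1 y2] By] := square_loop_boundary t01; exact: Hrho.
- by rewrite /comp square_loop_closed.
- rewrite -[RHS]T0; congr (turn _ 0 1); apply/funext => t.
  by rewrite /H /= subrr mul0r mul1r k0.
Qed.

Lemma segment01 a b t : 0 <= a -> a <= b -> b <= 1 -> 0 <= t <= 1 ->
  a <= (b - a) * t + a <= b.
Proof. by move=> a0 ab b1 /andP[t0 t1]; apply/andP; split; nra. Qed.

Lemma turn_segment f a b : nonzero_path f -> 0 <= a -> a <= b -> b <= 1 ->
  turn (fun t => f ((b - a) * t + a)) 0 1 = turn f a b.
Proof.
move=> nf a0 ab b1.
have I0 : 0 <= (0 : R) <= 1 by rewrite lexx ler01.
have I1 : 0 <= (1 : R) <= 1 by rewrite lexx ler01.
have := turn_reparam nf (@continuous_affine (b - a) a) _ I0 I1.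
rewrite /comp mulr0 add0r mulr1 subrK; apply => t /(segment01 a0 ab b1) /andP[? ?].
by apply/andP; split; lra.
Qed.

Lemma nonzero_diffl f (y : plane) : continuous f ->
  (forall t, 0 <= t <= 1 -> f t != y) -> nonzero_path (fun t => f t - y).
Proof.
move=> cf fy t t01; split; last by rewrite subr_eq0 fy.
by apply: continuousB; [exact: cf|exact: cst_continuous].
Qed.

Lemma nonzero_diffr f (y : plane) : continuous f ->
  (forall t, 0 <= t <= 1 -> y != f t) -> nonzero_path (fun t => y - f t).
Proof.
move=> cf fy t t01; split; last by rewrite subr_eq0 fy.
by apply: continuousB; [exact: cst_continuous|exact: cf].
Qed.

Definition diff_rect f g a b c d (x : plane) : plane :=
  f ((b - a) * x.1 + a) - g ((d - c) * x.2 + c).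

Lemma continuous_diff_rect f g a b c d : continuous f -> continuous g ->
  continuous (diff_rect f g a b c d).
Proof.
move=> cf cg x; apply: continuousB.
- apply: (@continuous_comp _ _ _ (fun x : plane => (b - a) * x.1 + a) f); last exact: cf.
  apply: (@continuous_comp _ _ _ fst (fun t : R => (b - a) * t + a)).
    exact: continuous_fst.
  exact: continuous_affine.
- apply: (@continuous_comp _ _ _ (fun x : plane => (d - c) * x.2 + c) g); last exact: cg.
  apply: (@continuous_comp _ _ _ snd (fun t : R => (d - c) * t + c)).
    exact: continuous_snd.
  exact: continuous_affine.
Qed.

(** This is [turn_rectangle] for (s, t) -> f s - g t. The first two nonvanishing hypotheses range
    over all of [0, 1] because [turn] is read from lifts over [0, 1]. *)
Lemma turn_two_paths f g a b c d : continuous f -> continuous g ->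
  0 <= a -> a <= b -> b <= 1 -> 0 <= c -> c <= d -> d <= 1 ->
  (forall s, 0 <= s <= 1 -> f s != g c /\ f s != g d) ->
  (forall t, 0 <= t <= 1 -> f a != g t /\ f b != g t) ->
  (forall s t, a <= s <= b -> c <= t <= d -> f s != g t) ->
  turn (fun s => f s - g c) a b + turn (fun t => f b - g t) c d =
  turn (fun t => f a - g t) c d + turn (fun s => f s - g d) a b.
Proof.
move=> cf cg a0 ab b1 c0 cd d1 Hcd Hab H.
have I0 : 0 <= (0 : R) <= 1 by rewrite lexx ler01.
have I1 : 0 <= (1 : R) <= 1 by rewrite lexx ler01.
have nc : nonzero_path (fun s => f s - g c) by apply: nonzero_diffl => // s /Hcd[].
have nd : nonzero_path (fun s => f s - g d) by apply: nonzero_diffl => // s /Hcd[].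
have na : nonzero_path (fun t => f a - g t) by apply: nonzero_diffr => // s /Hab[].
have nb : nonzero_path (fun t => f b - g t) by apply: nonzero_diffr => // s /Hab[].
rewrite -(turn_segment nc a0 ab b1) -(turn_segment nd a0 ab b1).
rewrite -(turn_segment na c0 cd d1) -(turn_segment nb c0 cd d1).
have nF : nonzero_square (diff_rect f g a b c d).
  move=> x [x1 x2]; split; first exact: continuous_diff_rect.
  by rewrite subr_eq0; apply: H; exact: segment01.
have := turn_rectangle nF I0 I1 I0 I1.
by rewrite /diff_rect /= !mulr0 !add0r !mulr1 !subrK.
Qed.

Lemma winding_const f g : continuous f -> continuous g -> f 0 = f 1 ->
  (forall s t, 0 <= s <= 1 -> 0 <= t <= 1 -> f s != g t) ->
  turn (fun s => f s - g 0) 0 1 = turn (fun s => f s - g 1) 0 1.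
Proof.
move=> cf cg f01 H.
have I0 : 0 <= (0 : R) <= 1 by rewrite lexx ler01.
have I1 : 0 <= (1 : R) <= 1 by rewrite lexx ler01.
have := @turn_two_paths f g 0 1 0 1 cf cg.
rewrite !lexx ler01 => /(_ isT isT isT isT isT isT); rewrite f01 => E.
by apply: (addIr (turn (fun t => f 1 - g t) 0 1)); rewrite [RHS]addrC; apply: E => // t t01;
  split; apply: H.
Qed.

(** The map (s, t) -> f s - g t vanishes only at (s0, t0), so the square minus a small rectangle
    around that point contributes nothing. [W1] and [W2] move t from 0 to c and from d to 1, [E1]
    and [E2] remove the strips on both sides of the rectangle, and the outer sides cancel because f
    0 = f 1. *)
Lemma winding_change f g s0 t0 a b c d : continuous f -> continuous g -> f 0 = f 1 ->
  (forall s t, 0 <= s <= 1 -> 0 <= t <= 1 -> f s = g t -> s = s0 /\ t = t0) ->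
  0 < a < s0 -> s0 < b < 1 -> 0 < c < t0 -> t0 < d < 1 ->
  turn (fun s => f s - g 0) 0 1 - turn (fun s => f s - g 1) 0 1 =
  turn (diff_rect f g a b c d \o square_loop) 0 1.
Proof.
move=> cf cg f01 H /andP[a0 as0] /andP[s0b b1] /andP[c0 ct0] /andP[t0d d1].
have Hl s t : 0 <= s <= 1 -> 0 <= t <= 1 -> s != s0 -> f s != g t.
  by move=> s01 t01; apply: contra => /eqP/(H _ _ s01 t01)[->].
have Hr s t : 0 <= s <= 1 -> 0 <= t <= 1 -> t != t0 -> f s != g t.
  by move=> s01 t01; apply: contra => /eqP/(H _ _ s01 t01)[_ ->].
have I0 : 0 <= (0 : R) <= 1 by rewrite lexx ler01.
have I1 : 0 <= (1 : R) <= 1 by rewrite lexx ler01.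
have Ia : 0 <= a <= 1 by apply/andP; split; lra.
have Ib : 0 <= b <= 1 by apply/andP; split; lra.
have Ic : 0 <= c <= 1 by apply/andP; split; lra.
have Id : 0 <= d <= 1 by apply/andP; split; lra.
have [ne0 ne1 nea neb] : [/\ 0 != s0, 1 != s0, a != s0 & b != s0].
  by split; apply/eqP; lra.
have [nf0 nf1 nfc nfd] : [/\ 0 != t0, 1 != t0, c != t0 & d != t0].
  by split; apply/eqP; lra.
have W1 : turn (fun s => f s - g 0) 0 1 = turn (fun s => f s - g c) 0 1.
  have := @turn_two_paths f g 0 1 0 c cf cg (lexx _) ler01 (lexx _) (lexx _) (ltW c0).
  rewrite f01 => E; apply: (addIr (turn (fun t => f 1 - g t) 0 c)); rewrite [RHS]addrC; apply: E.
  - by lra.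
  - by move=> s s01; split; exact: Hr.
  - by move=> t t01; split; exact: Hl.
  - by move=> s t s01 /andP[t0' tc]; apply: Hr => //; [apply/andP; split|apply/eqP]; lra.
have W2 : turn (fun s => f s - g d) 0 1 = turn (fun s => f s - g 1) 0 1.
  have := @turn_two_paths f g 0 1 d 1 cf cg (lexx _) ler01 (lexx _).
  rewrite f01 => E; apply: (addIr (turn (fun t => f 1 - g t) d 1)); rewrite [RHS]addrC; apply: E.
  - by lra.
  - by lra.
  - exact: lexx.
  - by move=> s s01; split; exact: Hr.
  - by move=> t t01; split; exact: Hl.
  - by move=> s t s01 /andP[t0' tc]; apply: Hr => //; [apply/andP; split|apply/eqP]; lra.
have cd : c <= d by lra.
have [a1' b1' c1' d1'] : [/\ a <= 1, b <= 1, c <= 1 & d <= 1] by split; lra.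
have b0' : 0 <= b by lra.
have E1 : turn (fun s => f s - g c) 0 a + turn (fun t => f a - g t) c d =
          turn (fun t => f 0 - g t) c d + turn (fun s => f s - g d) 0 a.
  apply: (turn_two_paths cf cg (lexx 0) (ltW a0) a1' (ltW c0) cd d1').
  - by move=> s s01; split; exact: Hr.
  - by move=> t t01; split; exact: Hl.
  - move=> s t /andP[s0' sa] /andP[tc td].
    by apply: Hl; [apply/andP; split|apply/andP; split|apply/eqP]; lra.
have E2 : turn (fun s => f s - g c) b 1 + turn (fun t => f 1 - g t) c d =
          turn (fun t => f b - g t) c d + turn (fun s => f s - g d) b 1.
  apply: (turn_two_paths cf cg b0' b1' (lexx 1) (ltW c0) cd d1').
  - by move=> s s01; split; exact: Hr.
  - by move=> t t01; split; exact: Hl.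
  - move=> s t /andP[s0' sa] /andP[tc td].
    by apply: Hl; [apply/andP; split|apply/andP; split|apply/eqP]; lra.
have nc : nonzero_path (fun s => f s - g c) by apply: nonzero_diffl => // s s01; exact: Hr.
have nd : nonzero_path (fun s => f s - g d) by apply: nonzero_diffl => // s s01; exact: Hr.
have na : nonzero_path (fun t => f a - g t) by apply: nonzero_diffr => // s s01; exact: Hl.
have nb : nonzero_path (fun t => f b - g t) by apply: nonzero_diffr => // s s01; exact: Hl.
have ab : a <= b by lra.
rewrite W1 -W2 turn_square_loop; last first.
  move=> x [[x1 x2] Hx]; split; first exact: continuous_diff_rect.
  rewrite /diff_rect subr_eq0.
  have /andP[sa sb] := segment01 (ltW a0) ab b1' x1.
  have /andP[tc td] := segment01 (ltW c0) cd d1' x2.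
  have s01 : 0 <= (b - a) * x.1 + a <= 1 by apply/andP; split; lra.
  have t01 : 0 <= (d - c) * x.2 + c <= 1 by apply/andP; split; lra.
  case: Hx => E; rewrite E in s01 t01 *.
  - by apply: Hl => //; rewrite mulr0 add0r.
  - by apply: Hl => //; rewrite mulr1 subrK.
  - by apply: Hr => //; rewrite mulr0 add0r.
  - by apply: Hr => //; rewrite mulr1 subrK.
have := turn_cat nc I0 Ia Ib; have := turn_cat nc I0 Ib I1.
have := turn_cat nd I0 Ia Ib; have := turn_cat nd I0 Ib I1.
rewrite /diff_rect /= !mulr0 !add0r !mulr1 !subrK.
rewrite (turn_segment nc)//; last exact: ltW.
rewrite (turn_segment nd)//; last exact: ltW.
rewrite (turn_segment na)//; last exact: ltW.
rewrite (turn_segment nb)//; last exact: ltW.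
by move: E1 E2; rewrite f01; lra.
Qed.

Lemma near_segment (P : set R) b : (\forall s \near b, P s) ->
  exists2 eta, 0 < eta & forall s, b - eta <= s <= b + eta -> P s.
Proof.
move=> /nbhs_ballP[e /= e0 He]; exists (e / 2); first by rewrite divr_gt0.
move=> s /andP[s1 s2]; apply: He; rewrite /ball /= distrC ltr_norml.
by apply/andP; split; lra.
Qed.

(** A continuous injection of an interval into the line is strictly monotone. *)
Lemma sign_change (x : R -> R) b eta : 0 < eta ->
  (forall s, b - eta <= s <= b + eta -> {for s, continuous x}) ->
  (forall s t, b - eta <= s <= b + eta -> b - eta <= t <= b + eta -> x s = x t -> s = t) ->
  x b = 0 -> x (b - eta) * x (b + eta) < 0.
Proof.
move=> eta0 cx ix xb.
have cI : {within `[b - eta, b + eta], continuous x}.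
  by apply: continuous_in_subspaceT => s; rewrite inE /= in_itv /=; exact: cx.
have iI : {in `[b - eta, b + eta] &, injective x}.
  by move=> s t; rewrite !in_itv /=; exact: ix.
have I1 : b - eta \in `[b - eta, b + eta] by rewrite in_itv /=; apply/andP; split; lra.
have I2 : b \in `[b - eta, b + eta] by rewrite in_itv /=; apply/andP; split; lra.
have I3 : b + eta \in `[b - eta, b + eta] by rewrite in_itv /=; apply/andP; split; lra.
have l1 : b - eta < b by lra.
have l2 : b < b + eta by lra.
have [H|H] := itv_continuous_inj_mono cI iI.
- have := H _ _ I1 I2 l1; have := H _ _ I2 I3 l2; rewrite xb => x1 x2.
  by rewrite nmulr_rlt0.
- have := H _ _ I2 I1 l1; have := H _ _ I3 I2 l2; rewrite xb => x1 x2.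
  by rewrite pmulr_rlt0.
Qed.

Lemma chart_origin U h k p : chart U h k p -> k (0, 0) = p.
Proof. by move=> [[_ Up] _ [hk _] <-]; case: (hk _ Up). Qed.

Lemma chart_box U h k p (V : set plane) : chart U h k p -> nbhs p V ->
  exists2 de, 0 < de <= 1 & forall y, `|y.1| < de -> `|y.2| < de -> V (k y).
Proof.
move=> ch Vp; have [_ [_ ck] _ _] := ch.
have : nbhs (0 : plane) (k @^-1` V).
  by apply: ck; rewrite /= ?normr0 ?ltr01// (chart_origin ch).
move=> /nbhs_ballP[e /= e0 He]; exists (Num.min e 1).
  by rewrite lt_min e0 ltr01 ge_min lexx orbT.
move=> y; rewrite !lt_min => /andP[y1 _] /andP[y2 _]; apply: He.
by split; rewrite /ball /= sub0r normrN.
Qed.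

Definition inj01 f := forall s t, 0 <= s <= 1 -> 0 <= t <= 1 -> f s = f t -> s = t.

(** [co] is the coordinate along the axis on which the chart places the arc, hence injective in the
    parameter; by [sign_change] the arc runs from one half of the axis to the other. The bounds
    [eta] and [de] let the piece be taken as small as needed. *)
Lemma arc_coordinate U h k p f (co : plane -> R) b eta de : chart U h k p ->
  continuous f -> continuous co -> co (0, 0) = 0 -> 0 < b < 1 -> f b = p ->
  (forall s t, 0 <= s <= 1 -> 0 <= t <= 1 -> U (f s) -> U (f t) ->
     co (h (f s)) = co (h (f t)) -> s = t) ->
  0 < eta -> 0 < de ->
  exists2 e, [/\ 0 < e, e <= eta, 0 < b - e & b + e < 1] &
    (forall s, b - e <= s <= b + e ->
      [/\ U (f s), {for s, continuous (fun s => co (h (f s)))} & `|co (h (f s))| < de]) /\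
    co (h (f (b - e))) * co (h (f (b + e))) < 0.
Proof.
move=> [[oU Up] [ch _] _ hp] cf cco co0 /andP[b0 b1] fb inj eta0 de0.
have cs s : U (f s) -> {for s, continuous (fun s => co (h (f s)))}.
  move=> Ufs; apply: (@continuous_comp _ _ _ (h \o f) co); last exact: cco.
  by apply: (@continuous_comp _ _ _ f h); [exact: cf|exact: ch].
have Uf : \forall s \near b, U (f s).
  by apply: cf; rewrite fb; exact: open_nbhs_nbhs.
have nde : \forall s \near b, `|co (h (f s))| < de.
  have := cs b; rewrite fb => /(_ Up) c.
  have := @cvgr_norm_lt _ _ _ _ _ _ _ c de; rewrite /= fb hp co0 normr0; exact.
have [e1 e10 H1] := near_segment Uf.
have [e2 e20 H2] := near_segment nde.
pose e := Num.min (Num.min e1 e2) (Num.min eta (Num.min (b / 2) ((1 - b) / 2))).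
have [ee1 ee2 eeta eb eb1] : [/\ e <= e1, e <= e2, e <= eta, e <= b / 2 & e <= (1 - b) / 2].
  by split; rewrite /e !ge_min lexx ?orbT.
have e0 : 0 < e by rewrite /e !lt_min e10 e20 eta0 !divr_gt0//; lra.
have He s : b - e <= s <= b + e -> U (f s) /\ `|co (h (f s))| < de.
  by move=> /andP[s1 s2]; split; [apply: H1|apply: H2]; apply/andP; split; lra.
exists e; first by split => //; lra.
split; first by move=> s /He[Ufs hs]; split => //; exact: cs.
apply: (sign_change (x := fun s => co (h (f s)))) => //.
- by move=> s /He[Ufs _]; exact: cs.
- move=> s t sI tI; have [Us _] := He _ sI; have [Ut _] := He _ tI.
  apply: inj => //; first by move: sI => /andP[? ?]; apply/andP; split; lra.
  by move: tI => /andP[? ?]; apply/andP; split; lra.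
- by rewrite fb hp.
Qed.

End Turning.

(** * Crossing arcs in a quadrilateral *)

Section PathCrossings.
Variable R : realType.
Local Notation plane := (R * R)%type.
Implicit Types (u v w : plane) (f g : R -> plane) (F : plane -> plane) (a b c d : R).

Lemma in01 lo hi (x : R) : 0 <= lo -> lo <= x -> x <= hi -> hi <= 1 -> 0 <= x <= 1.
Proof. by move=> l0 lx xh h1; rewrite (le_trans l0 lx) (le_trans xh h1). Qed.

Lemma oo_cc01 (x : R) : 0 < x < 1 -> 0 <= x <= 1.
Proof. by move=> /andP[/ltW -> /ltW ->]. Qed.

Lemma segment_ends (b e : R) : 0 < e -> b - e <= b - e <= b + e /\ b - e <= b + e <= b + e.
Proof. by move=> e0; split; apply/andP; split; lra. Qed.

(** The closed curve that follows [fA] from parameter [a], then [fB], then [fC] up to parameter [c].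
    For the outer pieces only the set traversed is recorded; the exact clock on [fB] is kept for the
    local index at the crossing with the fourth arc. *)
Definition loop_along (fA fB fC : R -> plane) a c (J : R -> plane) : Prop :=
  [/\ continuous J, J 0 = J 1,
      forall t, 0 <= t <= 1 ->
        [\/ exists2 s, a <= s <= 1 & J t = fA s,
            [/\ 0 <= 3 * t - 1 <= 1 & J t = fB (3 * t - 1)] |
            exists2 s, 0 <= s <= c & J t = fC s] &
      forall t, 1 <= 3 * t -> 3 * t <= 2 -> J t = fB (3 * t - 1)].

Lemma exists_loop_along (fA fB fC : R -> plane) a c :
  continuous fA -> continuous fB -> continuous fC -> fA 1 = fB 0 -> fB 1 = fC 0 ->
  0 < a < 1 -> 0 < c < 1 -> fA a = fC c -> exists J, loop_along fA fB fC a c J.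
Proof.
move=> cA cB cC AB1 BC1 /andP[a0 a1] /andP[c0 c1] fAC.
have cc m n : continuous (fun t : R => clamp (m * t + n)).
  move=> t; apply: (@continuous_comp _ _ _ (fun t : R => m * t + n) (fun x : R => clamp x)).
    exact: continuous_affine.
  exact: continuous_clamp.
(* Each arc moves only during its own third of the time and rests at a joint otherwise; the
   subtracted constants [fA 1] and [fB 1] cancel the two resting terms. *)
pose J (t : R) : plane := fA ((1 - a) * clamp (3 * t + 0) + a) + fB (clamp (3 * t + -1)) - fA 1
  + fC (c * clamp (3 * t + -2) + 0) - fB 1.
have cJ1 : continuous (fun t : R => fA ((1 - a) * clamp (3 * t + 0) + a)).
  move=> t; apply: (@continuous_comp _ _ _ (fun t : R => (1 - a) * clamp (3 * t + 0) + a) fA); last exact: cA.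
  apply: (@continuous_comp _ _ _ (fun t : R => clamp (3 * t + 0)) (fun t : R => (1 - a) * t + a)).
    exact: cc.
  exact: continuous_affine.
have cJ2 : continuous (fun t : R => fB (clamp (3 * t + -1))).
  by move=> t; apply: (@continuous_comp _ _ _ (fun t : R => clamp (3 * t + -1)) fB); [exact: cc|exact: cB].
have cJ3 : continuous (fun t : R => fC (c * clamp (3 * t + -2) + 0)).
  move=> t; apply: (@continuous_comp _ _ _ (fun t : R => c * clamp (3 * t + -2) + 0) fC); last exact: cC.
  apply: (@continuous_comp _ _ _ (fun t : R => clamp (3 * t + -2)) (fun t : R => c * t + 0)).
    exact: cc.
  exact: continuous_affine.
have cJ : continuous J.
  move=> t; apply: cvgB; last exact: cvg_cst.
  apply: cvgD; last exact: cJ3.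
  apply: cvgB; last exact: cvg_cst.
  by apply: cvgD; [exact: cJ1|exact: cJ2].
have JA t : 0 <= t -> 3 * t <= 1 -> J t = fA ((1 - a) * (3 * t) + a).
  move=> t0 t1.
  have k1 : clamp (3 * t + 0) = 3 * t by rewrite addr0 clampE//; apply/andP; split; lra.
  have k2 : clamp (3 * t + -1) = 0 by apply: clamp0; lra.
  have k3 : clamp (3 * t + -2) = 0 by apply: clamp0; lra.
  by rewrite /J k1 k2 k3 mulr0 !addr0 AB1 addrK BC1 addrK.
have JB t : 1 <= 3 * t -> 3 * t <= 2 -> J t = fB (3 * t - 1).
  move=> t0 t1.
  have k1 : clamp (3 * t + 0) = 1 by apply: clamp1; lra.
  have k2 : clamp (3 * t + -1) = 3 * t - 1 by rewrite clampE//; apply/andP; split; lra.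
  have k3 : clamp (3 * t + -2) = 0 by apply: clamp0; lra.
  by rewrite /J k1 k2 k3 mulr1 mulr0 !addr0 subrK [fA 1 + _]addrC addrK BC1 addrK.
have JC t : 2 <= 3 * t -> t <= 1 -> J t = fC (c * (3 * t - 2)).
  move=> t0 t1.
  have k1 : clamp (3 * t + 0) = 1 by apply: clamp1; lra.
  have k2 : clamp (3 * t + -1) = 1 by apply: clamp1; lra.
  have k3 : clamp (3 * t + -2) = 3 * t - 2 by rewrite clampE//; apply/andP; split; lra.
  by rewrite /J k1 k2 k3 mulr1 !addr0 subrK [fA 1 + _]addrC addrK [fB 1 + _]addrC addrK.
exists J; split => //.
  have j0 : 3 * (0 : R) <= 1 by lra.
  have j1 : 2 <= 3 * (1 : R) by lra.
  rewrite JA// JC// !mulr0 add0r fAC; congr fC; lra.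
move=> t /andP[t0 t1]; have [l1|l1] := lerP (3 * t) 1.
  apply: Or31; exists ((1 - a) * (3 * t) + a); last exact: JA.
  by apply/andP; split; nra.
have [l2|l2] := lerP (3 * t) 2.
  by apply: Or32; split; [apply/andP; split|apply: JB]; lra.
apply: Or33; exists (c * (3 * t - 2)); last by apply: JC; lra.
by apply/andP; split; nra.
Qed.

Lemma chart_axes U h k p f : chart U h k p ->
  ((forall s, 0 <= s <= 1 -> U (f s) -> (h (f s)).2 = 0) ->
    forall s, 0 <= s <= 1 -> U (f s) -> f s = k ((h (f s)).1, 0)) /\
  ((forall s, 0 <= s <= 1 -> U (f s) -> (h (f s)).1 = 0) ->
    forall s, 0 <= s <= 1 -> U (f s) -> f s = k (0, (h (f s)).2)).
Proof.
move=> [_ _ [hk _] _]; split => H s s01 Us; have := H s s01 Us;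
  have [_] := hk _ Us; case: (h (f s)) => x y /= <- -> //.
Qed.

(* At the first crossing the two branches outside the loop are joined across a
   quadrant of the chart. *)
Lemma winding_first_crossing (fA fB fC : R -> plane) a c U h k p J :
  [/\ continuous fA, continuous fB & continuous fC] -> inj01 fA -> inj01 fC ->
  0 < a < 1 -> 0 < c < 1 ->
  (forall s t, 0 <= s <= 1 -> 0 <= t <= 1 -> fA s = fB t -> s = 1) ->
  (forall s t, 0 <= s <= 1 -> 0 <= t <= 1 -> fB s = fC t -> t = 0) ->
  (forall s t, 0 <= s <= 1 -> 0 <= t <= 1 -> fA s = fC t -> s = a /\ t = c) ->
  chart U h k p -> fA a = p -> fC c = p ->
  (forall s, 0 <= s <= 1 -> U (fA s) -> (h (fA s)).2 = 0) ->
  (forall s, 0 <= s <= 1 -> U (fC s) -> (h (fC s)).1 = 0) ->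
  loop_along fA fB fC a c J ->
  turn (fun s => J s - fA 0) 0 1 = turn (fun s => J s - fC 1) 0 1.
Proof.
move=> [cA cB cC] iA iC a01 c01 AB BC AC ch fAa fCc UA UC [cJ J01 Jcase _].
have Ia := oo_cc01 a01; have Ic := oo_cc01 c01.
have [/andP[a0 a1] /andP[c0 c1]] := (a01, c01).
have [kA _] := chart_axes fA ch; have {}kA := kA UA.
have [_ kC] := chart_axes fC ch; have {}kC := kC UC.
(* The arc [fB] is compact and misses [p], so a small box of the chart is free of it; inside that
   box the loop lies on the two axes. *)
have nBp : nbhs p (~` (fB @` `[0, 1])).
  apply: open_nbhs_nbhs; split.
    apply: closed_openC; apply: compact_closed; first exact: norm_hausdorff.
    by apply: continuous_compact; [exact: continuous_subspaceT|exact: segment_compact].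
  move=> [s]; rewrite /= in_itv /= => s01; rewrite -fAa => /esym/(AB _ _ Ia s01) E.
  by rewrite E ltxx in a1.
have [de /andP[de0 de1] Hde] := chart_box ch nBp.
have injA s t : 0 <= s <= 1 -> 0 <= t <= 1 -> U (fA s) -> U (fA t) ->
    (h (fA s)).1 = (h (fA t)).1 -> s = t.
  by move=> s01 t01 Us Ut E; apply: iA => //; rewrite kA// E -kA.
have injC s t : 0 <= s <= 1 -> 0 <= t <= 1 -> U (fC s) -> U (fC t) ->
    (h (fC s)).2 = (h (fC t)).2 -> s = t.
  by move=> s01 t01 Us Ut E; apply: iC => //; rewrite kC// E -kC.
have [ea [ea0 _ ea1 _] [Hea _]] := arc_coordinate ch cA (@continuous_fst _ _) erefl a01 fAa injA ltr01 de0.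
have [ec [ec0 _ _ ec1] [Hec _]] := arc_coordinate ch cC (@continuous_snd _ _) erefl c01 fCc injC ltr01 de0.
have [Ufa _ x1] := Hea _ (segment_ends a ea0).1.
have [Ufc _ y1] := Hec _ (segment_ends c ec0).2.
have aea : a - ea < a by rewrite gtrBl.
have cec : c < c + ec by rewrite ltrDl.
have Iea : 0 <= a - ea <= 1 by rewrite (ltW ea1) (ltW (lt_trans aea a1)).
have Iec : 0 <= c + ec <= 1 by rewrite (ltW ec1) (ltW (lt_trans c0 cec)).
have {}kA := kA _ Iea Ufa; have {}kC := kC _ Iec Ufc.
move: (a - ea) (c + ec) aea cec Iea Iec x1 y1 Ufa Ufc kA kC ea1 ec1 => a' c' aa' cc' Ia' Ic'.
move=> x1 y1 Ufa Ufc kA kC a'0 c'1 {ea ec ea0 ec0 Hea Hec injA injC}.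
have JnA s t : 0 <= s <= 1 -> 0 <= t -> t <= a' -> J s != fA t.
  move=> s01 t0 ta; have ta1 := le_lt_trans ta aa'; have t01 := in01 t0 (lexx _) (ltW ta1) (ltW a1).
  apply/eqP => E; case: (Jcase s s01) => [[s' /andP[s1 s2]]|[s01']|[s' /andP[s1 s2]]] E'; rewrite E' in E.
  - have := iA _ _ (in01 (ltW a0) s1 s2 (lexx _)) t01 E => e.
    by move: s1; rewrite e leNgt ta1.
  - by have e := AB _ _ t01 s01' (esym E); move: ta1; rewrite e ltNge (ltW a1).
  - have [e _] := AC _ _ t01 (in01 (lexx 0) s1 s2 (ltW c1)) (esym E).
    by move: ta1; rewrite e ltxx.
have JnC s t : 0 <= s <= 1 -> c' <= t -> t <= 1 -> J s != fC t.
  move=> s01 ct t1; have ct1 := lt_le_trans cc' ct; have t01 := in01 (ltW c0) (ltW ct1) t1 (lexx _).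
  apply/eqP => E; case: (Jcase s s01) => [[s' /andP[s1 s2]]|[s01']|[s' /andP[s1 s2]]] E'; rewrite E' in E.
  - have [_ e] := AC _ _ (in01 (ltW a0) s1 s2 (lexx _)) t01 E.
    by move: ct1; rewrite e ltxx.
  - by have e := BC _ _ s01' t01 E; move: ct1; rewrite e ltNge (ltW c0).
  - have e := iC _ _ (in01 (lexx 0) s1 s2 (ltW c1)) t01 E.
    by move: s2; rewrite e leNgt ct1.
pose W (x : plane) := turn (fun s => J s - x) 0 1; rewrite -/(W (fA 0)) -/(W (fC 1)).
have W1 : W (fA 0) = W (fA a').
  have := winding_const (f := J) (g := fun t => fA ((a' - 0) * t + 0)) cJ _ J01.
  rewrite mulr0 mulr1 !subr0 !addr0; apply.
    move=> t; apply: (@continuous_comp _ _ _ (fun t : R => a' * t + 0) fA); last exact: cA.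
    exact: continuous_affine.
  move=> s t s01 /(segment01 (lexx 0) (ltW a'0) (le_trans (ltW aa') (ltW a1))).
  by rewrite subr0 => /andP[? ?]; apply: JnA.
have W3 : W (fC c') = W (fC 1).
  have := winding_const (f := J) (g := fun t => fC ((1 - c') * t + c')) cJ _ J01.
  rewrite mulr0 mulr1 add0r subrK; apply.
    move=> t; apply: (@continuous_comp _ _ _ (fun t : R => (1 - c') * t + c') fC); last exact: cC.
    exact: continuous_affine.
  move=> s t s01 /(segment01 (le_trans (ltW c0) (ltW cc')) (ltW c'1) (lexx 1)).
  by move=> /andP[? ?]; apply: JnC.
rewrite W1 -W3; move: kA kC x1 y1; set xa := (h (fA a')).1; set yc := (h (fC c')).2.
move=> kA kC x1 y1 {W1 W3 JnA JnC}.
have [_ [_ chk] [_ kh] _] := ch.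
(* The straight segment in the chart from [fA a'] to [fC c']. It meets the axes only at its ends,
   and these lie on the parts of [fA] and [fC] that the loop omits, so the winding number is
   constant along it. *)
pose g (t : R) : plane := ((1 - clamp t) * xa, clamp t * yc).
have small t : `|(g t).1| < de /\ `|(g t).2| < de.
  have /andP[t0 t1] := clamp01 t; rewrite /g /= !normrM (ger0_norm t0) ger0_norm ?subr_ge0//.
  by split; [apply: le_lt_trans x1|apply: le_lt_trans y1]; rewrite ler_piMl// gerBl.
have small1 t : `|(g t).1| < 1 /\ `|(g t).2| < 1.
  by have [l1 l2] := small t; rewrite !(lt_le_trans _ de1).
have cg : continuous g.
  move=> t; apply: (@continuous_pair _ _ _ (fun t => (1 - clamp t) * xa) (fun t => clamp t * yc)).
    apply: cvgM; last exact: cvg_cst.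
    by apply: cvgB; [exact: cvg_cst|exact: continuous_clamp].
  by apply: cvgM; [exact: continuous_clamp|exact: cvg_cst].
have ckg : continuous (k \o g).
  by move=> t; apply: (continuous_comp (cg t)); apply: chk; exact: small1.
have := winding_const cJ ckg J01; rewrite /= /g (clamp0 (t := 0))// (clamp1 (t := 1))//.
rewrite subr0 mul1r !mul0r subrr mul0r mul1r -kA -kC; apply => s t s01 t01.
rewrite clampE//; apply/eqP => E.
have [Uk hkg] := kh _ (small1 t); rewrite /g clampE// in Uk hkg.
case: (Jcase s s01) => [[s' /andP[s1 s2]]|[s01']|[s' /andP[s1 s2]]] E'; rewrite E' in E.
- have Is := in01 (ltW a0) s1 s2 (lexx _).
  have := UA s' Is; rewrite E => /(_ Uk); rewrite hkg /= => /eqP.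
  rewrite mulf_eq0 => /orP[/eqP t0|/eqP yc0].
    move: E; rewrite t0 subr0 mul1r mul0r -kA => /(iA _ _ Is Ia') e.
    by move: s1; rewrite e leNgt aa'.
  move: cc'; suff -> : c' = c by rewrite ltxx.
  by apply: iC => //; rewrite kC yc0 fCc (chart_origin ch).
- have [d1 d2] := small t; apply: (Hde _ d1 d2).
  exists (3 * s - 1); first by rewrite /= in_itv.
  by rewrite E /g clampE.
- have Is := in01 (lexx 0) s1 s2 (ltW c1).
  have := UC s' Is; rewrite E => /(_ Uk); rewrite hkg /= => /eqP.
  rewrite mulf_eq0 => /orP[/eqP t0|/eqP xa0].
    have t1 : t = 1 by apply/eqP; rewrite eq_sym -subr_eq0 t0.
    move: E; rewrite t1 subrr mul1r mul0r -kC => /(iC _ _ Is Ic') e.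
    by move: s2; rewrite e leNgt cc'.
  move: aa'; suff -> : a' = a by rewrite ltxx.
  by apply: iA => //; rewrite kA xa0 fAa (chart_origin ch).
Qed.

(** The loop meets [fE] only where [fB] does. So [winding_change] expresses the difference as the
    turn around a small rectangle, and in the chart this becomes the nonzero turn of
    [crossing_index]. *)
Lemma winding_second_crossing (fA fB fC fE : R -> plane) a c b e U h k q J :
  [/\ continuous fB & continuous fE] -> inj01 fB -> inj01 fE ->
  0 < a < 1 -> 0 < c < 1 -> 0 < b < 1 -> 0 < e < 1 ->
  (forall s t, 0 <= s <= 1 -> 0 <= t <= 1 -> fE s = fA t -> t = 0) ->
  (forall s t, 0 <= s <= 1 -> 0 <= t <= 1 -> fC s = fE t -> s = 1) ->
  (forall s t, 0 <= s <= 1 -> 0 <= t <= 1 -> fB s = fE t -> s = b /\ t = e) ->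
  chart U h k q -> fB b = q -> fE e = q ->
  (forall s, 0 <= s <= 1 -> U (fB s) -> (h (fB s)).2 = 0) ->
  (forall s, 0 <= s <= 1 -> U (fE s) -> (h (fE s)).1 = 0) ->
  loop_along fA fB fC a c J ->
  turn (fun s => J s - fE 0) 0 1 != turn (fun s => J s - fE 1) 0 1.
Proof.
move=> [cB cE] iB iE a01 c01 b01 e01 EA CE BE ch fBb fEe UB UE [cJ J01 Jcase JB].
have [/andP[a0 a1] /andP[c0 c1]] := (a01, c01).
have JE s t : 0 <= s <= 1 -> 0 <= t <= 1 -> J s = fE t -> s = (b + 1) / 3 /\ t = e.
  move=> s01 t01 E; case: (Jcase s s01) => [[s' /andP[s1 s2]]|[s01']|[s' /andP[s1 s2]]] E'; rewrite E' in E.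
  - have := EA _ _ t01 (in01 (ltW a0) s1 s2 (lexx _)) (esym E) => e0.
    by move: (lt_le_trans a0 s1); rewrite e0 ltxx.
  - by have [<- ->] := BE _ _ s01' t01 E; split => //; rewrite subrK mulrC mulKf.
  - have := CE _ _ (in01 (lexx 0) s1 s2 (ltW c1)) t01 E => e1.
    by move: (le_lt_trans s2 c1); rewrite e1 ltxx.
have [_ [_ _] [hk _] _] := ch.
have [kB _] := chart_axes fB ch; have {}kB := kB UB.
have [_ kE] := chart_axes fE ch; have {}kE := kE UE.
have injB s t : 0 <= s <= 1 -> 0 <= t <= 1 -> U (fB s) -> U (fB t) ->
    (h (fB s)).1 = (h (fB t)).1 -> s = t.
  by move=> s01 t01 Us Ut E; apply: iB => //; rewrite kB// E -kB.
have injE s t : 0 <= s <= 1 -> 0 <= t <= 1 -> U (fE s) -> U (fE t) ->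
    (h (fE s)).2 = (h (fE t)).2 -> s = t.
  by move=> s01 t01 Us Ut E; apply: iE => //; rewrite kE// E -kE.
have [[oU Uq] _ _ _] := ch.
have [rho rho0 Hrho] := open_euclidean_ball oU Uq.
have nq : nbhs q (fun x => dotp (x - q) (x - q) < rho ^+ 2).
  apply: (cvgr_lt _ (@continuous_distp _ q q)).
  by rewrite subrr /dotp /= mulr0 addr0 exprn_gt0.
have [de /andP[de0 de1] Hde] := chart_box ch nq.
have [eb [eb0 _ eb1 eb2] [Heb Xeb]] := arc_coordinate ch cB (@continuous_fst _ _) erefl b01 fBb injB ltr01 de0.
have [ee [ee0 _ ee1 ee2] [Hee Xee]] := arc_coordinate ch cE (@continuous_snd _ _) erefl e01 fEe injE ltr01 de0.
have {Jcase EA CE BE injB injE iB iE} _ := I.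
(* The parameters [b - eb] and [b + eb] of [fB] on the clock of the loop, which is at [fB s] at time
   (s + 1) / 3. *)
pose s1 := (b - eb + 1) / 3; pose s2 := (b + eb + 1) / 3.
have chg : turn (fun s => J s - fE 0) 0 1 - turn (fun s => J s - fE 1) 0 1 =
    turn (diff_rect J fE s1 s2 (e - ee) (e + ee) \o square_loop (R := R)) 0 1.
  by apply: (winding_change cJ cE J01 JE); rewrite /s1 /s2; apply/andP; split;
    clear -eb0 ee0 eb1 eb2 ee1 ee2; lra.
rewrite -subr_eq0 chg {chg}.
pose sB t := (b + eb - (b - eb)) * t + (b - eb); pose sE t := (e + ee - (e - ee)) * t + (e - ee).
pose X t := (h (fB (sB t))).1; pose Y t := (h (fE (sE t))).2.
have beb : b - eb <= b + eb by clear -eb0; lra.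
have eee : e - ee <= e + ee by clear -ee0; lra.
have IsB t : 0 <= t <= 1 -> b - eb <= sB t <= b + eb.
  exact: (segment01 (ltW eb1) beb (ltW eb2)).
have IsE t : 0 <= t <= 1 -> e - ee <= sE t <= e + ee.
  exact: (segment01 (ltW ee1) eee (ltW ee2)).
have XE t : 0 <= t <= 1 -> fB (sB t) = k (X t, 0).
  move=> t01; have [Us _ _] := Heb _ (IsB _ t01); apply: kB => //.
  by have /andP[l1 l2] := IsB _ t01; exact: in01 (ltW eb1) l1 l2 (ltW eb2).
have YE t : 0 <= t <= 1 -> fE (sE t) = k (0, Y t).
  move=> t01; have [Us _ _] := Hee _ (IsE _ t01); apply: kE => //.
  by have /andP[l1 l2] := IsE _ t01; exact: in01 (ltW ee1) l1 l2 (ltW ee2).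
have cX t : 0 <= t <= 1 -> {for t, continuous X}.
  move=> t01; have [_ cs _] := Heb _ (IsB _ t01).
  by apply: (@continuous_comp _ _ _ sB (fun s => (h (fB s)).1)); [exact: continuous_affine|exact: cs].
have cY t : 0 <= t <= 1 -> {for t, continuous Y}.
  move=> t01; have [_ cs _] := Hee _ (IsE _ t01).
  by apply: (@continuous_comp _ _ _ sE (fun s => (h (fE s)).2)); [exact: continuous_affine|exact: cs].
have sX t : 0 <= t <= 1 -> `|X t| < de by move=> /IsB/Heb[].
have sY t : 0 <= t <= 1 -> `|Y t| < de by move=> /IsE/Hee[].
have X01 : X 0 * X 1 < 0 by rewrite /X /sB mulr0 add0r mulr1 subrK.
have Y01 : Y 0 * Y 1 < 0 by rewrite /Y /sE mulr0 add0r mulr1 subrK.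
have N0 : turn ((fun x : plane => k (X x.1, 0) - k (0, Y x.2)) \o square_loop (R := R)) 0 1 != 0.
  apply: (crossing_index (X := X) (Y := Y) ch rho0 Hrho _ _ _ X01 Y01) => [t t01|t t01|s t s01 t01].
  - by split; [exact: cX|exact: cY].
  - by rewrite !(lt_le_trans _ de1)//; [exact: sY|exact: sX].
  - by apply: Hde; rewrite /= ?normrN; [exact: sX|exact: sY].
have JB' x : 0 <= x <= 1 -> J ((s2 - s1) * x + s1) = fB (sB x).
  move=> x01; have /andP[l1 l2] := IsB _ x01.
  have E : 3 * ((s2 - s1) * x + s1) = sB x + 1 by rewrite /s1 /s2 /sB; field.
  by rewrite JB E ?addrK// ?lerDr ?(le_trans (ltW eb1))//; clear -l2 eb2; lra.
have E t : 0 <= t <= 1 -> (diff_rect J fE s1 s2 (e - ee) (e + ee) \o square_loop (R := R)) t =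
    ((fun x : plane => k (X x.1, 0) - k (0, Y x.2)) \o square_loop (R := R)) t.
  move=> t01; have [[y1 y2] _] := square_loop_boundary t01.
  by rewrite /comp /diff_rect -XE// -YE// JB'.
apply: contra N0 => /eqP Z0; apply/eqP; rewrite -[RHS]Z0.
apply: turn_ext.
- move=> t t01; have [[y1 y2] By] := square_loop_boundary t01; split.
    apply: (@continuous_comp _ _ _ (square_loop (R := R)) (diff_rect J fE s1 s2 (e - ee) (e + ee))).
      exact: continuous_square_loop.
    exact: continuous_diff_rect.
  have s01 : 0 <= (s2 - s1) * (square_loop t).1 + s1 <= 1.
    have h1 : 0 <= s1 by rewrite /s1; clear -eb1; lra.
    have h2 : s1 <= s2 by rewrite /s1 /s2; clear -eb0; lra.
    have h3 : s2 <= 1 by rewrite /s2; clear -eb2; lra.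
    by have /andP[l1 l2] := segment01 h1 h2 h3 y1; exact: in01 h1 l1 l2 h3.
  have t01' : 0 <= sE (square_loop t).2 <= 1.
    by have /andP[l1 l2] := IsE _ y2; exact: in01 (ltW ee1) l1 l2 (ltW ee2).
  rewrite /comp /diff_rect subr_eq0; apply/eqP => /(JE _ _ s01 t01')[z1 z2].
  (* The rectangle is symmetric about the crossing, so the only zero of the difference is the centre
     of the square, off its boundary. *)
  have {}z1 : (square_loop t).1 = 1 / 2.
    by apply: (mulfI (lt0r_neq0 eb0)); move: z1; rewrite /s1 /s2; clear; lra.
  have {}z2 : (square_loop t).2 = 1 / 2.
    by apply: (mulfI (lt0r_neq0 ee0)); move: z2; rewrite /sE; clear; lra.
  by case: By; rewrite ?z1 ?z2; clear; lra.
- by rewrite lexx ler01.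
- by rewrite lexx ler01.
- by move=> t t01; rewrite E.
Qed.

Lemma quadrilateral_single_crossing (fA fB fC fE : R -> plane) a c b e
    U h k p U' h' k' q :
  [/\ continuous fA, continuous fB, continuous fC & continuous fE] ->
  [/\ inj01 fA, inj01 fB, inj01 fC & inj01 fE] ->
  [/\ fA 1 = fB 0, fB 1 = fC 0, fC 1 = fE 0 & fE 1 = fA 0] ->
  [/\ 0 < a < 1, 0 < c < 1, 0 < b < 1 & 0 < e < 1] ->
  (forall s t, 0 <= s <= 1 -> 0 <= t <= 1 -> fE s = fA t -> t = 0) ->
  (forall s t, 0 <= s <= 1 -> 0 <= t <= 1 -> fA s = fB t -> s = 1) ->
  (forall s t, 0 <= s <= 1 -> 0 <= t <= 1 -> fB s = fC t -> t = 0) ->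
  (forall s t, 0 <= s <= 1 -> 0 <= t <= 1 -> fC s = fE t -> s = 1) ->
  (forall s t, 0 <= s <= 1 -> 0 <= t <= 1 -> fA s = fC t -> s = a /\ t = c) ->
  (forall s t, 0 <= s <= 1 -> 0 <= t <= 1 -> fB s = fE t -> s = b /\ t = e) ->
  chart U h k p -> fA a = p -> fC c = p ->
  chart U' h' k' q -> fB b = q -> fE e = q ->
  (forall s, 0 <= s <= 1 -> U (fA s) -> (h (fA s)).2 = 0) ->
  (forall s, 0 <= s <= 1 -> U (fC s) -> (h (fC s)).1 = 0) ->
  (forall s, 0 <= s <= 1 -> U' (fB s) -> (h' (fB s)).2 = 0) ->
  (forall s, 0 <= s <= 1 -> U' (fE s) -> (h' (fE s)).1 = 0) ->
  False.
Proof.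
move=> [cA cB cC cE] [iA iB iC iE] [AB1 BC1 CE1 EA1] [a01 c01 b01 e01].
move=> EA AB BC CE AC BE ch fAa fCc ch' fBb fEe UA UC UB UE.
have [J HJ] := exists_loop_along cA cB cC AB1 BC1 a01 c01 (etrans fAa (esym fCc)).
have := winding_second_crossing (conj cB cE) iB iE a01 c01 b01 e01 EA CE BE ch' fBb fEe UB UE HJ.
rewrite -CE1 EA1.
by rewrite (winding_first_crossing (And3 cA cB cC) iA iC a01 c01 AB BC AC ch fAa fCc UA UC HJ) eqxx.
Qed.

Lemma open_square : open [set y : plane | `|y.1| < 1 /\ `|y.2| < 1].
Proof.
have opn (co : plane -> R) : continuous co -> open [set y | `|co y| < 1].
  move=> cco; have -> : [set y | `|co y| < 1] = co @^-1` [set x | `|x| < 1] by [].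
  apply: open_comp => [x _|]; first exact: cco.
  have -> : [set x : R | `|x| < 1] = ball 0 1.
    by apply/funext => x; rewrite /ball /= sub0r normrN.
  exact: ball_open.
have -> : [set y : plane | `|y.1| < 1 /\ `|y.2| < 1] =
  [set y | `|y.1| < 1] `&` [set y | `|y.2| < 1] by [].
by apply: openI; apply: opn; [exact: continuous_fst|exact: continuous_snd].
Qed.

(** The neighbourhood and the square are both open, so continuity within them is continuity at each
    of their points, the form in which [chart] asks for it. *)
Lemma cross_at_chart (A B : set plane) p : cross_at A B p -> exists U h k,
  chart U h k p /\ forall x, U x -> (A x <-> (h x).2 = 0) /\ (B x <-> (h x).1 = 0).
Proof.
move=> [U [h [k [[oU Up] [ch ck] [hk kh] hp HAB]]]]; exists U, h, k; split=> //; split=> //.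
split.
- by move=> x Ux; move: ch; rewrite continuous_open_subspace// => /(_ x); rewrite inE; exact.
- move=> y Qy; move: ck; rewrite continuous_open_subspace; last exact: open_square.
  by move=> /(_ y); rewrite inE; exact.
Qed.

Lemma within_clamp (g : R -> plane) : {within `[0, 1], continuous g} ->
  continuous (g \o clamp (R := R)).
Proof.
move=> /subspace_continuousP cg t.
have It : `[0, 1]%classic (clamp t) by rewrite /= in_itv /=; exact: clamp01.
apply: cvg_comp; last exact: (cg _ It).
move=> P HP; have ct : {for t, continuous (fun x : R => clamp x)} by exact: continuous_clamp.
have H : nbhs t (fun x => `[0, 1]%classic (clamp x) -> P (clamp x)) := ct _ HP.
change (nbhs t (fun x => P (clamp x))); apply: filterS H => s; apply.
by rewrite /= in_itv /=; exact: clamp01.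
Qed.

Lemma is_arc_path (A : set plane) (x y : plane) : is_arc A x y -> exists f,
  [/\ continuous f, inj01 f, f 0 = x, f 1 = y &
      forall p, A p <-> exists2 s, 0 <= s <= 1 & f s = p].
Proof.
move=> [g [cg ig g0 g1 ->]]; exists (g \o clamp (R := R)).
have I0 : 0 <= (0 : R) <= 1 by rewrite lexx ler01.
have I1 : 0 <= (1 : R) <= 1 by rewrite lexx ler01.
split => [||||p].
- exact: within_clamp.
- by move=> s t s01 t01; rewrite /= !clampE// => /ig; rewrite !in_itv /=; apply.
- by rewrite /= clampE.
- by rewrite /= clampE.
- split=> [[s /=]|[s s01 <-]].
    by rewrite in_itv /= => s01 <-; exists s => //=; rewrite clampE.
  by exists s; rewrite /= ?in_itv//= clampE.
Qed.

End PathCrossings.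

(** * Good drawings *)

Lemma cross_at_mem (R : realType) (A B : set (R * R)) p : cross_at A B p -> A p /\ B p.
Proof. by move=> [U [h [k [[_ Up] _ _ hp /(_ p Up)[[_ HA] [_ HB]]]]]]; rewrite hp in HA HB; split; auto. Qed.

Section Drawing.
Variable R : realType.
Local Notation plane := (R * R)%type.
Variables (V : finType) (adj : rel V) (D : drawing R V).
Hypothesis adj_sym : symmetric adj.

(* The consequences of [good_drawing] that determine how crossings are counted;
   unlike [good_drawing] they make no reference to charts. *)
Definition simple_drawing : Prop :=
  [/\ forall u v, adj u v -> dedge D u v = dedge D v u,
      forall u v w p, distinct_edges adj u v u w -> nonvertex D p ->
        ~ (dedge D u v p /\ dedge D u w p),
      forall u v w z p q, distinct_edges adj u v w z ->
        nonvertex D p -> nonvertex D q ->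
        dedge D u v p -> dedge D w z p -> dedge D u v q -> dedge D w z q -> p = q &
      forall p u v u' v' u'' v'', nonvertex D p ->
        distinct_edges adj u v u' v' -> distinct_edges adj u v u'' v'' ->
        distinct_edges adj u' v' u'' v'' ->
        ~ [/\ dedge D u v p, dedge D u' v' p & dedge D u'' v'' p]].

Lemma good_simple : good_drawing adj D -> simple_drawing.
Proof.
move=> [[_ Dsym _ _] D3 Dadj Duniq Dcross]; split => //.
- by move=> u v w p de np [uv uw]; apply: (Dadj _ _ _ p de); exact: Dcross.
- move=> u v w z p q de np nq uvp wzp uvq wzq.
  by apply: (Duniq _ _ _ _ _ _ de); exact: Dcross.
Qed.

Definition crosses (u v w z : V) : Prop :=
  [/\ adj u v, adj w z, uniq [:: u; v; w; z] &
      exists p, [/\ nonvertex D p, dedge D u v p & dedge D w z p]].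

Lemma set2_neq (u v w z : V) : uniq [:: u; v; w; z] -> [set u; v]%SET != [set w; z]%SET.
Proof.
rewrite /= !inE !negb_or => /andP[/and3P[_ uw uz] _].
by apply/eqP => /setP/(_ u); rewrite !inE eqxx (negPf uw) (negPf uz).
Qed.

Lemma good_not_both_cross u v w z : good_drawing adj D ->
  crosses u v w z -> ~ crosses v w z u.
Proof.
move=> gD [uv wz un [p [np uvp wzp]]] [vw zu _ [q [nq vwq zuq]]].
have [Dsym Dadj Duniq _] := good_simple gD.
have [[Dinj _ Darc Dvert] _ _ _ Dcross] := gD.
have [[uvn uwn uzn vwn vzn] wzn] : [/\ u != v, u != w, u != z, v != w & v != z] /\ w != z.
  by move: un; rewrite /= !inE !negb_or => /and3P[/and3P[-> -> ->] /andP[-> ->] /andP[-> _]].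
have [fA [cA iA A0 A1 HA]] := is_arc_path (Darc _ _ uv).
have [fB [cB iB B0 B1 HB]] := is_arc_path (Darc _ _ vw).
have [fC [cC iC C0 C1 HC]] := is_arc_path (Darc _ _ wz).
have [fE [cE iE E0 E1 HE]] := is_arc_path (Darc _ _ zu).
have I0 : 0 <= (0 : R) <= 1 by rewrite lexx ler01.
have I1 : 0 <= (1 : R) <= 1 by rewrite lexx ler01.
have inside (f : R -> plane) x y s r : f 0 = dvertex D x -> f 1 = dvertex D y ->
    nonvertex D r -> 0 <= s <= 1 -> f s = r -> 0 < s < 1.
  move=> f0 f1 nr /andP[s0 s1] fs; rewrite !lt_neqAle s0 s1 !andbT; apply/andP; split.
    by apply/eqP => e; apply: (nr x); rewrite -f0 e.
  by apply/eqP => e; apply: (nr y); rewrite -f1 -e.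
have [a Ia fa] := (HA p).1 uvp; have [c Ic fc] := (HC p).1 wzp.
have [b Ib fb] := (HB q).1 vwq; have [e Ie fe] := (HE q).1 zuq.
have a01 := inside _ _ _ _ _ A0 A1 np Ia fa; have c01 := inside _ _ _ _ _ C0 C1 np Ic fc.
have b01 := inside _ _ _ _ _ B0 B1 nq Ib fb; have e01 := inside _ _ _ _ _ E0 E1 nq Ie fe.
have de x y x' y' : adj x y -> adj x' y' -> uniq [:: x; y; x'; y'] -> distinct_edges adj x y x' y'.
  by move=> xy xy' /set2_neq n; split.
have un' : uniq [:: v; w; z; u] by rewrite -(rot_uniq 3).
have deAC := de _ _ _ _ uv wz un; have deBE := de _ _ _ _ vw zu un'.
(* A further common point of two adjacent edges would be either a vertex that is an endpoint of
   both, or a crossing of adjacent edges. *)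
have adjacent x y t r : adj x y -> adj y t -> x != t -> x != y -> dedge D x y r -> dedge D y t r ->
    r = dvertex D y.
  move=> xy yt xt xyn rxy ryt; have [[s sr]|nr] := pselect (exists s, dvertex D s = r).
    have := Dvert _ _ s xy; rewrite sr => /(_ rxy)[sx|sy]; last by rewrite -sr sy.
    subst s.
    have := Dvert _ _ x yt; rewrite sr => /(_ ryt)[xyE|xtE]; first by rewrite -sr xyE.
    by move: xt; rewrite xtE eqxx.
  exfalso; have nvr : nonvertex D r by move=> s sr; apply: nr; exists s.
  have yx : adj y x by rewrite adj_sym.
  apply: (Dadj y x t r _ nvr); last by rewrite -(Dsym _ _ xy).
  split => //; apply/eqP => /setP/(_ x); rewrite !inE eqxx orbT (negPf xyn) (negPf xt) //.
have disj x y x' y' r : adj x y -> adj x' y' -> uniq [:: x; y; x'; y'] ->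
    dedge D x y r -> dedge D x' y' r -> nonvertex D r.
  move=> xy xy' xu rxy rxy' s sr; move: xu; rewrite /= !inE !negb_or.
  move=> /and3P[/and3P[_ n1 n2] /andP[n3 n4] _].
  have := Dvert _ _ s xy; rewrite sr => /(_ rxy); have := Dvert _ _ s xy'; rewrite sr => /(_ rxy').
  by move=> [->|->] [E|E]; move: n1 n2 n3 n4; rewrite E eqxx.
have mem (f : R -> plane) (A : set plane) : (forall p, A p <-> exists2 s, 0 <= s <= 1 & f s = p) ->
    forall s, 0 <= s <= 1 -> A (f s).
  by move=> H s s01; apply/H; exists s.
have mA := mem _ _ HA; have mB := mem _ _ HB; have mC := mem _ _ HC; have mE := mem _ _ HE.
have [U [h [k [ch HU]]]] := cross_at_chart (Dcross _ _ _ _ _ deAC np uvp wzp).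
have [U' [h' [k' [ch' HU']]]] := cross_at_chart (Dcross _ _ _ _ _ deBE nq vwq zuq).
apply: (quadrilateral_single_crossing (fA := fA) (fB := fB) (fC := fC) (fE := fE)
  (a := a) (b := b) (c := c) (e := e) _ _ _ _ _ _ _ _ _ _ ch fa fc ch' fb fe).
- by [].
- by [].
- by rewrite A1 B0 B1 C0 C1 E0 E1 A0.
- by [].
- move=> s t s01 t01 E; apply: iA => //; rewrite A0.
  by apply: (adjacent z u v) => //; [rewrite eq_sym|rewrite eq_sym|rewrite -E; exact: mE|exact: mA].
- move=> s t s01 t01 E; apply: iA => //; rewrite A1.
  by apply: (adjacent u v w) => //; [exact: mA|rewrite E; exact: mB].
- move=> s t s01 t01 E; apply: iC => //; rewrite C0.
  by apply: (adjacent v w z) => //; [rewrite -E; exact: mB|exact: mC].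
- move=> s t s01 t01 E; apply: iC => //; rewrite C1.
  by apply: (adjacent w z u) => //; [rewrite eq_sym|exact: mC|rewrite E; exact: mE].
- move=> s t s01 t01 E.
  have nr : nonvertex D (fA s) by apply: (disj _ _ _ _ _ uv wz un); [exact: mA|rewrite E; exact: mC].
  have Ep : fA s = p.
    by apply: (Duniq _ _ _ _ _ _ deAC nr np) => //; [exact: mA|rewrite E; exact: mC].
  by split; [apply: iA; rewrite // fa|apply: iC; rewrite // fc -E].
- move=> s t s01 t01 E.
  have nr : nonvertex D (fB s) by apply: (disj _ _ _ _ _ vw zu un'); [exact: mB|rewrite E; exact: mE].
  have Eq : fB s = q.
    by apply: (Duniq _ _ _ _ _ _ deBE nr nq) => //; [exact: mB|rewrite E; exact: mE].
  by split; [apply: iB; rewrite // fb|apply: iE; rewrite // fe -E].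
- by move=> s s01 Us; apply/(HU _ Us).1; exact: mA.
- by move=> s s01 Us; apply/(HU _ Us).2; exact: mC.
- by move=> s s01 Us; apply/(HU' _ Us).1; exact: mB.
- by move=> s s01 Us; apply/(HU' _ Us).2; exact: mE.
Qed.

End Drawing.

(** * Counting crossings by ordered quadruples *)

Section Counting.
Variable R : realType.
Local Notation plane := (R * R)%type.
Variables (V : finType) (adj : rel V) (D : drawing R V).
Hypotheses (adj_sym : symmetric adj) (adj_irr : irreflexive adj).
Hypothesis sD : simple_drawing adj D.

Definition crosses_at (q : V * V * V * V) (p : plane) : Prop :=
  let: (u, v, w, z) := q in
  [/\ distinct_edges adj u v w z, nonvertex D p, dedge D u v p & dedge D w z p].

Lemma neq_sym (u v : V) : adj u v -> u != v.
Proof. by apply: contraTneq => ->; rewrite adj_irr. Qed.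

Lemma distinct_edges_swap u v w z : distinct_edges adj u v w z ->
  distinct_edges adj v u w z /\ distinct_edges adj w z u v.
Proof.
move=> [uv wz n]; split; split => //.
- by rewrite adj_sym.
- by rewrite finset.setUC.
- by rewrite eq_sym.
Qed.

Lemma crosses_at_swap u v w z p : crosses_at (u, v, w, z) p ->
  crosses_at (v, u, w, z) p /\ crosses_at (w, z, u, v) p.
Proof.
move=> [de np uvp wzp]; have [de1 de2] := distinct_edges_swap de.
split; split => //; case: sD => Dsym _ _ _.
by rewrite -Dsym//; case: de.
Qed.

Lemma crosses_at_uniq u v w z p : crosses_at (u, v, w, z) p -> uniq [:: u; v; w; z].
Proof.
move=> H; have [Dsym Dadj _ _] := sD.
have first_neq a b c d : crosses_at (a, b, c, d) p -> a != c.
  move=> [de np abp cdp]; apply/eqP => ac; subst c.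
  exact: (Dadj _ _ _ _ de np).
have [H1 H2] := crosses_at_swap H; have [H3 _] := crosses_at_swap H2.
have [_ H4] := crosses_at_swap H1; have [H5 _] := crosses_at_swap H4.
rewrite /= !inE !negb_or (first_neq _ _ _ _ H) (first_neq _ _ _ _ H1).
have [[uv wz _] _ _ _] := H; rewrite (neq_sym uv) (neq_sym wz) /= andbT.
by rewrite [u == z]eq_sym [v == z]eq_sym (first_neq _ _ _ _ H3) (first_neq _ _ _ _ H5).
Qed.

Lemma crossesE u v w z : crosses adj D u v w z <-> exists p, crosses_at (u, v, w, z) p.
Proof.
split=> [[uv wz un [p [np uvp wzp]]]|[p H]].
  by exists p; split => //; split => //; exact: set2_neq.
have un := crosses_at_uniq H; move: H => [[uv wz _] np uvp wzp].
by split => //; exists p.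
Qed.

Definition crossing_quads : {set V * V * V * V} :=
  [set q | `[< crosses adj D q.1.1.1 q.1.1.2 q.1.2 q.2 >]].

Lemma crossing_quadsP q : reflect (exists p, crosses_at q p) (q \in crossing_quads).
Proof.
by case: q => [[[u v] w] z]; rewrite inE /=; apply: (equivP (asboolP _)); exact: crossesE.
Qed.

Definition crossing_point (q : V * V * V * V) : plane := xget 0 [set p | crosses_at q p].

Lemma crossing_pointP q : q \in crossing_quads -> crosses_at q (crossing_point q).
Proof. by move=> /crossing_quadsP[p Hp]; rewrite /crossing_point; case: xgetP => [y _ //|/(_ p)[]]. Qed.

Lemma crossing_point_uniq q p : crosses_at q p -> crossing_point q = p.
Proof.
move=> H; have := crossing_pointP (introT (crossing_quadsP q) (ex_intro _ p H)).
case: sD => _ _ Duniq _.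
case: q H => [[[u v] w] z] [de np uvp wzp] [_ np' uvp' wzp'].
exact: (Duniq _ _ _ _ _ _ de).
Qed.

Lemma set2_eqP (a b u v : V) : [set a; b]%SET = [set u; v]%SET -> a != b ->
  (a, b) = (u, v) \/ (a, b) = (v, u).
Proof.
move=> E ab; have : a \in [set u; v]%SET by rewrite -E !inE eqxx.
have : b \in [set u; v]%SET by rewrite -E !inE eqxx orbT.
rewrite !inE => /orP[/eqP bE|/eqP bE] /orP[/eqP aE|/eqP aE]; move: ab; rewrite aE bE ?eqxx//.
- by right.
- by left.
Qed.

(** The eight ways to write an unordered pair of edges as a quadruple: reverse the first edge,
    reverse the second, exchange them. *)
Definition quad_symmetry (q : V * V * V * V) (b : bool * bool * bool) : V * V * V * V :=
  let: (u, v, w, z) := q in let: (b1, b2, b3) := b in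
  let: (u', v') := if b1 then (u, v) else (v, u) in
  let: (w', z') := if b2 then (w, z) else (z, w) in
  if b3 then (u', v', w', z') else (w', z', u', v').

Lemma quad_symmetry_inj u v w z : uniq [:: u; v; w; z] -> injective (quad_symmetry (u, v, w, z)).
Proof.
rewrite /= !inE !negb_or => /and3P[/and3P[uv uw uz] /andP[vw vz] /andP[wz _]].
pose E := (negPf uv, negPf uw, negPf uz, negPf vw, negPf vz, negPf wz).
have vu : v != u by rewrite eq_sym.
have wu : w != u by rewrite eq_sym.
have zu : z != u by rewrite eq_sym.
have wv : w != v by rewrite eq_sym.
have zv : z != v by rewrite eq_sym.
have zw : z != w by rewrite eq_sym.
pose E' := (negPf vu, negPf wu, negPf zu, negPf wv, negPf zv, negPf zw).
by move=> [[[] []] []] [[[] []] []] //= /eqP; rewrite !xpair_eqE ?E ?E' ?andbF.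
Qed.

(** No three edges pass through a crossing point, so the point determines its two edges, and only
    the eight ways of ordering them remain. *)
Lemma crossing_fiber q : q \in crossing_quads ->
  [set q' in crossing_quads | crossing_point q' == crossing_point q]%SET =
  [set quad_symmetry q b | b : bool * bool * bool]%SET.
Proof.
move=> /crossing_pointP; set p := crossing_point q; case: q @p => [[[u v] w] z] p Hp.
have [Dsym _ _ D3] := sD.
apply/setP => q'; rewrite inE; apply/idP/imsetP.
- move=> /andP[/crossing_pointP + /eqP q'p]; rewrite q'p.
  case: q' {q'p} => [[[a b] c] d] Hq.
  have [[uv wz uwn] np uvp wzp] := Hp; have [[ab cd acn] _ abp cdp] := Hq.
  have third x y : adj x y -> dedge D x y p ->
      [set x; y]%SET = [set u; v]%SET \/ [set x; y]%SET = [set w; z]%SET.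
    move=> xy xyp; have [|n1] := eqVneq [set x; y]%SET [set u; v]%SET; first by left.
    have [|n2] := eqVneq [set x; y]%SET [set w; z]%SET; first by right.
    exfalso; apply: (D3 p x y u v w z np); by split.
  have [ab' cd'] := (neq_sym ab, neq_sym cd).
  have [E1|E1] := third _ _ ab abp; have [E2|E2] := third _ _ cd cdp;
    try by move: acn; rewrite E1 E2 eqxx.
  + case: (set2_eqP E1 ab') => -[-> ->]; case: (set2_eqP E2 cd') => -[-> ->].
    * by exists (true, true, true).
    * by exists (true, false, true).
    * by exists (false, true, true).
    * by exists (false, false, true).
  + case: (set2_eqP E1 ab') => -[-> ->]; case: (set2_eqP E2 cd') => -[-> ->].
    * by exists (true, true, false).
    * by exists (false, true, false).
    * by exists (true, false, false).
    * by exists (false, false, false).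
- move=> [[[b1 b2] b3] _ ->].
  have Hq' : crosses_at (quad_symmetry (u, v, w, z) (b1, b2, b3)) p.
    have [H1 H2] := crosses_at_swap Hp; have [H3 H4] := crosses_at_swap H2.
    have [_ H5] := crosses_at_swap H1; have [_ H6] := crosses_at_swap H3.
    have [H7 _] := crosses_at_swap H5; have [H8 H9] := crosses_at_swap H6.
    have [_ H10] := crosses_at_swap H7.
    by case: b1; case: b2; case: b3.
  rewrite (crossing_point_uniq Hq') eqxx andbT; apply/crossing_quadsP; by exists p.
Qed.

Lemma crossings_image : crossings adj D = [set crossing_point q | q in [set` crossing_quads]].
Proof.
apply/seteqP; split => p.
- move=> [np [u [v [w [z [de uvp wzp]]]]]]; have H : crosses_at (u, v, w, z) p by split.
  exists (u, v, w, z); last exact: crossing_point_uniq.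
  by apply/crossing_quadsP; exists p.
- move=> [[[[u v] w] z] /crossing_pointP H <-]; case: H => de np uvp wzp.
  by split => //; exists u, v, w, z.
Qed.

(** Double counting over the fibres of [crossing_point], each of size eight. Finiteness of
    [crossings], without which [cr] would read 0, holds because it is the image of a finite set. *)
Lemma card_crossing_quads : #|crossing_quads| = (8 * cr adj D)%N.
Proof.
pose S := fset_set (crossings adj D).
have fin : finite_set (crossings adj D).
  by rewrite crossings_image; apply: finite_image; exact: finite_finset.
have memS q : q \in crossing_quads -> crossing_point q \in finmap.enum_fset S.
  move=> Hq; rewrite in_fset_set// inE crossings_image; by exists q.
have -> : #|crossing_quads| =
    (\sum_(q in crossing_quads) \sum_(p <- finmap.enum_fset S) (crossing_point q == p))%N.
  rewrite -sum1_card; apply: eq_bigr => q Hq.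
  under eq_bigr do rewrite eq_sym.
  by rewrite -big_mkcond /= sum1_count -/(count_mem _ _) count_uniq_mem ?finmap.fset_uniq// memS.
rewrite exchange_big /= /cr -/S -sum1_size mulnC big_distrl /= big_seq [RHS]big_seq.
apply: eq_bigr => p; rewrite in_fset_set// inE crossings_image => -[q Hq <-].
rewrite mul1n -big_mkcondr /= sum1dep_card crossing_fiber//.
rewrite card_imset; first by rewrite !card_prod !card_bool.
case: q Hq => [[[u v] w] z] /crossing_pointP/crosses_at_uniq; exact: quad_symmetry_inj.
Qed.

End Counting.

(** * Convex drawings *)

Section GenericReals.
Variable R : realType.
Implicit Types (a b c d e f x y : R) (s : seq R).

(* The line through (a, a^2) and (b, b^2). *)
Definition chord a b x y : Prop := y = (a + b) * x - a * b.

Lemma chordC a b x y : chord a b x y -> chord b a x y.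
Proof. by rewrite /chord [b + a]addrC [b * a]mulrC. Qed.

Lemma chord_diag a b e : chord a b e (e ^+ 2) -> e = a \/ e = b.
Proof.
rewrite /chord => E; have /eqP : (e - a) * (e - b) = 0.
  have -> : (e - a) * (e - b) = e ^+ 2 - ((a + b) * e - a * b) by ring.
  by rewrite -E subrr.
by rewrite mulf_eq0 !subr_eq0 => /orP[/eqP|/eqP]; [left|right].
Qed.

(** Parallel chords with a common point lie on the same line; then a, b and c, d have equal sum and
    product, so they are roots of the same quadratic. *)
Lemma chord_slope a b c d x y : chord a b x y -> chord c d x y -> a + b = c + d ->
  a = c \/ a = d.
Proof.
rewrite /chord => -> E' E; rewrite E in E'; have {}E' : a * b = c * d by lra.
have /eqP : (a - c) * (a - d) = 0.
  have -> : (a - c) * (a - d) = a ^+ 2 - (c + d) * a + c * d by ring.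
  by rewrite -E -E'; ring.
by rewrite mulf_eq0 !subr_eq0 => /orP[/eqP|/eqP]; [left|right].
Qed.

Definition general_position s : Prop :=
  forall a b c d e f, {subset [:: a; b; c; d; e; f] <= s} -> uniq [:: a; b; c; d; e; f] ->
  forall x y, chord a b x y -> chord c d x y -> ~ chord e f x y.

(* The parameter [f] for which the chord from [e] passes through the intersection
   of the chords [a b] and [c d]. *)
Definition concurrent_parameter a b c d e : R :=
  let x := (a * b - c * d) / (a + b - c - d) in
  let y := (a + b) * x - a * b in
  (y - e * x) / (x - e).

Lemma concurrent_parameterE a b c d e f x y : uniq [:: a; b; c; d; e; f] ->
  chord a b x y -> chord c d x y -> chord e f x y -> f = concurrent_parameter a b c d e.
Proof.
rewrite /= !inE !negb_or => /andP[/and5P[_ ac ad ae _] /and5P[/and4P[_ _ be _] _ _ _ _]].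
move=> ab cd ef.
have dn : a + b - c - d != 0.
  rewrite -addrA -opprD subr_eq0; apply/eqP => E.
  by case: (chord_slope ab cd E) => E'; move: ac ad; rewrite E' eqxx.
have xE : x = (a * b - c * d) / (a + b - c - d).
  apply: (mulIf dn); rewrite divfK//; move: ab cd; rewrite /chord => -> E.
  have E2 : (a + b - c - d) * x = (a + b) * x - (c + d) * x by ring.
  by rewrite mulrC E2; lra.
have yE : y = (a + b) * x - a * b := ab.
rewrite /concurrent_parameter -xE -yE.
have xe : x - e != 0.
  rewrite subr_eq0; apply/eqP => E; subst e.
  move: ef; rewrite /chord => ef; have y2 : y = x ^+ 2 by rewrite ef; ring.
  move: ab; rewrite y2 => /chord_diag[E|E]; first by move: ae; rewrite E eqxx.
  by move: be; rewrite E eqxx.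
apply: (mulIf xe); rewrite divfK//; move: ef; rewrite /chord => ->; ring.
Qed.

Lemma le_sum_norm s x : x \in s -> x <= \sum_(i <- s) `|i|.
Proof.
elim: s => [//|y s IHs]; rewrite inE big_cons => /orP[/eqP ->|/IHs xs].
  by apply: le_trans (ler_norm _) _; rewrite lerDl; exact: sumr_ge0.
by apply: le_trans xs _; rewrite lerDr.
Qed.

(** Greedy choice: a new parameter larger than all earlier ones and than the finitely many values of
    [concurrent_parameter] completes no concurrent triple and keeps the sequence increasing. *)
Lemma exists_general_position (N : nat) :
  exists s, [/\ size s = N, sorted <%R s & general_position s].
Proof.
elim: N => [|N [s [sN ss gs]]].
  by exists [::]; split => // a b c d e f /(_ a); rewrite inE eqxx => /(_ isT).
pose bad := [seq concurrent_parameter p.1.1.1 p.1.1.2 p.1.2.1 p.1.2.2 p.2 |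
  p <- allpairs pair (allpairs pair (allpairs pair s s) (allpairs pair s s)) s].
pose f := 1 + \sum_(x <- s ++ bad) `|x|.
have lf x : x \in s ++ bad -> x < f.
  by move=> /le_sum_norm xs; rewrite /f addrC; apply: le_lt_trans xs _; rewrite ltrDl.
have fbad a b c d e : {subset [:: a; b; c; d; e] <= s} -> f != concurrent_parameter a b c d e.
  move=> H; rewrite gt_eqF// lf// mem_cat; apply/orP; right.
  apply/mapP; exists (((a, b), (c, d)), e) => //.
  by apply/allpairsP; exists (((a, b), (c, d)), e); split => //=;
    [apply/allpairsP; exists ((a, b), (c, d)); split => //=; apply/allpairsP;
     [exists (a, b)|exists (c, d)]; split => //=|]; apply: H; rewrite !inE eqxx ?orbT.
have key a b c d e : {subset [:: a; b; c; d; e] <= rcons s f} -> uniq [:: a; b; c; d; e; f] ->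
    forall x y, chord a b x y -> chord c d x y -> ~ chord e f x y.
  move=> H un x y ab cd ef; have := concurrent_parameterE un ab cd ef; apply/eqP/fbad.
  move=> z zi; have := H z zi; rewrite mem_rcons inE => /orP[/eqP zf|//].
  move: un; rewrite -[[:: a; _; _; _; _; _]]/(rcons [:: a; b; c; d; e] f) rcons_uniq.
  by rewrite -zf zi.
exists (rcons s f); split.
- by rewrite size_rcons sN.
- case: (lastP s) ss lf => [//|s' z] ss lf; rewrite -cats1 -cats1 -catA /=.
  have := ss; rewrite -cats1 => ss'.
  rewrite cats1 in ss'; rewrite -cat_rcons cats1.
  have -> : sorted <%R (rcons (rcons s' z) f) = sorted <%R (rcons s' z) && (z < f).
    by case: (s') => [|y l] //=; rewrite ?andbT// !rcons_path last_rcons.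
  by rewrite ss lf// mem_cat mem_rcons inE eqxx.
- move=> a b c d e g H un x y ab cd eg.
  have Hs z : z \in [:: a; b; c; d; e; g] -> z != f -> z \in s.
    by move=> /H; rewrite mem_rcons inE => /orP[/eqP ->|//]; rewrite eqxx.
  have perm l l' : perm_eq l l' -> uniq l -> {subset l <= rcons s f} ->
      uniq l' /\ {subset l' <= rcons s f}.
    by move=> p ul Hl; rewrite -(perm_uniq p); split => // z; rewrite -(perm_mem p) => /Hl.
  (* Concurrency is invariant under permuting the three chords and reversing each, so the new
     parameter can be moved to the last place, where [key] applies. *)
  have use (a' b' c' d' e' g' : R) : g' = f -> perm_eq [:: a; b; c; d; e; g] [:: a'; b'; c'; d'; e'; g'] ->
      chord a' b' x y -> chord c' d' x y -> chord e' g' x y -> False.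
    move=> gf p ab' cd' eg'; have [un' H'] := perm _ _ p un H; subst g'.
    apply: (key a' b' c' d' e' _ un' _ _ ab' cd' eg') => z zi; apply: H'.
    by move: zi; rewrite !inE => /or4P[->|->|->|/orP[->|->]]; rewrite ?orbT.
  have [af|af] := eqVneq a f.
    apply: (use c d e g b a) => //; last exact: chordC.
    by apply/permP => P /=; clear; lia.
  have [bf|bf] := eqVneq b f.
    by apply: (use c d e g a b) => //; apply/permP => P /=; clear; lia.
  have [cf|cf] := eqVneq c f.
    apply: (use a b e g d c) => //; last exact: chordC.
    by apply/permP => P /=; clear; lia.
  have [df|df] := eqVneq d f.
    by apply: (use a b e g c d) => //; apply/permP => P /=; clear; lia.
  have [ef|ef] := eqVneq e f.
    apply: (use a b c d g e) => //; last exact: chordC.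
    by apply/permP => P /=; clear; lia.
  have [gf|gf] := eqVneq g f.
    by apply: (use a b c d e g).
  apply: (gs a b c d e g _ un x y ab cd eg) => z zi; apply: (Hs _ zi).
  by move: zi; rewrite !inE => /or4P[/eqP->|/eqP->|/eqP->|/or3P[/eqP->|/eqP->|/eqP->]].
Qed.

End GenericReals.

(** * Chords of a parabola *)

Section ParabolaDrawing.
Variable R : realType.
Local Notation plane := (R * R)%type.
Variables (V : finType) (adj : rel V) (tau : V -> R).
Hypotheses (adj_sym : symmetric adj) (adj_irr : irreflexive adj).
Hypothesis tau_inj : injective tau.
Hypothesis tau_gen : general_position [seq tau v | v <- enum V].

Definition chord_segment (a b : R) : set plane :=
  [set p | chord a b p.1 p.2 /\ Num.min a b <= p.1 <= Num.max a b].

Definition parabola_drawing : drawing R V :=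
  Drawing (fun v => (tau v, tau v ^+ 2)) (fun u v => chord_segment (tau u) (tau v)).

Local Notation D := parabola_drawing.

Lemma chord_segmentC a b : chord_segment a b = chord_segment b a.
Proof.
apply/funext => p; rewrite /chord_segment /= minC maxC; apply/propext.
by split=> -[/chordC].
Qed.

Lemma chord_segment_vertex u v w : chord_segment (tau u) (tau v) (dvertex D w) ->
  w = u \/ w = v.
Proof. by move=> [/chord_diag[/tau_inj ->|/tau_inj ->] _]; [left|right]. Qed.

Lemma adjacent_chords u v w p : v != w ->
  chord_segment (tau u) (tau v) p -> chord_segment (tau u) (tau w) p -> p = dvertex D u.
Proof.
move=> vw [uv _] [uw _]; have p1 : p.1 = tau u.
  have : (tau v - tau w) * (p.1 - tau u) = 0.
    by move: uv uw; rewrite /chord => ->; lra.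
  move=> /eqP; rewrite mulf_eq0 subr_eq0 (inj_eq tau_inj) (negPf vw) /= subr_eq0.
  by move=> /eqP.
by rewrite (surjective_pairing p) uv p1 /=; congr (_, _); ring.
Qed.

Lemma distinct_chords_slope u v w z p : distinct_edges adj u v w z ->
  chord_segment (tau u) (tau v) p -> chord_segment (tau w) (tau z) p ->
  tau u + tau v != tau w + tau z.
Proof.
move=> [uv wz n] [cuv _] [cwz _]; apply: contra n => /eqP E.
have [/tau_inj uw|/tau_inj uz] := chord_slope cuv cwz E.
  by move: E; rewrite uw => /addrI/tau_inj ->.
by move: E; rewrite uz addrC => /addIr/tau_inj ->; rewrite finset.setUC.
Qed.

Lemma distinct_chords_meet u v w z p q : distinct_edges adj u v w z ->
  chord_segment (tau u) (tau v) p -> chord_segment (tau w) (tau z) p ->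
  chord_segment (tau u) (tau v) q -> chord_segment (tau w) (tau z) q -> p = q.
Proof.
move=> de uvp wzp uvq wzq; have sl := distinct_chords_slope de uvp wzp.
move: uvp wzp uvq wzq => [uvp _] [wzp _] [uvq _] [wzq _].
have E : p.1 = q.1.
  have : (tau u + tau v - (tau w + tau z)) * (p.1 - q.1) = 0.
    by move: uvp wzp uvq wzq; rewrite /chord => -> E1 -> E2; lra.
  by move=> /eqP; rewrite mulf_eq0 !subr_eq0 (negPf sl) => /eqP.
by rewrite (surjective_pairing p) (surjective_pairing q) uvp uvq E.
Qed.

Lemma nonvertex_interior u v p : nonvertex D p -> chord_segment (tau u) (tau v) p ->
  Num.min (tau u) (tau v) < p.1 < Num.max (tau u) (tau v).
Proof.
move=> np [uv /andP[l1 l2]].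
have ne w : w = u \/ w = v -> p.1 != tau w.
  move=> wE; apply/eqP => E; apply: (np w); rewrite (surjective_pairing p) uv E /=.
  by congr (_, _); case: wE => ->; ring.
have nu := ne u (or_introl erefl); have nv := ne v (or_intror erefl).
rewrite !lt_neqAle l1 l2 !andbT; apply/andP; split.
  by rewrite eq_sym; case: leP.
by case: leP.
Qed.

Lemma chord_segment_arc u v : tau u != tau v ->
  is_arc (chord_segment (tau u) (tau v)) (dvertex D u) (dvertex D v).
Proof.
rewrite /=; move: (tau u) (tau v) => a b ab.
pose x t := (b - a) * t + a; pose g t : plane := (x t, (a + b) * x t - a * b).
have cx : continuous x.
  by move=> t; apply: cvgD; [apply: cvgM; [exact: cvg_cst|exact: cvg_id]|exact: cvg_cst].
exists g; split.
- apply: continuous_subspaceT => t; apply: continuous_pair; first exact: cx.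
  apply: cvgB; last exact: cvg_cst.
  by apply: cvgM; [exact: cvg_cst|exact: cx].
- move=> s t _ _ [+ _]; rewrite /x => /addIr/mulfI; apply.
  by rewrite subr_eq0 eq_sym.
- by rewrite /g /x mulr0 add0r; congr (_, _); ring.
- by rewrite /g /x mulr1 subrK; congr (_, _); ring.
- apply/seteqP; split => p.
  + move=> [cp /andP[l1 l2]]; have ba : b - a != 0 by rewrite subr_eq0 eq_sym.
    exists ((p.1 - a) / (b - a)).
      rewrite /= in_itv /=; move: l1 l2 ba; have [lab|lba] := leP a b => l1 l2 ba.
        have b0 : 0 < b - a by rewrite lt0r ba subr_ge0.
        by rewrite divr_ge0 ?subr_ge0//= ler_pdivrMr// mul1r lerB.
      have b0 : b - a < 0 by rewrite subr_lt0.
      rewrite ler_ndivlMr// mul0r subr_le0 l2 /= ler_ndivrMr// mul1r lerB//.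
    by rewrite /g /x mulrC divfK// subrK -cp -surjective_pairing.
  + move=> [t /=]; rewrite in_itv /= => /andP[t0 t1] <-; split; first by [].
    rewrite /= /x; have [lab|lba] := leP a b; apply/andP; split; nra.
Qed.

(** Such a crossing would sit at the common vertex. Along the horizontal axis of the chart the
    abscissa is continuous and injective, so it would pass to both sides of [tau u], whereas the
    segment stays on one side. *)
Lemma adjacent_chords_not_cross u v w p : v != w -> tau u != tau v ->
  ~ cross_at (chord_segment (tau u) (tau v)) (chord_segment (tau u) (tau w)) p.
Proof.
move=> vw uv /cross_at_chart[U [h [k [ch HU]]]].
have [[_ Up] [_ ck] [hk kh] hp] := ch.
have [A2 B1] := HU _ Up; rewrite hp /= in A2 B1.
have pu := adjacent_chords vw (A2.2 erefl) (B1.2 erefl).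
pose x s := (k (s, 0)).1 - tau u.
have Q (s : R) : - 2^-1 <= s <= 2^-1 -> `|s| < 1 /\ `|(0 : R)| < 1.
  move=> /andP[s1 s2]; rewrite normr0 ltr01; split => //.
  by rewrite ltr_norml; apply/andP; split; lra.
have kA (s : R) : - 2^-1 <= s <= 2^-1 -> chord_segment (tau u) (tau v) (k (s, 0)).
  move=> /Q Qs; have [Uk hks] := kh (s, 0) Qs.
  by apply: (HU _ Uk).1.2; rewrite hks.
have : x (0 - 2^-1) * x (0 + 2^-1) < 0.
  apply: sign_change; rewrite ?sub0r ?add0r.
  - by rewrite invr_gt0.
  - move=> s sI; apply: cvgB; last exact: cvg_cst.
    apply: (@continuous_comp _ _ _ (fun s : R => k (s, 0)) fst); last exact: continuous_fst.
    apply: (@continuous_comp _ _ _ (fun s : R => (s, 0 : R)) k); last exact: (ck (s, 0) (Q _ sI)).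
    by apply: continuous_pair; [exact: cvg_id|exact: cst_continuous].
  - move=> s t sI tI /addIr E; have [As _] := kA _ sI; have [At _] := kA _ tI.
    have Ek : k (s, 0) = k (t, 0).
      by rewrite (surjective_pairing (k (s, 0))) (surjective_pairing (k (t, 0))) As At E.
    have [_ hs] := kh (s, 0) (Q _ sI); have [_ ht] := kh (t, 0) (Q _ tI).
    by have := congr1 h Ek; rewrite hs ht => -[].
  - by rewrite /x (chart_origin ch) pu /= subrr.
rewrite sub0r add0r.
apply/negP; rewrite -leNgt /x.
have [|_ /andP[l1 l2]] := kA (- 2^-1); first by apply/andP; split; lra.
have [|_ /andP[l3 l4]] := kA 2^-1; first by apply/andP; split; lra.
have [luv|lvu] := leP (tau u) (tau v).
  move: l1 l3; rewrite (min_l luv) => l1 l3; apply: mulr_ge0; by rewrite subr_ge0.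
move: l2 l4; rewrite (max_l (ltW lvu)) => l2 l4; apply: mulr_le0; by rewrite subr_le0.
Qed.

Lemma open_box (co1 co2 : plane -> R) (e : R) : continuous co1 -> continuous co2 ->
  open [set y : plane | `|co1 y| < e /\ `|co2 y| < e].
Proof.
have opn (co : plane -> R) : continuous co -> open [set y | `|co y| < e].
  move=> cco; have -> : [set y | `|co y| < e] = co @^-1` [set x | `|x| < e] by [].
  apply: open_comp => [x _|]; first exact: cco.
  have -> : [set x : R | `|x| < e] = ball 0 e.
    by apply/funext => x; rewrite /ball /= sub0r normrN.
  exact: ball_open.
by move=> c1 c2; apply: openI; exact: opn.
Qed.

Lemma distinct_chords_cross u v w z p : distinct_edges adj u v w z -> nonvertex D p ->
  chord_segment (tau u) (tau v) p -> chord_segment (tau w) (tau z) p ->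
  cross_at (chord_segment (tau u) (tau v)) (chord_segment (tau w) (tau z)) p.
Proof.
move=> de np uvp wzp; have sl := distinct_chords_slope de uvp wzp.
have := nonvertex_interior np uvp; have := nonvertex_interior np wzp.
move: uvp wzp sl => [uvp _] [wzp _].
rewrite /chord_segment; move: uvp wzp; rewrite /chord.
set m := tau u + tau v; set m' := tau w + tau z.
move: (tau u * tau v) (tau w * tau z) => n n'.
move: (Num.min _ _) (Num.max _ _) => lo' hi'.
move: (Num.min _ _) (Num.max _ _) => lo hi.
move=> E E' mm /andP[lo'p phi'] /andP[lop phi].
have mm0 : m - m' != 0 by rewrite subr_eq0.
pose de0 := Num.min (Num.min (p.1 - lo) (hi - p.1)) (Num.min (p.1 - lo') (hi' - p.1)).
have de00 : 0 < de0 by rewrite !lt_min !subr_gt0 lop phi lo'p phi'.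
(* The residuals of the two line equations differ by [(m - m') * (x.1 - p.1)], so residuals below
   [ep] force [x.1] within [de0] of [p.1], inside both segments. The chart consists of these two
   residuals divided by [ep]. *)
pose ep := de0 * `|m - m'| / 2.
have ep0 : 0 < ep by rewrite divr_gt0// mulr_gt0// normr_gt0.
pose psi (x : plane) := x.2 - (m' * x.1 - n'); pose fi (x : plane) := x.2 - (m * x.1 - n).
have cpsi : continuous psi.
  move=> x; apply: cvgB; first exact: continuous_snd.
  apply: cvgB; last exact: cvg_cst.
  by apply: cvgM; [exact: cvg_cst|exact: continuous_fst].
have cfi : continuous fi.
  move=> x; apply: cvgB; first exact: continuous_snd.
  apply: cvgB; last exact: cvg_cst.
  by apply: cvgM; [exact: cvg_cst|exact: continuous_fst].
pose h (x : plane) : plane := (psi x / ep, fi x / ep).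
pose kx (y : plane) := p.1 + (ep / (m - m')) * (y.1 - y.2).
pose k (y : plane) : plane := (kx y, m * kx y - n + ep * y.2).
have ckx : continuous kx.
  move=> x; apply: cvgD; first exact: cvg_cst.
  apply: cvgM; first exact: cvg_cst.
  by apply: cvgB; [exact: continuous_fst|exact: continuous_snd].
have range x : `|psi x| < ep -> `|fi x| < ep -> lo <= x.1 <= hi /\ lo' <= x.1 <= hi'.
  move=> h1 h2; have d : `|x.1 - p.1| < de0.
    have Ex : psi x - fi x = (m - m') * (x.1 - p.1) by rewrite /psi /fi; lra.
    have : `|(m - m') * (x.1 - p.1)| < 2 * ep.
      by rewrite -Ex; apply: le_lt_trans (ler_normB _ _) _; lra.
    by rewrite normrM /ep mulrC [2 * _]mulrC divfK// ltr_pM2r// normr_gt0.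
  move: d; rewrite !lt_min => /andP[/andP[d1 d2] /andP[d3 d4]].
  by move: d1 d2 d3 d4; rewrite !ltr_norml => *; split; apply/andP; split; lra.
have ch : continuous h.
  move=> x; apply: (@continuous_pair _ _ _ (fun x => psi x / ep) (fun x => fi x / ep)).
    by apply: cvgM; [exact: cpsi|exact: cvg_cst].
  by apply: cvgM; [exact: cfi|exact: cvg_cst].
have ck : continuous k.
  move=> x; apply: (@continuous_pair _ _ _ kx (fun y => m * kx y - n + ep * y.2)); first exact: ckx.
  apply: cvgD; last by apply: cvgM; [exact: cvg_cst|exact: continuous_snd].
  by apply: cvgB; [apply: cvgM; [exact: cvg_cst|exact: ckx]|exact: cvg_cst].
exists [set x | `|psi x| < ep /\ `|fi x| < ep], h, k => /=.
have hlt (y : R) : `|y| < ep -> `|y / ep| < 1.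
  by move=> ye; rewrite normrM normfV (gtr0_norm ep0) ltr_pdivrMr// mul1r.
have psip : psi p = 0 by rewrite /psi -E' subrr.
have fip : fi p = 0 by rewrite /fi -E subrr.
have kpsi y : psi (k y) = ep * y.1.
  have Ek : (m - m') * kx y = (m - m') * p.1 + ep * (y.1 - y.2) by rewrite /kx; field.
  have -> : psi (k y) = (m - m') * kx y - n + n' + ep * y.2 by rewrite /psi /k /=; ring.
  by rewrite Ek; move: E E'; clear; lra.
have kfi y : fi (k y) = ep * y.2 by rewrite /fi /k /=; ring.
split.
- split; first exact: open_box.
  by rewrite psip fip normr0.
- by split; exact: continuous_subspaceT.
- split.
  + move=> x [h1 h2]; split; first by split; exact: hlt.
    have kxE : kx (h x) = x.1.
      have Ex : psi x - fi x = (m - m') * (x.1 - p.1) by rewrite /psi /fi; lra.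
      rewrite /kx /h /= -mulrBl Ex; field.
      by rewrite mm0 gt_eqF.
    rewrite /k kxE (surjective_pairing x) /=; congr (_, _).
    have -> : ep * (fi (x.1, x.2) / ep) = fi (x.1, x.2) by rewrite mulrC divfK ?gt_eqF.
    by rewrite /fi /=; ring.
  + have epl (y : R) : `|y| < 1 -> `|ep * y| < ep.
      by move=> y1; rewrite normrM (gtr0_norm ep0) gtr_pMr.
    move=> y [y1 y2]; rewrite kpsi kfi; split; first by split; exact: epl.
    by rewrite /h kpsi kfi ![ep * _]mulrC !mulfK ?gt_eqF// -surjective_pairing.
- by rewrite /h psip fip !mul0r.
- move=> x [h1 h2]; have [r1 r2] := range x h1 h2; split.
  + split=> [[/eqP + _]|/eqP]; rewrite /h /=.
      by rewrite -subr_eq0 => /eqP e; rewrite /fi e mul0r.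
    rewrite mulf_eq0 invr_eq0 (gt_eqF ep0) orbF subr_eq0 => /eqP e; split => //.
  + split=> [[/eqP + _]|/eqP]; rewrite /h /=.
      by rewrite -subr_eq0 => /eqP e; rewrite /psi e mul0r.
    rewrite mulf_eq0 invr_eq0 (gt_eqF ep0) orbF subr_eq0 => /eqP e; split => //.
Qed.

Lemma chords_uniq u v w z p : distinct_edges adj u v w z -> nonvertex D p ->
  chord_segment (tau u) (tau v) p -> chord_segment (tau w) (tau z) p ->
  uniq [:: u; v; w; z].
Proof.
have ne a b c d : distinct_edges adj a b c d -> nonvertex D p ->
    chord_segment (tau a) (tau b) p -> chord_segment (tau c) (tau d) p -> a != c.
  move=> [_ _ n] np abp cdp; apply/eqP => ac; subst c.
  have bd : b != d by apply: contraNneq n => ->.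
  exact: (np a (esym (adjacent_chords bd abp cdp))).
move=> de np uvp wzp; have [uv wz _] := de.
have [de1 de2] := distinct_edges_swap adj_sym de.
have [de3 de4] := distinct_edges_swap adj_sym de2.
have [_ de5] := distinct_edges_swap adj_sym de1.
have [de6 _] := distinct_edges_swap adj_sym de5.
have vup : chord_segment (tau v) (tau u) p by rewrite chord_segmentC.
have zwp : chord_segment (tau z) (tau w) p by rewrite chord_segmentC.
rewrite /= !inE !negb_or (neq_sym adj_irr uv) (neq_sym adj_irr wz).
rewrite (ne _ _ _ _ de np uvp wzp) (ne _ _ _ _ de1 np vup wzp).
rewrite [u == z]eq_sym (ne _ _ _ _ de3 np zwp uvp).
by rewrite [v == z]eq_sym (ne _ _ _ _ de6 np zwp vup).
Qed.

Lemma parabola_drawing_good : good_drawing adj D.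
Proof.
have ne u v : adj u v -> tau u != tau v.
  by move=> /(neq_sym adj_irr); rewrite (inj_eq tau_inj).
split; first split.
- by move=> u v [/tau_inj].
- by move=> u v _; exact: chord_segmentC.
- by move=> u v /ne; exact: chord_segment_arc.
- by move=> u v w _; exact: chord_segment_vertex.
- move=> p u v u' v' u'' v'' np de de' de'' [h h' h''].
  have [un un' un''] := And3 (chords_uniq de np h h') (chords_uniq de' np h h'')
    (chords_uniq de'' np h' h'').
  have un6 : uniq [:: u; v; u'; v'; u''; v''].
    move: un un' un''; rewrite /= !inE !negb_or.
    move=> /and3P[/and3P[-> -> ->] /andP[-> ->] /andP[-> _]].
    move=> /and3P[/and3P[_ -> ->] /andP[-> ->] /andP[-> _]].
    by move=> /and3P[/and3P[_ -> ->] /andP[-> ->] _].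
  apply: (tau_gen (a := tau u) (b := tau v) (c := tau u') (d := tau v') (e := tau u'')
    (f := tau v'') _ _ h.1 h'.1 h''.1).
    by move=> x; rewrite !inE => /or4P[|||/or3P[]] /eqP ->; apply: map_f; rewrite mem_enum.
  by rewrite -[[:: tau u; _; _; _; _; _]]/(map tau [:: u; v; u'; v'; u''; v''])
    (map_inj_uniq tau_inj).
- move=> u v w p [uv uw n]; apply: adjacent_chords_not_cross; last exact: ne.
  by apply: contraNneq n => ->.
- move=> u v w z p q de c1 c2.
  have [h1 h2] := cross_at_mem c1; have [h3 h4] := cross_at_mem c2.
  exact: (distinct_chords_meet de h1 h2 h3 h4).
- by move=> u v w z p de np; exact: distinct_chords_cross.
Qed.

Lemma interleaved_chords_cross u v w z : adj u v -> adj w z ->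
  tau u < tau w -> tau w < tau v -> tau v < tau z -> crosses adj D u v w z.
Proof.
move=> uv wz uw wv vz.
have un : uniq [:: u; v; w; z].
  rewrite /= !inE !negb_or -!(inj_eq tau_inj) (lt_eqF uw) (gt_eqF wv) (lt_eqF vz).
  by rewrite (lt_eqF (lt_trans uw wv)) (lt_eqF (lt_trans wv vz)) (lt_eqF (lt_trans (lt_trans uw wv) vz)).
have uv' := lt_trans uw wv; have wz' := lt_trans wv vz.
have pI : exists p, chord_segment (tau u) (tau v) p /\ chord_segment (tau w) (tau z) p.
  rewrite /chord_segment (min_l (ltW uv')) (max_r (ltW uv')) (min_l (ltW wz')) (max_r (ltW wz')).
  move: (tau u) (tau v) (tau w) (tau z) uw wv vz {un uv wz uv' wz'} => a b c d ac cb bd.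
  have s0 : 0 < c + d - (a + b) by lra.
  (* The abscissa where the two lines meet. That it lies between c and b follows from the
     factorisations (c - a) (b - c) and (b - c) (d - b) below. *)
  pose x := (c * d - a * b) / (c + d - (a + b)).
  have xE : x * (c + d - (a + b)) = c * d - a * b by rewrite /x divfK// gt_eqF.
  have cx : c <= x.
    rewrite /x ler_pdivlMr// -subr_ge0.
    have -> : c * d - a * b - c * (c + d - (a + b)) = (c - a) * (b - c) by ring.
    by apply: mulr_ge0; rewrite subr_ge0 ltW.
  have xb : x <= b.
    rewrite /x ler_pdivrMr// -subr_ge0.
    have -> : b * (c + d - (a + b)) - (c * d - a * b) = (b - c) * (d - b) by ring.
    by apply: mulr_ge0; rewrite subr_ge0 ltW.
  exists (x, (a + b) * x - a * b); split; split; rewrite /chord /=.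
  - by [].
  - by rewrite (le_trans (ltW ac) cx) xb.
  - by lra.
  - by rewrite cx (le_trans xb (ltW bd)).
split => //; have [p [h1 h2]] := pI; exists p; split => //.
move=> s ps; rewrite -ps in h1 h2.
have := chord_segment_vertex h1; have := chord_segment_vertex h2.
move: un; rewrite /= !inE !negb_or => /and3P[/and3P[_ n1 n2] /andP[n3 n4] _].
by move=> [->|->] [E|E]; move: n1 n2 n3 n4; rewrite E eqxx.
Qed.

End ParabolaDrawing.

(** * The maximum crossing number *)

Section MaximumCrossingNumber.
Variable R : realType.
Variables (V : finType) (part rank : V -> nat).
Hypothesis rank_inj : injective rank.
Hypothesis rank_part : forall u v, (rank u < rank v)%N -> (part u <= part v)%N.

Definition part_adj : rel V := fun u v => part u != part v.

Definition spread (q : V * V * V * V) : bool :=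
  let: (u, v, w, z) := q in
  [&& uniq [:: u; v; w; z],
      ~~ ((part u == part v) && (part v == part w)),
      ~~ ((part u == part v) && (part v == part z)),
      ~~ ((part u == part w) && (part w == part z)) &
      ~~ ((part v == part w) && (part w == part z))].

Definition spread_quads : {set V * V * V * V} := [set q | spread q].

Lemma part_adj_sym : symmetric part_adj.
Proof. by move=> u v; rewrite /part_adj eq_sym. Qed.

Lemma part_adj_irr : irreflexive part_adj.
Proof. by move=> u; rewrite /part_adj eqxx. Qed.

Section Pairings.
Variable D : drawing R V.
Hypothesis sD : simple_drawing part_adj D.

Lemma crosses_sym u v w z : crosses part_adj D u v w z ->
  crosses part_adj D v u w z /\ crosses part_adj D w z u v.
Proof.
move=> /(crossesE part_adj_sym part_adj_irr sD)[p /(crosses_at_swap part_adj_sym sD)[h1 h2]].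
by split; apply/(crossesE part_adj_sym part_adj_irr sD); exists p.
Qed.

Lemma crosses_flip u v w z : crosses part_adj D u v w z -> crosses part_adj D u v z w.
Proof. by move=> /crosses_sym[_ /crosses_sym[/crosses_sym[]]]. Qed.

(** One clause for each of the three ways to split four vertices into two pairs. *)
Definition pairing_crosses u v w z : Prop :=
  [\/ crosses part_adj D u v w z, crosses part_adj D v w z u | crosses part_adj D u w v z].

(** Adjacent transpositions generate all permutations, so these three lemmas and their counterparts
    for [spread] allow the four vertices to be sorted by [rank]. *)
Lemma pairing_crosses12 u v w z : pairing_crosses u v w z -> pairing_crosses v u w z.
Proof.
move=> [/crosses_sym[c _]|/crosses_sym[_ c]|/crosses_flip c].
- exact: Or31.
- by apply: Or33; apply: crosses_flip; case: (crosses_sym (crosses_flip c)) => _ /crosses_sym[].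
- exact: Or32.
Qed.

Lemma pairing_crosses23 u v w z : pairing_crosses u v w z -> pairing_crosses u w v z.
Proof.
by move=> [c|/crosses_sym[c _]|c]; [exact: Or33|exact: Or32|exact: Or31].
Qed.

Lemma pairing_crosses34 u v w z : pairing_crosses u v w z -> pairing_crosses u v z w.
Proof.
move=> [/crosses_flip c|/crosses_sym[_ /crosses_sym[c _]]|/crosses_sym[_ /crosses_flip c]].
- exact: Or31.
- exact: Or33.
- exact: Or32.
Qed.

Lemma crosses_spread u v w z : crosses part_adj D u v w z -> spread (u, v, w, z).
Proof.
by move=> [+ + un _]; rewrite /part_adj /spread un => /negPf -> /negPf ->; rewrite !andbF.
Qed.

Lemma spread12 u v w z : spread (u, v, w, z) -> spread (v, u, w, z).
Proof.
rewrite /spread => /and5P[un n1 n2 n3 n4]; rewrite n3 n4 !andbT.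
have -> : uniq [:: v; u; w; z] by rewrite -(perm_uniq (s1 := [:: u; v; w; z]))//; apply/permP => P /=; clear; lia.
rewrite /= [part v == _]eq_sym; apply/andP; split.
  by apply: contra n1 => /andP[/eqP e /eqP <-]; rewrite e eqxx.
by apply: contra n2 => /andP[/eqP e /eqP <-]; rewrite e eqxx.
Qed.

Lemma spread23 u v w z : spread (u, v, w, z) -> spread (u, w, v, z).
Proof.
rewrite /spread => /and5P[un n1 n2 n3 n4]; rewrite n3 n2.
have -> : uniq [:: u; w; v; z] by rewrite -(perm_uniq (s1 := [:: u; v; w; z]))//; apply/permP => P /=; clear; lia.
rewrite /= [part w == part v]eq_sym; apply/andP; split.
  by apply: contra n1 => /andP[/eqP -> /eqP ->]; rewrite eqxx.
by apply: contra n4 => /andP[/eqP <- /eqP ->]; rewrite eqxx.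
Qed.

Lemma spread34 u v w z : spread (u, v, w, z) -> spread (u, v, z, w).
Proof.
rewrite /spread => /and5P[un n1 n2 n3 n4]; rewrite n1 n2.
have -> : uniq [:: u; v; z; w] by rewrite -(perm_uniq (s1 := [:: u; v; w; z]))//; apply/permP => P /=; clear; lia.
rewrite [part z == part w]eq_sym /=; apply/andP; split.
  by apply: contra n3 => /andP[/eqP -> /eqP ->]; rewrite eqxx.
by apply: contra n4 => /andP[/eqP -> /eqP ->]; rewrite eqxx.
Qed.

(** The preimages of the crossing quadruples under this map and under [exchange_quad] are the
    quadruples whose second and third pairing crosses. *)
Definition rotate_quad (q : V * V * V * V) : V * V * V * V :=
  let: (u, v, w, z) := q in (v, w, z, u).

Definition exchange_quad (q : V * V * V * V) : V * V * V * V :=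
  let: (u, v, w, z) := q in (u, w, v, z).

Lemma rotate_quad_inj : injective rotate_quad.
Proof. by move=> [[[u v] w] z] [[[u' v'] w'] z'] [-> -> -> ->]. Qed.

Lemma exchange_quad_inj : injective exchange_quad.
Proof. by move=> [[[u v] w] z] [[[u' v'] w'] z'] [-> -> -> ->]. Qed.

Local Notation CQ := (crossing_quads part_adj D).

Definition paired_quads : {set V * V * V * V} :=
  CQ :|: rotate_quad @^-1: CQ :|: exchange_quad @^-1: CQ.

Lemma paired_quadsP u v w z :
  reflect (pairing_crosses u v w z) ((u, v, w, z) \in paired_quads).
Proof.
rewrite !inE /=; apply: (iffP orP) => [[/orP[]|]|[]] /asboolP c.
- exact: Or31.
- exact: Or32.
- exact: Or33.
- by left; rewrite c.
- by left; rewrite c orbT.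
- by right.
Qed.

Lemma paired_quads_spread : paired_quads \subset spread_quads.
Proof.
apply/fintype.subsetP => -[[[u v] w] z] /paired_quadsP; rewrite inE.
move=> [/crosses_spread//|/crosses_spread s|/crosses_spread s].
- by apply: spread12; apply: spread23; apply: spread34.
- exact: spread23.
Qed.

Lemma card_paired_quads_le : (#|paired_quads| <= 3 * #|CQ|)%N.
Proof.
have h1 : (#|rotate_quad @^-1: CQ| <= #|CQ|)%N by rewrite on_card_preimset //; exact: onW_bij (injF_bij rotate_quad_inj).
have h2 : (#|exchange_quad @^-1: CQ| <= #|CQ|)%N.
  by rewrite on_card_preimset //; exact: onW_bij (injF_bij exchange_quad_inj).
apply: leq_trans (leq_card_setU _ _).1 _.
rewrite -[3%N]/(2 + 1)%N mulnDl mul1n leq_add//.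
by apply: leq_trans (leq_card_setU _ _).1 _; rewrite mul2n -addnn leq_add.
Qed.

End Pairings.

(** Any two of the three pairings are the two pairs of opposite edges of one 4-cycle. So
    [good_not_both_cross] makes the three equinumerous sets disjoint, and all of them lie in
    [spread_quads]. *)
Lemma card_crossing_quads_le (D : drawing R V) : good_drawing part_adj D ->
  (3 * #|crossing_quads part_adj D| <= #|spread_quads|)%N.
Proof.
move=> gD; have sD := good_simple gD; set CQ := crossing_quads _ _.
have no2 := good_not_both_cross part_adj_sym gD.
apply: leq_trans (subset_leq_card (paired_quads_spread D)).
have h1 : #|rotate_quad @^-1: CQ| = #|CQ| by rewrite on_card_preimset //; exact: onW_bij (injF_bij rotate_quad_inj).
have h2 : #|exchange_quad @^-1: CQ| = #|CQ| by rewrite on_card_preimset //; exact: onW_bij (injF_bij exchange_quad_inj).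
have d1 : CQ :&: rotate_quad @^-1: CQ = finset.set0.
  apply/finset.setP => -[[[u v] w] z] /=; rewrite !inE /=; apply/negP => /andP[/asboolP c /asboolP c'].
  exact: (no2 _ _ _ _ c c').
have d2 : (CQ :|: rotate_quad @^-1: CQ) :&: exchange_quad @^-1: CQ = finset.set0.
  apply/finset.setP => -[[[u v] w] z] /=; rewrite !inE /=; apply/negP.
  move=> /andP[/orP[/asboolP c|/asboolP c] /asboolP c'].
    by apply: (no2 v u w z); [case: (crosses_sym sD c)|exact: crosses_flip].
  by apply: (no2 v w u z); [exact: crosses_flip|case: (crosses_sym sD c') => /(crosses_flip sD)].
have := cardsUI CQ (rotate_quad @^-1: CQ).
have := cardsUI (CQ :|: rotate_quad @^-1: CQ) (exchange_quad @^-1: CQ).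
rewrite d1 d2 !cards0 !addn0 h1 h2 -/(paired_quads D) => -> ->.
by rewrite -[3%N]/(1 + 1 + 1)%N !mulnDl !mul1n.
Qed.

Lemma exists_parabola_parameters : exists tau : V -> R,
  [/\ forall u v, (rank u < rank v)%N -> tau u < tau v & general_position [seq tau v | v <- enum V]].
Proof.
have [s [sN ss gs]] := exists_general_position R (\max_(v : V) rank v).+1.
have lt v : (rank v < size s)%N by rewrite sN ltnS; exact: (leq_bigmax v).
exists (fun v => nth 0 s (rank v)); split.
  by move=> u v uv; apply: (sorted_ltn_nth (leT := <%R)) => //; [exact: lt_trans|exact: lt|exact: lt].
move=> a b c d e f H; apply: gs => x /H /mapP[v _ ->]; exact: mem_nth.
Qed.

(** For four vertices sorted along the parabola the chords joining first to third and second to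
    fourth interleave. Hence every spread quadruple has a crossing pairing, which makes the union
    bound [card_paired_quads_le] sufficient. *)
Lemma exists_convex_drawing : exists D : drawing R V, good_drawing part_adj D /\
  (#|spread_quads| <= 3 * #|crossing_quads part_adj D|)%N.
Proof.
have [tau [tau_mono tau_gen]] := exists_parabola_parameters.
have tau_inj : injective tau.
  move=> u v E; apply: rank_inj; have [h|h|//] := ltngtP (rank u) (rank v).
    by move: (tau_mono _ _ h); rewrite E ltxx.
  by move: (tau_mono _ _ h); rewrite E ltxx.
have gD := parabola_drawing_good part_adj_sym part_adj_irr tau_inj tau_gen.
have sD := good_simple gD.
exists (parabola_drawing tau); split => //; apply: leq_trans (card_paired_quads_le _).
apply: subset_leq_card; apply/fintype.subsetP => -[[[u v] w] z]; rewrite inE => sp; apply/paired_quadsP.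
pose S u v w z := spread (u, v, w, z) -> pairing_crosses (parabola_drawing tau) u v w z.
have S12 a b c d : S a b c d -> S b a c d.
  by move=> h /spread12/h/(pairing_crosses12 sD).
have S23 a b c d : S a b c d -> S a c b d.
  by move=> h /spread23/h/(pairing_crosses23 sD).
have S34 a b c d : S a b c d -> S a b d c.
  by move=> h /spread34/h/(pairing_crosses34 sD).
have sorted4 a b c d : (rank a < rank b)%N -> (rank b < rank c)%N -> (rank c < rank d)%N -> S a b c d.
  move=> ab bc cd /and5P[un n1 n2 n3 n4]; apply: Or33.
  have pab := rank_part ab; have pbc := rank_part bc; have pcd := rank_part cd.
  apply: (interleaved_chords_cross tau_inj).
  (* If both ends of a chord lay in one part, monotonicity of [part] along [rank] would put the
     vertex between them there too, giving three in one part. *)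
  - by apply: contra n1 => /eqP ac; apply/andP; split; apply/eqP; clear -pab pbc ac; lia.
  - by apply: contra n4 => /eqP bd; apply/andP; split; apply/eqP; clear -pbc pcd bd; lia.
  - exact: tau_mono.
  - exact: tau_mono.
  - exact: tau_mono.
have neq a b c d : spread (a, b, c, d) -> [/\ rank a <> rank b, rank a <> rank c, rank a <> rank d,
    rank b <> rank c & rank b <> rank d] /\ rank c <> rank d.
  move=> /and5P[+ _ _ _ _]; rewrite /= !inE !negb_or -!(inj_eq rank_inj).
  by move=> /and3P[/and3P[/eqP ? /eqP ? /eqP ?] /andP[/eqP ? /eqP ?] /andP[/eqP ? _]].
(* Insertion sort: [sorted3] inserts the fourth vertex among three sorted ones, and [any] sorts the
   first three. *)
have sorted3 a b c d : (rank a < rank b)%N -> (rank b < rank c)%N -> S a b c d.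
  move=> ab bc s; have [[_ _ ad _ bd] cd] := neq _ _ _ _ s; move: s; rewrite -/(S a b c d).
  have [cd'|dc] := ltnP (rank c) (rank d); first exact: sorted4.
  have [bd'|db] := ltnP (rank b) (rank d).
    by apply: S34; apply: sorted4 => //; lia.
  have [ad'|da] := ltnP (rank a) (rank d).
    by apply: S34; apply: S23; apply: sorted4 => //; lia.
  by apply: S34; apply: S23; apply: S12; apply: sorted4 => //; lia.
have {sorted4} any a b c d : S a b c d.
  move=> s; have [[ab ac _ bc _] _] := neq _ _ _ _ s; move: s; rewrite -/(S a b c d).
  have [ab'|ba] := ltnP (rank a) (rank b).
    have [bc'|cb] := ltnP (rank b) (rank c); first exact: sorted3.
    have [ac'|ca] := ltnP (rank a) (rank c).
      by apply: S23; apply: sorted3; lia.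
    by apply: S23; apply: S12; apply: sorted3; lia.
  have [ac'|ca] := ltnP (rank a) (rank c).
    by apply: S12; apply: sorted3; lia.
  have [bc'|cb] := ltnP (rank b) (rank c).
    by apply: S12; apply: S23; apply: sorted3; lia.
  by apply: (S12); apply: S23; apply: S12; apply: sorted3; lia.
exact: any.
Qed.

(** The factor is 3 pairings times 8 orderings. The convex drawing attains the upper bound, so the
    maximum exists and [xget] does not return its default. *)
Lemma CR_spread : (24 * CR R part_adj)%N = #|spread_quads|.
Proof.
have [D0 [g0 le0]] := exists_convex_drawing.
have cQ (D : drawing R V) : good_drawing part_adj D -> #|crossing_quads part_adj D| = (8 * cr part_adj D)%N.
  by move=> gD; apply: (card_crossing_quads part_adj_sym part_adj_irr (good_simple gD)).
have up (D : drawing R V) : good_drawing part_adj D -> (24 * cr part_adj D <= #|spread_quads|)%N.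
  by move=> gD; have := card_crossing_quads_le gD; rewrite cQ// mulnA.
have lo : (#|spread_quads| <= 24 * cr part_adj D0)%N by move: le0; rewrite cQ// mulnA.
have E0 : (24 * cr part_adj D0)%N = #|spread_quads| by apply/eqP; rewrite eqn_leq up// lo.
rewrite /CR; case: xgetP => [m _ [[D gD <-] mx]|/(_ (cr part_adj D0))[]].
  have := mx _ g0; have := up _ gD; lia.
split; first by exists D0.
move=> D /up; lia.
Qed.

End MaximumCrossingNumber.

(** * Random points on the sphere *)

Section UniformSphere.
Variable R : realType.
Local Notation space := (R * R * R)%type.
Implicit Types (a b c x : space).

Definition dot3 a b : R := a.1.1 * b.1.1 + a.1.2 * b.1.2 + a.2 * b.2.

Definition cross3 a b : space :=
  (a.1.2 * b.2 - a.2 * b.1.2, a.2 * b.1.1 - a.1.1 * b.2, a.1.1 * b.1.2 - a.1.2 * b.1.1).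

Lemma measurable_x : measurable_fun setT (fun x : space => x.1.1).
Proof. by apply: (measurableT_comp measurable_fst); exact: measurable_fst. Qed.

Lemma measurable_y : measurable_fun setT (fun x : space => x.1.2).
Proof. by apply: (measurableT_comp measurable_snd); exact: measurable_fst. Qed.

Lemma measurable_z : measurable_fun setT (fun x : space => x.2).
Proof. exact: measurable_snd. Qed.

Lemma measurable_dot3 d (T : measurableType d) (f g : T -> space) :
  measurable_fun setT f -> measurable_fun setT g ->
  measurable_fun setT (fun t => dot3 (f t) (g t)).
Proof.
move=> mf mg.
have m1 (h : T -> space) : measurable_fun setT h -> measurable_fun setT (fun t => (h t).1.1).
  by move=> mh; exact: (measurableT_comp measurable_x mh).
have m2 (h : T -> space) : measurable_fun setT h -> measurable_fun setT (fun t => (h t).1.2).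
  by move=> mh; exact: (measurableT_comp measurable_y mh).
have m3 (h : T -> space) : measurable_fun setT h -> measurable_fun setT (fun t => (h t).2).
  by move=> mh; exact: (measurableT_comp measurable_z mh).
apply: measurable_funD; last by apply: measurable_funM; exact: m3.
by apply: measurable_funD; apply: measurable_funM; do ?exact: m1; exact: m2.
Qed.

Lemma measurable_cross3 d (T : measurableType d) (f g : T -> space) :
  measurable_fun setT f -> measurable_fun setT g ->
  measurable_fun setT (fun t => cross3 (f t) (g t)).
Proof.
move=> mf mg.
have m1 (h : T -> space) : measurable_fun setT h -> measurable_fun setT (fun t => (h t).1.1).
  by move=> mh; exact: (measurableT_comp measurable_x mh).
have m2 (h : T -> space) : measurable_fun setT h -> measurable_fun setT (fun t => (h t).1.2).
  by move=> mh; exact: (measurableT_comp measurable_y mh).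
have m3 (h : T -> space) : measurable_fun setT h -> measurable_fun setT (fun t => (h t).2).
  by move=> mh; exact: (measurableT_comp measurable_z mh).
apply: measurable_fun_pair; first apply: measurable_fun_pair.
- by apply: measurable_funB; apply: measurable_funM; [exact: m2|exact: m3|exact: m3|exact: m2].
- by apply: measurable_funB; apply: measurable_funM; [exact: m3|exact: m1|exact: m1|exact: m3].
- by apply: measurable_funB; apply: measurable_funM; [exact: m1|exact: m2|exact: m2|exact: m1].
Qed.

Lemma enormE x : enorm x = Num.sqrt (dot3 x x).
Proof. by rewrite /enorm /dot3 !expr2. Qed.

Lemma dot3_ge0 x : 0 <= dot3 x x.
Proof. by rewrite /dot3 -!expr2 !addr_ge0 ?sqr_ge0. Qed.

Lemma dot3_eq0 x : dot3 x x = 0 -> x = 0.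
Proof.
move=> /eqP; rewrite /dot3 -!expr2 !paddr_eq0 ?addr_ge0 ?sqr_ge0// !sqrf_eq0.
by case: x => -[x y] z /= /andP[/andP[/eqP -> /eqP ->] /eqP ->].
Qed.

Lemma measurable_enorm : measurable_fun setT (@enorm R).
Proof.
have -> : @enorm R = (fun x => (dot3 x x) `^ 2^-1).
  by apply/funext => x; rewrite enormE powR12_sqrt// dot3_ge0.
have md : measurable_fun setT (fun x : space => dot3 x x) by exact: measurable_dot3.
have h : measurable_fun setT (fun x : R => x `^ 2^-1) by exact: measurable_powR.
have h2 := measurableT_comp h md; exact: h2.
Qed.

Lemma measurable_enormV : measurable_fun setT (fun x : space => (enorm x)^-1).
Proof.
have -> : (fun x : space => (enorm x)^-1) = (fun x => (enorm x) `^ (- 1)).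
  by apply/funext => x; rewrite powR_inv1// enormE sqrtr_ge0.
have h : measurable_fun setT (fun x : R => x `^ (- 1)) by exact: measurable_powR.
have h2 := measurableT_comp h measurable_enorm; exact: h2.
Qed.

Definition cone (A : set space) : set space :=
  [set x | ball3 x /\ A ((enorm x)^-1 *: x)].

Lemma measurable_ball3 : measurable (@ball3 R).
Proof.
have -> : @ball3 R = @enorm R @^-1` `]0, 1]%classic.
  by apply/seteqP; split => x; rewrite /ball3 /= in_itv.
by rewrite -[X in measurable X]setTI; apply: measurable_enorm.
Qed.

Lemma measurable_cone A : measurable A -> measurable (cone A).
Proof.
move=> mA; apply: measurableI; first exact: measurable_ball3.
rewrite -[X in measurable X]setTI.
have : measurable_fun setT (fun x : space => (enorm x)^-1 *: x); last by apply.
have -> : (fun x : space => (enorm x)^-1 *: x) =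
   (fun x => ((enorm x)^-1 * x.1.1, (enorm x)^-1 * x.1.2, (enorm x)^-1 * x.2)).
  by apply/funext => -[[x y] z].
apply: measurable_fun_pair; first apply: measurable_fun_pair.
- by apply: measurable_funM; [exact: measurable_enormV|exact: measurable_x].
- by apply: measurable_funM; [exact: measurable_enormV|exact: measurable_y].
- by apply: measurable_funM; [exact: measurable_enormV|exact: measurable_z].
Qed.

Lemma volume_ge0 A : (0 <= @volume R A)%E.
Proof. exact: measure_ge0. Qed.

Lemma volume_subset A B : measurable A -> measurable B -> A `<=` B ->
  (@volume R A <= volume B)%E.
Proof. by move=> mA mB AB; apply: le_measure; rewrite ?inE. Qed.

Lemma measurable_plane c : measurable [set x | dot3 c x = 0].
Proof.
have -> : [set x | dot3 c x = 0] = dot3 c @^-1` [set 0] by [].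
by rewrite -[X in measurable X]setTI; apply: measurable_dot3.
Qed.

Lemma lebesgue_measure_line (a b : R) : a != 0 ->
  lebesgue_measure [set x : R | b + a * x = 0] = 0%E.
Proof.
move=> a0; have -> : [set x : R | b + a * x = 0] = [set - b / a].
  apply/seteqP; split => x /=; last by move=> ->; rewrite mulrCA divff// mulr1 subrr.
  by move=> /eqP; rewrite addrC addr_eq0 => /eqP E; rewrite -E mulrAC divff// mul1r.
exact: lebesgue_measure_set1.
Qed.

(** Fubini along an axis on which the normal has a nonzero coordinate: every section is a single
    point. Coordinates on which the normal vanishes split off as factors R of infinite measure,
    harmless because 0 times infinity is 0 in [\bar R]. *)
Lemma volume_plane c : c != 0 -> @volume R [set x | dot3 c x = 0] = 0%E.
Proof.
move=> c0; have [c2|c2] := eqVneq c.2 0; last first.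
  apply: integral0_eq => -[x y] _; rewrite [LHS]/=.
  have -> : xsection [set x | dot3 c x = 0] (x, y) =
      [set z | c.1.1 * x + c.1.2 * y + c.2 * z = 0].
    by apply/seteqP; split => z; rewrite /xsection /= inE.
  exact: lebesgue_measure_line.
pose L := [set p : R * R | c.1.1 * p.1 + c.1.2 * p.2 = 0].
have -> : [set x | dot3 c x = 0] = L `*` setT.
  by apply/seteqP; split => -[p z]; rewrite /L /dot3 /= c2 mul0r addr0 //; case.
have mL : measurable L.
  have -> : L = (fun p : R * R => c.1.1 * p.1 + c.1.2 * p.2) @^-1` [set 0] by [].
  rewrite -[X in measurable X]setTI.
  have : measurable_fun setT (fun p : R * R => c.1.1 * p.1 + c.1.2 * p.2); last by apply.
  by apply: measurable_funD; apply: measurable_funM.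
rewrite /volume product_measure1E//.
transitivity ((0 : \bar R) * lebesgue_measure [set: R])%E; last by rewrite mul0e.
congr (_ * _)%E; change ((@lebesgue_measure R \x @lebesgue_measure R)%E L = 0%E).
have [c1|c1] := eqVneq c.1.2 0; last first.
  apply: integral0_eq => x _; rewrite [LHS]/=.
  have -> : xsection L x = [set y | c.1.1 * x + c.1.2 * y = 0].
    by apply/seteqP; split => z; rewrite /xsection /= inE.
  exact: lebesgue_measure_line.
have -> : L = [set x : R | 0 + c.1.1 * x = 0] `*` setT.
  by apply/seteqP; split => -[x y]; rewrite /L /= c1 mul0r addr0 add0r //; case.
have c11 : c.1.1 != 0.
  by apply: contraNneq c0; case: c c2 c1 {L mL} => -[a b] d /= -> -> ->.
have mK : measurable [set x : R | 0 + c.1.1 * x = 0].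
  have -> : [set x : R | 0 + c.1.1 * x = 0] = (fun x : R => 0 + c.1.1 * x) @^-1` [set 0] by [].
  rewrite -[X in measurable X]setTI.
  have : measurable_fun setT (fun x : R => 0 + c.1.1 * x); last by apply.
  by apply: measurable_funD => //; apply: measurable_funM.
rewrite product_measure1E//.
transitivity ((0 : \bar R) * lebesgue_measure [set: R])%E; last by rewrite mul0e.
by congr (_ * _)%E; exact: lebesgue_measure_line.
Qed.

Lemma measurable_opp3 : measurable_fun setT (fun x : space => - x).
Proof.
have -> : (fun x : space => - x) = (fun x => (- x.1.1, - x.1.2, - x.2)).
  by apply/funext => -[[x y] z].
have mo : measurable_fun setT (fun x : R => - x) by exact: oppr_measurable.
apply: measurable_fun_pair; first apply: measurable_fun_pair.
- have h := measurableT_comp mo measurable_x; exact: h.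
- have h := measurableT_comp mo measurable_y; exact: h.
- have h := measurableT_comp mo measurable_z; exact: h.
Qed.

(** The section at x of the preimage is the [n2]-preimage of the section at [n1 x], and a change of
    variable by [n1] removes it from the outer integral. Two applications to the sign change on the
    line give [volumeN]. *)
Lemma product_measureN d1 d2 (T1 : measurableType d1) (T2 : measurableType d2)
    (m1 : {measure set T1 -> \bar R})
    (m2 : {sigma_finite_measure set T2 -> \bar R}) (n1 : T1 -> T1) (n2 : T2 -> T2) :
  measurable_fun setT n1 ->
  (forall A, measurable A -> m1 (n1 @^-1` A) = m1 A) ->
  (forall A, measurable A -> m2 (n2 @^-1` A) = m2 A) ->
  forall A, measurable A ->
    (m1 \x m2)%E ((fun p => (n1 p.1, n2 p.2)) @^-1` A) = (m1 \x m2)%E A.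
Proof.
move=> mn1 H1 H2 A mA; pose g := m2 \o xsection A.
have mg : measurable_fun setT g by exact: measurable_fun_xsection.
transitivity (\int[m1]_(x in n1 @^-1` setT) (g \o n1) x)%E.
  rewrite preimage_setT; apply: eq_integral => x _; rewrite /g /=.
  rewrite -(H2 _ (measurable_xsection _ mA)); congr (m2 _).
have mp : measurable_fun setT (n1 : T1 -> T1) by [].
rewrite -(ge0_integral_pushforward mp) //.
apply: eq_measure_integral => B mB _; exact: H1.
Qed.

Lemma volumeN A : measurable A -> @volume R ((fun x => - x) @^-1` A) = volume A.
Proof.
have mo : measurable_fun setT (fun x : R => - x) by exact: oppr_measurable.
have lN (B : set R) : measurable B ->
    @lebesgue_measure R ((fun x : R => - x) @^-1` B) = lebesgue_measure B.
  by move=> mB; exact: lebesgue_measureN.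
have m2 : measurable_fun setT (fun p : R * R => (- p.1, - p.2)).
  apply: measurable_fun_pair.
    exact: (measurableT_comp mo measurable_fst).
  exact: (measurableT_comp mo measurable_snd).
move=> mA.
pose T := measurableTypeR R.
have H2 := @product_measureN _ _ T T lebesgue_measure lebesgue_measure _ _ mo lN lN.
have H3 := @product_measureN _ _ _ T (@lebesgue_measure R \x @lebesgue_measure R)%E
  lebesgue_measure _ _ m2 H2 lN.
have H4 := H3 A mA; exact: H4.
Qed.

Lemma enormN x : enorm (- x) = enorm x.
Proof. by rewrite /enorm /= !sqrrN. Qed.

Lemma uniform_sphereN A : measurable A ->
  uniform_sphere ((fun x => - x) @^-1` A) = uniform_sphere A.
Proof.
move=> mA; rewrite /uniform_sphere -[in RHS](volumeN (measurable_cone mA)).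
congr (volume _ / _)%E; apply/seteqP; split => x; rewrite /cone /ball3 /= enormN scalerN //.
Qed.

Lemma uniform_sphere_null A B : measurable A -> measurable B -> cone A `<=` B ->
  @volume R B = 0%E -> uniform_sphere A = 0%E.
Proof.
move=> mA mB AB B0; rewrite /uniform_sphere -/(cone A).
have -> : volume (cone A) = 0%E; last by rewrite mul0e.
apply/eqP; rewrite eq_le volume_ge0 andbT -B0; apply: volume_subset => //.
exact: measurable_cone.
Qed.

Lemma uniform_sphere_plane c : c != 0 -> uniform_sphere [set x | dot3 c x = 0] = 0%E.
Proof.
move=> c0; apply: (uniform_sphere_null (B := [set x | dot3 c x = 0])).
- exact: measurable_plane.
- exact: measurable_plane.
- move=> x [/andP[x0 _]] /=.
  have -> : dot3 c ((enorm x)^-1 *: x) = (enorm x)^-1 * dot3 c x.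
    by rewrite /dot3 /= /GRing.scale /=; ring.
  by move=> /eqP; rewrite mulf_eq0 invr_eq0 (gt_eqF x0) => /eqP.
- exact: volume_plane.
Qed.

Lemma measurable_sphere : measurable (@sphere R).
Proof.
have -> : @sphere R = @enorm R @^-1` [set 1] by [].
by rewrite -[X in measurable X]setTI; apply: measurable_enorm.
Qed.

Lemma uniform_sphere_off : uniform_sphere (~` @sphere R) = 0%E.
Proof.
apply: (uniform_sphere_null (B := set0)) => //.
- by apply: measurableC; exact: measurable_sphere.
- move=> x [/andP[x0 _]]; apply => /=; rewrite /sphere /=.
  rewrite enormE /dot3 /= /GRing.scale /=.
  have -> : (enorm x)^-1 * x.1.1 * ((enorm x)^-1 * x.1.1) + (enorm x)^-1 * x.1.2 * ((enorm x)^-1 * x.1.2) +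
      (enorm x)^-1 * x.2 * ((enorm x)^-1 * x.2) = (enorm x)^-1 ^+ 2 * dot3 x x.
    by rewrite /dot3; ring.
  by rewrite exprVn enormE sqr_sqrtr ?dot3_ge0// mulVf ?sqrtr1// -[dot3 x x]sqr_sqrtr ?dot3_ge0// -enormE expf_neq0// gt_eqF.
Qed.
End UniformSphere.

(** * The joint law of the vertices *)

Section UniformFamily.
Variables (R : realType) (V : finType).
Local Notation space := (R * R * R)%type.

Definition cylinder (A : V -> set space) : set (V -> space) := [set f | forall v, A v (f v)].

Definition cylinders : set (set (V -> space)) :=
  [set C | exists2 A, forall v, measurable (A v) & C = cylinder A].

Local Notation placements := (g_sigma_algebraType cylinders).

Lemma setI_closed_cylinders : setI_closed cylinders.
Proof.
move=> _ _ [A mA ->] [B mB ->]; exists (fun v => A v `&` B v).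
  by move=> v; exact: measurableI.
by apply/seteqP; split => [f [fA fB] v|f fAB]; split => // v; case: (fAB v).
Qed.

Lemma cylindersT : cylinders setT.
Proof. by exists (fun=> setT) => //; apply/seteqP; split. Qed.

Lemma measurable_coord v : measurable_fun setT (fun f : placements => f v).
Proof.
move=> _ A mA; rewrite setTI; apply: sub_sigma_algebra.
exists (fun w => if w == v then A else setT); first by move=> w; case: ifP.
apply/seteqP; split => [f /= fA w|f /(_ v)]; last by rewrite eqxx.
by have [->|] := eqVneq w v.
Qed.

Section Placement.
Context d (T : measurableType d) (X : V -> T -> space).
Hypothesis mX : forall v, measurable_fun setT (X v).

Definition placement (t : T) : placements := X ^~ t.

Lemma preimage_cylinder A :
  placement @^-1` (cylinder A) = \bigcap_(v in [set: V]) (X v @^-1` A v).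
Proof. by apply/seteqP; split => [t h v _|t h v]; [exact: h|exact: (h v I)]. Qed.

Lemma measurable_placement : measurable_fun setT placement.
Proof.
apply: (@measurability _ _ T placements setT placement cylinders) => // _ [_ [A mA ->] <-].
rewrite setTI preimage_cylinder; apply: fin_bigcap_measurable; first exact: finite_finset.
by move=> v _; rewrite -[X in measurable X]setTI; exact: mX.
Qed.

Definition uniform_family (m : set T -> \bar R) : Prop :=
  forall A : V -> set space, (forall v, measurable (A v)) ->
    m (\bigcap_(v in [set: V]) (X v @^-1` A v)) = (\prod_(v : V) uniform_sphere (A v))%E.

End Placement.

(** Cylinders are closed under intersection and generate the sigma-algebra, so the product formula
    fixes the law. The two families may live on different spaces; this is what permits reflecting or
    redrawing vertices. *)
Lemma law_unique d d' (T : measurableType d) (T' : measurableType d')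
    (m : {measure set T -> \bar R}) (m' : {measure set T' -> \bar R})
    (X : V -> T -> space) (Y : V -> T' -> space) :
  (forall v, measurable_fun setT (X v)) -> (forall v, measurable_fun setT (Y v)) ->
  uniform_family X m -> uniform_family Y m' -> (m setT < +oo)%E ->
  forall C : set placements, measurable C -> m (placement X @^-1` C) = m' (placement Y @^-1` C).
Proof.
move=> mX mY uX uY mT C mC.
have pX := measurable_placement mX; have pY := measurable_placement mY.
have cover : \bigcup_(k in [set: nat]) [set: placements] = setT by apply/seteqP; split => // f _; exists 0%N.
have H := @measure_unique _ R placements cylinders (fun=> setT) erefl setI_closed_cylinders
  (fun=> cylindersT) cover (pushforward m (placement X)) (pushforward m' (placement Y)).
apply: (H pX pY _ _ C mC).
  move=> _ [A mA ->]; 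
  transitivity (\prod_(v : V) uniform_sphere (A v))%E.
    by rewrite -uX// -preimage_cylinder.
  by rewrite -uY// -preimage_cylinder.
by move=> _; exact: mT.
Qed.

Section Resampling.
Context d (T : measurableType d) (P : probability T R) (X : V -> T -> space).
Hypothesis mX : forall v, measurable_fun setT (X v).
Hypothesis lawX : forall v A, measurable A -> P (X v @^-1` A) = uniform_sphere A.
Hypothesis uX : uniform_family X P.
Variable v0 : V.

(** Vertex [v0] is redrawn from a second copy of the probability space. The law is unchanged, but
    [v0] now has its own factor in [P \x P], over which Fubini can integrate. *)
Definition resampled (v : V) (t : T * T) : space := if v == v0 then X v0 t.2 else X v t.1.

Lemma measurable_resampled v : measurable_fun setT (resampled v).
Proof.
rewrite /resampled; case: (v == v0).
  exact: (measurableT_comp (mX v0) measurable_snd).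
exact: (measurableT_comp (mX v) measurable_fst).
Qed.

Lemma uniform_sphereT : uniform_sphere [set: space] = 1%E.
Proof. by rewrite -(lawX v0)// preimage_setT; exact: probability_setT. Qed.

Lemma uniform_resampled : uniform_family resampled (P \x P)%E.
Proof.
move=> A mA; pose A' v := if v == v0 then setT else A v.
have mA' v : measurable (A' v) by rewrite /A'; case: ifP.
have mpre v B : measurable B -> measurable (X v @^-1` B).
  by move=> mB; rewrite -[X in measurable X]setTI; exact: mX.
have -> : \bigcap_(v in [set: V]) (resampled v @^-1` A v) =
    (\bigcap_(v in [set: V]) (X v @^-1` A' v)) `*` (X v0 @^-1` A v0).
  apply/seteqP; split => [[t t'] h|[t t'] [h h'] v _].
    split => [v _|]; last by move: (h v0 I); rewrite /resampled /= eqxx.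
    by rewrite /A' /=; case: eqVneq => // n; move: (h v I); rewrite /resampled /= (negbTE n).
  rewrite /resampled /=; case: eqVneq => [->|n] //.
  by move: (h v I); rewrite /A' /= (negbTE n).
transitivity (P (\bigcap_(v in [set: V]) (X v @^-1` A' v)) * P (X v0 @^-1` A v0))%E.
  apply: product_measure1E; last exact: mpre.
  by apply: fin_bigcap_measurable => [|v _]; [exact: finite_finset|exact: mpre].
rewrite uX// lawX// (bigD1 v0)//= [in RHS](bigD1 v0)//= /A' eqxx uniform_sphereT mul1e muleC.
by congr (_ * _)%E; apply: eq_bigr => v /negbTE ->.
Qed.

(** With the other vertices fixed, [c] is a constant vector, nonzero off a null event, and the great
    circle orthogonal to it has measure zero. Integrating these sections over [P] gives the
    claim. *)
Lemma null_dot3 (c : placements -> space) : measurable_fun setT c ->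
  (forall f g : V -> space, (forall v, v != v0 -> f v = g v) -> c f = c g) ->
  P (placement X @^-1` [set f | c f = 0]) = 0%E ->
  P (placement X @^-1` [set f : placements | dot3 (c f) (f v0) = 0]) = 0%E.
Proof.
move=> mc c_indep c0.
pose C := [set f : placements | dot3 (c f) (f v0) = 0].
have mC : measurable C.
  have -> : C = (fun f : placements => dot3 (c f) (f v0)) @^-1` [set 0] by [].
  rewrite -[X in measurable X]setTI.
  by have := measurable_dot3 mc (@measurable_coord v0); apply.
have mR := measurable_resampled.
have PT : (P setT < +oo)%E by rewrite (@probability_setT _ _ _ P) ltry.
have -> : P (placement X @^-1` C) = (P \x P)%E (placement resampled @^-1` C).
  have h := law_unique mX mR uX uniform_resampled PT mC; exact: h.
have mB : measurable (placement resampled @^-1` C).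
  by rewrite -[X in measurable X]setTI; exact: (measurable_placement mR).
pose N := placement X @^-1` [set f | c f = 0].
have mN : measurable N.
  have mz : measurable [set f | c f = 0].
    have -> : [set f | c f = 0] = (fun f => dot3 (c f) (c f)) @^-1` [set 0].
      apply/seteqP; split => f /=; last exact: dot3_eq0.
      by move=> ->; rewrite /dot3 /= !mul0r !addr0.
    rewrite -[X in measurable X]setTI.
    by have := measurable_dot3 mc mc; apply.
  by rewrite -[X in measurable X]setTI; exact: (measurable_placement mX).
pose phi t := P (xsection (placement resampled @^-1` C) t).
have mphi : measurable_fun setT phi by exact: measurable_fun_xsection.
transitivity (\int[P]_t phi t)%E; first by [].
rewrite (ae_eq_integral (cst 0%E)) ?integral0//.
exists N; split => // t; apply: contra_notP => /= ct _.
rewrite /phi; have -> : xsection (placement resampled @^-1` C) t =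
    X v0 @^-1` [set x | dot3 (c (placement X t)) x = 0].
  have E t' : c (placement resampled (t, t')) = c (placement X t).
    by apply: c_indep => v n; rewrite /placement /resampled (negbTE n).
  by apply/seteqP; split => t'; rewrite /xsection /= inE /C /= E /placement /resampled eqxx.
rewrite lawX ?uniform_sphere_plane//; first exact/eqP.
exact: measurable_plane.
Qed.

End Resampling.
End UniformFamily.

(** * Almost sure general position *)

Section GeneralPosition.
Variables (R : realType) (V : finType).
Local Notation space := (R * R * R)%type.
Local Notation placements := (g_sigma_algebraType (@cylinders R V)).

Definition det3 (a b c : space) : R := dot3 (cross3 a b) c.

Definition pole : space := (0, 0, 1).

(** The determinants say, in order: the great circle through two vertices avoids the centre of
    projection; no three vertices share a great circle; the line where the planes of a, b and of c,
    d meet is not in the plane of e, g, so no three disjoint edges are concurrent. *)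
Definition spherical_position (f : V -> space) : Prop :=
  [/\ forall v, sphere (f v),
      forall u v, u != v -> det3 (f u) pole (f v) != 0,
      forall u v w, uniq [:: u; v; w] -> det3 (f u) (f v) (f w) != 0 &
      forall a b c d e g, uniq [:: a; b; c; d; e; g] ->
        det3 (cross3 (cross3 (f a) (f b)) (cross3 (f c) (f d))) (f e) (f g) != 0].

Context d (T : measurableType d) (P : probability T R) (X : V -> T -> space).
Hypothesis UX : uniform_independent P X.

Let mX v : measurable_fun setT (X v). Proof. by case: UX. Qed.

Let lawX v A : measurable A -> P (X v @^-1` A) = uniform_sphere A.
Proof. by case: UX => _ + _; apply. Qed.

Lemma uniform_independent_family : uniform_family X P.
Proof.
by move=> A mA; case: UX => _ _ ->//; apply: eq_bigr => v _; exact: lawX.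
Qed.
Let uX := uniform_independent_family.

(** The inductive step of general position: each condition provides the almost surely nonzero vector
    [c] for a later one, from constant vectors through the pole and triples to six vertices. *)
Lemma ae_dot3 v0 (c : placements -> space) : measurable_fun setT c ->
  (forall f g : V -> space, (forall v, v != v0 -> f v = g v) -> c f = c g) ->
  {ae P, forall t, c (X ^~ t) != 0} -> {ae P, forall t, dot3 (c (X ^~ t)) (X v0 t) != 0}.
Proof.
move=> mc ci c0.
have mp := measurable_placement mX.
have meas (g : placements -> R) : measurable_fun setT g -> measurable (placement X @^-1` [set f | g f = 0]).
  move=> mg; rewrite -[X in measurable X]setTI; apply: mp => //.
  have -> : [set f | g f = 0] = g @^-1` [set 0] by [].
  by rewrite -[X in measurable X]setTI; apply: mg.
have E : [set f | c f = 0] = [set f | dot3 (c f) (c f) = 0].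
  apply/seteqP; split => f /=; last exact: dot3_eq0.
  by move=> ->; rewrite /dot3 /= !mul0r !addr0.
have := null_dot3 mX lawX uX mc ci.
have m1 : measurable (placement X @^-1` [set f | c f = 0]).
  by rewrite E; apply: meas; exact: measurable_dot3.
have m2 : measurable (placement X @^-1` [set f : placements | dot3 (c f) (f v0) = 0]).
  by apply: meas; apply: measurable_dot3 => //; exact: measurable_coord.
have -> : P (placement X @^-1` [set f | c f = 0]) = 0%E.
  apply/negligibleP => //; apply: negligibleS c0 => t /= ct.
  by rewrite ct eqxx.
move=> /(_ erefl) N; exists (placement X @^-1` [set f : placements | dot3 (c f) (f v0) = 0]).
by split => // t /= /negP; rewrite negbK => /eqP.
Qed.

Lemma ae_dot3_const e v : e != 0 -> {ae P, forall t, dot3 e (X v t) != 0}.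
Proof.
by move=> e0; apply: (ae_dot3 (c := fun=> e)) => //; exact: aeW.
Qed.

Let mcoord v : measurable_fun setT (fun f : placements => f v).
Proof. exact: measurable_coord. Qed.

Lemma ae_det3_pole u v : u != v -> {ae P, forall t, det3 (X u t) pole (X v t) != 0}.
Proof.
move=> uv; apply: (ae_dot3 (c := fun f => cross3 (f u) pole)).
- by apply: measurable_cross3 => //; exact: measurable_cst.
- by move=> f g fg; rewrite fg.
(* If [cross3 (X u t) pole] vanishes, so does the first coordinate of [X u t], a null event. *)
- have e0 : (1, 0, 0) != 0 :> space by apply/eqP => -[/eqP]; rewrite oner_eq0.
  apply: filterS (ae_dot3_const u e0) => t; apply: contraNneq.
  by rewrite /cross3 /dot3 /= => -[]; rewrite !mulr1 !mulr0 subr0 => _; lra.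
Qed.

Lemma ae_det3 u v w : uniq [:: u; v; w] -> {ae P, forall t, det3 (X u t) (X v t) (X w t) != 0}.
Proof.
rewrite /= !inE negb_or andbT => /andP[/andP[uv uw] vw].
apply: (ae_dot3 (c := fun f => cross3 (f u) (f v))).
- exact: measurable_cross3.
- by move=> f g fg; rewrite !fg.
- apply: filterS (ae_det3_pole uv) => t; apply: contraNneq.
  rewrite /det3 /cross3 /dot3 /= => -[E1 E2 E3].
  apply/eqP; transitivity (- ((X u t).1.1 * (X v t).1.2 - (X u t).1.2 * (X v t).1.1)); first by ring.
  by rewrite E3 oppr0.
Qed.

Lemma ae_six a b c d' e g : uniq [:: a; b; c; d'; e; g] ->
  {ae P, forall t, det3 (cross3 (cross3 (X a t) (X b t)) (cross3 (X c t) (X d' t))) (X e t) (X g t) != 0}.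
Proof.
move=> un; apply: (ae_dot3 (c := fun f => cross3 (cross3 (cross3 (f a) (f b)) (cross3 (f c) (f d'))) (f e))).
- by do !apply: measurable_cross3.
- move: un; rewrite /= !inE !negb_or => /and5P[/and5P[_ _ _ _ ag] /and4P[_ _ _ bg] /and3P[_ _ cg] /andP[_ dg] /andP[eg _]].
  by move=> f h fh; rewrite !fh.
- have u1 : uniq [:: a; b; d'].
    by move: un; rewrite /= !inE !negb_or => /and5P[/and5P[-> _ -> _ _] /and4P[_ -> _ _] _ _ _].
  have u2 : uniq [:: c; e; d'].
    by move: un; rewrite /= !inE !negb_or [e == d']eq_sym => /and5P[_ _ /and3P[-> -> _] /andP[-> _] _].
  (* Pairing the vector with [X d' t] gives exactly the product of the determinants of a, b, d' and
     c, e, d', so it is nonzero when both are. *)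
  apply: filterS2 (ae_det3 u1) (ae_det3 u2) => t D1 D2.
  apply: contraNneq (mulf_neq0 D1 D2) => [[E1 E2 E3]].
  move: (X a t) (X b t) (X c t) (X d' t) (X e t) E1 E2 E3 {D1 D2} => [[a1 a2] a3] [[b1 b2] b3] [[c1 c2] c3] [[d1 d2] d3] [[e1 e2] e3].
  rewrite /det3 /cross3 /dot3 /= => E1 E2 E3.
  apply/eqP; transitivity (d1 * 0 + d2 * 0 + d3 * 0 : R); last by ring.
  rewrite -{1}E1 -{1}E2 -{1}E3; ring.
Qed.

Lemma ae_sphere v : {ae P, forall t, sphere (X v t)}.
Proof.
have mS : measurable (~` @sphere R) by apply: measurableC; exact: measurable_sphere.
exists (X v @^-1` (~` @sphere R)); split => //.
  by rewrite -[X in measurable X]setTI; exact: mX.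
by rewrite lawX// uniform_sphere_off.
Qed.

Lemma ae_spherical_position : {ae P, forall t, spherical_position (X ^~ t)}.
Proof.
have imp (b : bool) (Q : T -> Prop) : (b -> {ae P, forall t, Q t}) -> {ae P, forall t, b -> Q t}.
  by case: b => [/(_ isT)|_]; [apply: filterS|exact: aeW].
have H1 : {ae P, forall t, forall v, sphere (X v t)}.
  by apply: filter_forall; exact: ae_sphere.
have H2 : {ae P, forall t, forall p : V * V, p.1 != p.2 -> det3 (X p.1 t) pole (X p.2 t) != 0}.
  by apply: filter_forall => p; apply: imp; exact: ae_det3_pole.
have H3 : {ae P, forall t, forall p : V * V * V, uniq [:: p.1.1; p.1.2; p.2] ->
    det3 (X p.1.1 t) (X p.1.2 t) (X p.2 t) != 0}.
  by apply: filter_forall => p; apply: imp; exact: ae_det3.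
have H4 : {ae P, forall t, forall p : (V * V * V) * (V * V * V),
    uniq [:: p.1.1.1; p.1.1.2; p.1.2; p.2.1.1; p.2.1.2; p.2.2] ->
    det3 (cross3 (cross3 (X p.1.1.1 t) (X p.1.1.2 t)) (cross3 (X p.1.2 t) (X p.2.1.1 t)))
      (X p.2.1.2 t) (X p.2.2 t) != 0}.
  by apply: filter_forall => p; apply: imp; exact: ae_six.
apply: filterS2 (filterI H1 H2) (filterI H3 H4) => t [h1 h2] [h3 h4]; split => //.
- by move=> u v; exact: (h2 (u, v)).
- by move=> u v w; exact: (h3 (u, v, w)).
- by move=> a b c e g h; exact: (h4 (a, b, c, (e, g, h))).
Qed.

End GeneralPosition.

(** * Geodesic drawings *)

Section GeodesicDrawing.
Variable R : realType.
Local Notation space := (R * R * R)%type.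
Implicit Types (a b c x y : space) (s t : R).

Lemma det3_cyc a b c : det3 a b c = det3 b c a.
Proof. by rewrite /det3 /dot3 /cross3 /=; ring. Qed.

Lemma det3_swap a b c : det3 a b c = - det3 b a c.
Proof. by rewrite /det3 /dot3 /cross3 /=; ring. Qed.

Lemma det3_comb a b s c t x : det3 a b (s *: c + t *: x) = s * det3 a b c + t * det3 a b x.
Proof. by rewrite /det3 /dot3 /cross3 /= /GRing.scale /=; ring. Qed.

Lemma det3_diagl a b : det3 a b a = 0.
Proof. by rewrite /det3 /dot3 /cross3 /=; ring. Qed.

Lemma det3_diagr a b : det3 a b b = 0.
Proof. by rewrite /det3 /dot3 /cross3 /=; ring. Qed.

Lemma space_eq x y : x.1.1 = y.1.1 -> x.1.2 = y.1.2 -> x.2 = y.2 -> x = y.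
Proof. by case: x y => -[? ?] ? [[? ?] ?] /= -> -> ->. Qed.

(** The linear relation between four vectors of space (Cramer), grouped so that both sides express
    one vector in the intersection of the planes of a, b and of c, x. *)
Lemma det3_relation a b c x :
  det3 b c x *: a + (- det3 a c x) *: b = - (det3 a b x *: c + (- det3 a b c) *: x).
Proof.
by apply: space_eq; rewrite /det3 /dot3 /cross3 /= /GRing.scale /=; ring.
Qed.

Lemma det3_coplanar a b c x : x != 0 -> dot3 a x = 0 -> dot3 b x = 0 -> dot3 c x = 0 ->
  det3 a b c = 0.
Proof.
move=> x0 ax bx cx.
have E (k : space -> R) : (forall y, k y = y.1.1) \/ (forall y, k y = y.1.2) \/ (forall y, k y = y.2) ->
    det3 a b c * k x = 0.
  move=> H; transitivity (dot3 a x * k (cross3 b c) + dot3 b x * k (cross3 c a) + dot3 c x * k (cross3 a b)).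
    by case: H => [|[]] H; rewrite !H /det3 /dot3 /cross3 /=; ring.
  by rewrite ax bx cx; ring.
apply/eqP; apply: contraNT x0 => D0.
have z r : det3 a b c * r = 0 -> r = 0 by move=> /eqP; rewrite mulf_eq0 (negbTE D0) => /eqP.
by apply/eqP/space_eq; apply: z; [apply: (E (fun y => y.1.1))|apply: (E (fun y => y.1.2))|
  apply: (E (fun y => y.2))]; auto.
Qed.

Lemma sphereE x : sphere x <-> dot3 x x = 1.
Proof.
rewrite /sphere /= enormE; split => [E|->]; last exact: sqrtr1.
by rewrite -[LHS]sqr_sqrtr ?dot3_ge0// E expr1n.
Qed.

Lemma sphere_scale x s : sphere x -> 0 <= s -> sphere (s *: x) -> s = 1.
Proof.
move=> /sphereE x1 s0 /sphereE.
have -> : dot3 (s *: x) (s *: x) = s ^+ 2 * dot3 x x.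
  by rewrite /dot3 /= /GRing.scale /=; ring.
rewrite x1 mulr1 => /eqP; rewrite sqrf_eq1 => /orP[/eqP //|/eqP s1].
by move: s0; rewrite s1 lerNr oppr0 ler10.
Qed.

Lemma sphere_neq0 x : sphere x -> x != 0.
Proof.
by move=> /sphereE E; apply/eqP => x0; move: E; rewrite x0 /dot3 /= !mul0r !addr0 => /eqP; rewrite eq_sym oner_eq0.
Qed.

Lemma sphere_pole x : sphere x -> x.2 = 1 -> x = pole R.
Proof.
move=> /sphereE; case: x => -[x1 x2] x3; rewrite /dot3 /= => + x31.
rewrite x31 mulr1 => /eqP; rewrite -subr_eq0 addrK -!expr2 paddr_eq0 ?sqr_ge0//.
by rewrite !sqrf_eq0 => /andP[/eqP -> /eqP ->].
Qed.

Lemma stereographic_inj x y : sphere x -> sphere y -> x != pole R -> y != pole R ->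
  stereographic x = stereographic y -> x = y.
Proof.
move=> Sx Sy xp yp.
have x2 : 1 - x.2 != 0.
  by apply: contraNneq xp => /eqP; rewrite subr_eq0 eq_sym => /eqP /(sphere_pole Sx) ->.
have y2 : 1 - y.2 != 0.
  by apply: contraNneq yp => /eqP; rewrite subr_eq0 eq_sym => /eqP /(sphere_pole Sy) ->.
move: Sx Sy => /sphereE Sx /sphereE Sy.
case: x y x2 y2 Sx Sy {xp yp} => -[x1 x2] x3 [[y1 y2] y3] /= nx ny.
rewrite /dot3 /stereographic /= => Sx Sy [E1 E2].
have e1 : x1 * (1 - y3) = y1 * (1 - x3).
  by rewrite -[x1](divfK nx) E1 mulrAC divfK.
have e2 : x2 * (1 - y3) = y2 * (1 - x3).
  by rewrite -[x2](divfK nx) E2 mulrAC divfK.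
(* The sphere equations turn the sum of the squares of [e1] and [e2] into (1 - x3^2) (1 - y3)^2 = (1
   - y3^2) (1 - x3)^2, whose two sides differ by twice this product. *)
have e3 : (1 - x3) * (1 - y3) * (x3 - y3) = 0.
  have : (x1 * (1 - y3)) ^+ 2 + (x2 * (1 - y3)) ^+ 2 = (y1 * (1 - x3)) ^+ 2 + (y2 * (1 - x3)) ^+ 2.
    by rewrite e1 e2.
  have -> : (x1 * (1 - y3)) ^+ 2 + (x2 * (1 - y3)) ^+ 2 = (x1 * x1 + x2 * x2 + x3 * x3 - x3 ^+ 2) * (1 - y3) ^+ 2 by ring.
  have -> : (y1 * (1 - x3)) ^+ 2 + (y2 * (1 - x3)) ^+ 2 = (y1 * y1 + y2 * y2 + y3 * y3 - y3 ^+ 2) * (1 - x3) ^+ 2 by ring.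
  rewrite Sx Sy => E; apply: (mulfI (_ : 2 != 0 :> R)); first by rewrite pnatr_eq0.
  rewrite mulr0 -[RHS](subrr ((1 - x3 ^+ 2) * (1 - y3) ^+ 2)) [X in _ = _ - X]E.
  by ring.
have e4 : x3 = y3.
  by move/eqP: e3; rewrite !mulf_eq0 (negbTE nx) (negbTE ny) subr_eq0 => /eqP.
move: e1 e2; rewrite -e4 => /(mulIf nx) -> /(mulIf nx) ->.
by rewrite e4.
Qed.

Section Geodesics.
Variables (V : finType) (adj : rel V) (f : V -> space).
Hypotheses (adj_irr : irreflexive adj) (Hf : spherical_position f).
Implicit Types (u v w z : V).
Local Notation D := (geodesic_drawing f).

Lemma position_sphere v : sphere (f v).
Proof. by case: Hf. Qed.

Lemma position_pole u v : u != v -> f u != pole R.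
Proof.
case: Hf => _ /(_ v u); rewrite eq_sym => H _ _ uv; apply: contraNneq (H uv) => ->.
by rewrite det3_diagr.
Qed.

Lemma position_det u v w : uniq [:: u; v; w] -> det3 (f u) (f v) (f w) != 0.
Proof. by case: Hf => _ _ H _; exact: H. Qed.

Lemma geodesicC a b : geodesic a b = geodesic b a.
Proof.
by apply/seteqP; split => x [Sx [s [t [s0 t0 xE]]]]; (split; first by []); exists t, s;
  split => //; rewrite xE addrC.
Qed.

Lemma geodesic_det3 a b x : geodesic a b x -> det3 a b x = 0.
Proof. by move=> [_ [s [t [_ _ ->]]]]; rewrite det3_comb det3_diagl det3_diagr !mulr0 addr0. Qed.

Lemma geodesic_pole u v x : u != v -> geodesic (f u) (f v) x -> x != pole R.
Proof.
move=> uv /geodesic_det3 E; have [_ Hp _ _] := Hf.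
by apply: contraNneq (Hp _ _ uv) => <-; rewrite det3_cyc det3_cyc det3_swap E oppr0.
Qed.

Lemma stereographic_geodesic u v w z x y : u != v -> w != z ->
  geodesic (f u) (f v) x -> geodesic (f w) (f z) y -> stereographic x = stereographic y -> x = y.
Proof.
move=> uv wz gx gy; apply: stereographic_inj; first by case: gx.
- by case: gy.
- exact: geodesic_pole gx.
- exact: geodesic_pole gy.
Qed.

Lemma adjacent_geodesics u v w x : uniq [:: u; v; w] ->
  geodesic (f u) (f v) x -> geodesic (f u) (f w) x -> x = f u.
Proof.
move=> un gx [Sx [s [t [s0 t0 xE]]]].
have := geodesic_det3 gx; rewrite {1}xE det3_comb det3_diagl mulr0 add0r => /eqP.
rewrite mulf_eq0 (negbTE (position_det un)) orbF => /eqP t00.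
move: xE; rewrite t00 scale0r addr0 => xE.
by rewrite xE (sphere_scale (position_sphere u) s0) ?scale1r// -xE.
Qed.

Lemma edge_point u v p : u != v -> nonvertex D p -> dedge D u v p ->
  exists x, [/\ geodesic (f u) (f v) x, stereographic x = p & forall w, x != f w].
Proof.
move=> uv np [x gx xp]; exists x; split => // w; apply/eqP => xw.
by apply: (np w); rewrite /= -xw.
Qed.

Lemma edges_point u v w z p : u != v -> w != z -> nonvertex D p -> dedge D u v p -> dedge D w z p ->
  exists x, [/\ geodesic (f u) (f v) x, geodesic (f w) (f z) x, stereographic x = p &
    forall k, x != f k].
Proof.
move=> uv wz np uvp [y gy yp]; have [x [gx xp xn]] := edge_point uv np uvp.
exists x; split => //; rewrite (stereographic_geodesic uv wz gx gy) //.
by rewrite xp.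
Qed.

Lemma geodesics_uniq u v w z x : u != v -> w != z -> [set u; v]%SET != [set w; z]%SET ->
  geodesic (f u) (f v) x -> geodesic (f w) (f z) x -> (forall k, x != f k) -> uniq [:: u; v; w; z].
Proof.
have adj_case (a b c e : V) : a != b -> c != e -> [set a; b]%SET != [set c; e]%SET ->
    geodesic (f a) (f b) x -> geodesic (f c) (f e) x -> (forall k, x != f k) -> a != c.
  move=> ab ce n g1 g2 xn; apply/eqP => ac; subst c.
  have be : b != e by apply: contraNneq n => ->.
  have un : uniq [:: a; b; e] by rewrite /= !inE negb_or ab ce be.
  by have := xn a; rewrite (adjacent_geodesics un g1 g2) eqxx.
move=> uv wz n g1 g2 xn; rewrite /= !inE !negb_or uv wz /= andbT.
have g1' := g1; rewrite geodesicC in g1'; have g2' := g2; rewrite geodesicC in g2'.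
have vu : v != u by rewrite eq_sym.
have zw : z != w by rewrite eq_sym.
have n1 : [set v; u]%SET != [set w; z]%SET by rewrite finset.setUC.
have n2 : [set u; v]%SET != [set z; w]%SET by rewrite [X in _ != X]finset.setUC.
have n3 : [set v; u]%SET != [set z; w]%SET by rewrite finset.setUC.
rewrite (adj_case _ _ _ _ uv wz n)// (adj_case _ _ _ _ uv zw n2)//.
by rewrite (adj_case _ _ _ _ vu wz n1)// (adj_case _ _ _ _ vu zw n3).
Qed.

Lemma uniq4 u v w z : uniq [:: u; v; w; z] ->
  [/\ uniq [:: u; v; w], uniq [:: u; v; z], uniq [:: u; w; z] & uniq [:: v; w; z]].
Proof.
rewrite /= !inE !negb_or !andbT.
by move=> /and3P[/and3P[-> -> ->] /andP[-> ->] ->].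
Qed.

(** Two distinct planes through the origin share a line, which meets the sphere in two antipodal
    points; nonnegativity of the cone coefficients excludes the antipode. *)
Lemma disjoint_geodesics_meet u v w z x y : uniq [:: u; v; w; z] ->
  geodesic (f u) (f v) x -> geodesic (f w) (f z) x ->
  geodesic (f u) (f v) y -> geodesic (f w) (f z) y -> x = y.
Proof.
move=> un [Sx [s [t [s0 t0 xE]]]] /geodesic_det3 Dx [Sy [s' [t' [s0' t0' yE]]]] /geodesic_det3 Dy.
have A0 : det3 (f w) (f z) (f u) != 0.
  by rewrite det3_cyc det3_cyc; apply: position_det; case: (uniq4 un).
have B0 : det3 (f w) (f z) (f v) != 0.
  by rewrite det3_cyc det3_cyc; apply: position_det; case: (uniq4 un).
move: Dx Dy; rewrite {1}xE {1}yE !det3_comb => Dx Dy.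
have K : t' * s = t * s'.
  apply/eqP; rewrite -subr_eq0 -(mulrI_eq0 _ (mulfI A0)); apply/eqP.
  transitivity (t' * (s * det3 (f w) (f z) (f u) + t * det3 (f w) (f z) (f v)) -
    t * (s' * det3 (f w) (f z) (f u) + t' * det3 (f w) (f z) (f v))); first by ring.
  by rewrite Dx Dy; ring.
have E : t' *: x = t *: y.
  by rewrite xE yE !scalerDr !scalerA K; congr (_ + _ *: _); rewrite mulrC.
have pos r q p : r * det3 (f w) (f z) (f u) + q * det3 (f w) (f z) (f v) = 0 -> 0 <= q ->
    p = r *: f u + q *: f v -> sphere p -> 0 < q.
  move=> D0 q0 pE Sp; rewrite lt_neqAle q0 andbT; apply/eqP => q00.
  move: D0 (sphere_neq0 Sp); rewrite pE -q00 mul0r addr0 => /eqP.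
  by rewrite mulf_eq0 (negbTE A0) orbF => /eqP ->; rewrite !scale0r addr0 eqxx.
have t_gt0 := pos _ _ _ Dx t0 xE Sx; have t'_gt0 := pos _ _ _ Dy t0' yE Sy.
have xy : x = (t'^-1 * t) *: y by rewrite -scalerA -E scalerA mulVf ?scale1r// gt_eqF.
have c0 : 0 <= t'^-1 * t by rewrite mulr_ge0// invr_ge0.
have c1 : t'^-1 * t = 1 by apply: (sphere_scale Sy c0); rewrite -xy.
by rewrite xy c1 scale1r.
Qed.

(** Everything reduces to determinants on the sphere. If three edges met at x, their three normals
    would be orthogonal to x, hence dependent, against the six-vertex condition. *)
Lemma geodesic_drawing_simple : simple_drawing adj D.
Proof.
have ne u v : adj u v -> u != v by apply: contraTneq => ->; rewrite adj_irr.
have two u v w z p : distinct_edges adj u v w z -> nonvertex D p -> dedge D u v p -> dedge D w z p ->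
    exists x, [/\ geodesic (f u) (f v) x, geodesic (f w) (f z) x, stereographic x = p &
      uniq [:: u; v; w; z]].
  move=> [/ne uv /ne wz n] np h1 h2; have [x [g1 g2 xp xn]] := edges_point uv wz np h1 h2.
  by exists x; split => //; exact: geodesics_uniq g1 g2 xn.
split.
- by move=> u v _; rewrite /= geodesicC.
- move=> u v w p de np [h1 h2]; have [x [_ _ _]] := two _ _ _ _ _ de np h1 h2.
  by rewrite /= !inE eqxx orbT.
- move=> u v w z p q de np nq h1 h2 h3 h4.
  have [x [g1 g2 <- un]] := two _ _ _ _ _ de np h1 h2.
  have [y [g3 g4 <- _]] := two _ _ _ _ _ de nq h3 h4.
  by rewrite (disjoint_geodesics_meet un g1 g2 g3 g4).
- move=> p u v u' v' u'' v'' np d1 d2 d3 [h1 h2 h3].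
  have [x [g1 g2 xp un1]] := two _ _ _ _ _ d1 np h1 h2.
  have [y [g3 g4 yp un2]] := two _ _ _ _ _ d2 np h1 h3.
  have [_ [_ _ _ un3]] := two _ _ _ _ _ d3 np h2 h3.
  have [[/ne uv _ _] [_ /ne u''v'' _]] := (d1, d2).
  have xy : x = y by apply: (stereographic_geodesic uv uv g1 g3); rewrite xp.
  have un6 : uniq [:: u; v; u'; v'; u''; v''].
    move: un1 un2 un3; rewrite /= !inE !negb_or.
    move=> /and3P[/and3P[-> -> ->] /andP[-> ->] /andP[-> _]].
    move=> /and3P[/and3P[_ -> ->] /andP[-> ->] /andP[-> _]].
    by move=> /and3P[/and3P[_ -> ->] /andP[-> ->] _].
  have [_ _ _ /(_ _ _ _ _ _ _ un6)/eqP] := Hf; apply.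
  rewrite -xy in g4; move: g1 g2 g4 => /[dup] -[Sx _] /geodesic_det3 D1 /geodesic_det3 D2 /geodesic_det3 D3.
  transitivity (det3 (cross3 (f u) (f v)) (cross3 (f u') (f v')) (cross3 (f u'') (f v''))).
    by rewrite /det3 /dot3 /cross3 /=; ring.
  by apply: (det3_coplanar (sphere_neq0 Sx)).
Qed.

(** Equivalently, the coefficients of a, b, c, x in [det3_relation], arranged as a combination of a
    and b equal to one of c and x, all have the same sign, so a vector or its opposite lies in both
    cones. *)
Definition cross_sign a b c x : Prop :=
  [/\ det3 b c x * det3 a c x < 0, det3 a b x * det3 a b c < 0 &
      det3 b c x * det3 a b x < 0].

Lemma opposite_sign (s t a b : R) : 0 < s -> 0 <= t -> a != 0 -> s * b + t * a = 0 -> b != 0 -> a * b < 0.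
Proof.
move=> s0 t0 a0 E b0; rewrite -(pmulr_rlt0 _ s0).
have t_gt0 : 0 < t.
  rewrite lt_neqAle t0 andbT; apply: contra_eqT E => /negPn/eqP <-.
  by rewrite mul0r addr0 mulf_neq0// gt_eqF.
have -> : s * (a * b) = - (t * a ^+ 2) + a * (s * b + t * a) by ring.
by rewrite E mulr0 addr0 oppr_lt0 mulr_gt0// exprn_even_gt0.
Qed.

Lemma geodesics_meet a b c x (s t s' t' : R) : 0 <= s -> 0 <= t -> 0 <= s' -> 0 <= t' ->
  s *: a + t *: b = s' *: c + t' *: x -> s *: a + t *: b != 0 ->
  exists y, geodesic a b y /\ geodesic c x y.
Proof.
move=> s0 t0 s0' t0' E; set y := s *: a + t *: b in E *; move=> y0.
have n0 : enorm y != 0.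
  by rewrite enormE sqrtr_eq0 -ltNge lt_neqAle dot3_ge0 andbT eq_sym; apply: contraNneq y0 => /dot3_eq0 ->.
have n1 : 0 <= (enorm y)^-1 by rewrite invr_ge0 enormE sqrtr_ge0.
have Sy : sphere ((enorm y)^-1 *: y).
  apply/sphereE.
  have -> : dot3 ((enorm y)^-1 *: y) ((enorm y)^-1 *: y) = (enorm y)^-1 ^+ 2 * dot3 y y.
    by rewrite /dot3 /= /GRing.scale /=; ring.
  by rewrite -[dot3 y y]sqr_sqrtr ?dot3_ge0// -enormE -exprMn mulVf// expr1n.
exists ((enorm y)^-1 *: y); split; split => //.
  by exists ((enorm y)^-1 * s), ((enorm y)^-1 * t); rewrite !mulr_ge0// -!scalerA -scalerDr.
by exists ((enorm y)^-1 * s'), ((enorm y)^-1 * t'); rewrite !mulr_ge0// -!scalerA -scalerDr -E.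
Qed.

Lemma cross_sign_meet u v w z : uniq [:: u; v; w; z] ->
  (exists x, geodesic (f u) (f v) x /\ geodesic (f w) (f z) x) <-> cross_sign (f u) (f v) (f w) (f z).
Proof.
move=> un; have [u1 u2 u3 u4] := uniq4 un.
have := position_det u1; have := position_det u2; have := position_det u3; have := position_det u4.
have rel := det3_relation (f u) (f v) (f w) (f z).
rewrite /cross_sign; move: rel.
move al_eq: (det3 (f v) (f w) (f z)) => al; move be_eq: (det3 (f u) (f w) (f z)) => be.
move ga_eq: (det3 (f u) (f v) (f z)) => ga; move de_eq: (det3 (f u) (f v) (f w)) => de.
move=> rel al0 be0 ga0 de0; split.
  move=> [x [[Sx [s [t [s0 t0 xE]]]] [_ [s' [t' [s0' t0' xE']]]]]].
  have x0 := sphere_neq0 Sx.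
  (* The three equations test both expressions of [x] against a determinant with two fixed vectors,
     (w, z), (u, v) and (v, z), which kills the terms along these vectors. *)
  have e1 : s * be + t * al = 0.
    have := det3_comb (f w) (f z) s (f u) t (f v); rewrite -xE xE' det3_comb det3_diagl det3_diagr.
    by rewrite !mulr0 addr0 -be_eq -al_eq [det3 (f u) _ _]det3_cyc [det3 (f v) _ _]det3_cyc.
  have e2 : s' * de + t' * ga = 0.
    have := det3_comb (f u) (f v) s' (f w) t' (f z); rewrite -xE' xE det3_comb det3_diagl det3_diagr.
    by rewrite !mulr0 addr0 ga_eq de_eq.
  have e3 : s * ga + s' * al = 0.
    have := det3_comb (f v) (f z) s (f u) t (f v); rewrite -xE xE' det3_comb !det3_diagl det3_diagr.
    rewrite !mulr0 !addr0 -[det3 (f v) (f z) (f u)]det3_cyc ga_eq => <-.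
    have -> : det3 (f v) (f z) (f w) = - al by rewrite -al_eq det3_cyc det3_swap -det3_cyc.
    by ring.
  have s_gt0 : 0 < s.
    rewrite lt_neqAle s0 andbT; apply: contraNneq x0 => s00; move: e1; rewrite xE -s00.
    by rewrite mul0r add0r => /eqP; rewrite mulf_eq0 (negbTE al0) orbF => /eqP ->; rewrite !scale0r addr0.
  have s'_gt0 : 0 < s'.
    rewrite lt_neqAle s0' andbT; apply: contraNneq x0 => s00; move: e2; rewrite xE' -s00.
    by rewrite mul0r add0r => /eqP; rewrite mulf_eq0 (negbTE ga0) orbF => /eqP ->; rewrite !scale0r addr0.
  by split; [apply: opposite_sign e1 _|apply: opposite_sign e2 _|apply: opposite_sign e3 _]; rewrite // ltW.
have nonzero (s t : R) : s != 0 -> s *: f u + t *: f v != 0.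
  move=> s0; apply/eqP => E0; have := det3_comb (f v) (f z) s (f u) t (f v).
  rewrite E0 det3_diagl mulr0 addr0 -[det3 (f v) (f z) (f u)]det3_cyc ga_eq.
  have -> : det3 (f v) (f z) 0 = 0 by rewrite /det3 /dot3 /= !mulr0 !addr0.
  by move=> /esym/eqP; rewrite mulf_eq0 (negbTE s0) (negbTE ga0).
move=> [ab cd ac]; have [al_gt|al_lt|al_0] := ltgtP 0 al.
- move: ab ac; rewrite !(pmulr_rlt0 _ al_gt) => be_lt ga_lt; move: cd; rewrite (nmulr_rlt0 _ ga_lt) => de_gt.
  apply: (@geodesics_meet _ _ _ _ al (- be) (- ga) de); rewrite ?oppr_ge0 ?ltW ?nonzero//.
  by rewrite rel opprD !scaleNr opprK.
- move: ab ac; rewrite !(nmulr_rlt0 _ al_lt) => be_gt ga_gt; move: cd; rewrite (pmulr_rlt0 _ ga_gt) => de_lt.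
  apply: (@geodesics_meet _ _ _ _ (- al) be ga (- de)); rewrite ?oppr_ge0 ?ltW ?nonzero ?oppr_eq0//.
  by apply: oppr_inj; rewrite -rel opprD !scaleNr opprK.
- by move: al0; rewrite -al_0 eqxx.
Qed.

Lemma crosses_geodesic u v w z : adj u v -> adj w z -> uniq [:: u; v; w; z] ->
  crosses adj D u v w z <-> cross_sign (f u) (f v) (f w) (f z).
Proof.
move=> uv wz un; rewrite -cross_sign_meet//.
have [u1 u2 u3 u4] := uniq4 un.
have [uvn wzn] : u != v /\ w != z.
  by move: un; rewrite /= !inE !negb_or => /and3P[/andP[->]] _ _ /andP[->].
split=> [[_ _ _ [p [np h1 h2]]]|[x [g1 g2]]].
  by have [x [g1 g2 _ _]] := edges_point uvn wzn np h1 h2; exists x.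
split => //; exists (stereographic x); split; [|by exists x|by exists x].
move=> k kx; have xn : f k = x.
  apply: stereographic_inj kx; [exact: position_sphere|by case: g1| |exact: geodesic_pole g1].
  by have [->|] := eqVneq k u; [exact: position_pole uvn|exact: position_pole].
have D1 := geodesic_det3 g1; have D2 := geodesic_det3 g2; rewrite -xn in D1 D2.
have [ku|ku] := eqVneq k u.
  by move: (position_det u3); rewrite -ku det3_cyc D2 eqxx.
have [kv|kv] := eqVneq k v.
  by move: (position_det u4); rewrite -kv det3_cyc D2 eqxx.
have un' : uniq [:: u; v; k] by rewrite /= !inE negb_or uvn eq_sym ku eq_sym kv.
by move: (position_det un'); rewrite D1 eqxx.
Qed.

End Geodesics.
End GeodesicDrawing.

(** * The expected number of crossings *)

Section CrossProbability.
Variables (R : realType) (V : finType).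
Local Notation space := (R * R * R)%type.
Local Notation placements := (g_sigma_algebraType (@cylinders R V)).

Definition flip (B : pred V) (f : V -> space) : V -> space :=
  fun v => if B v then - f v else f v.

Context d (T : measurableType d) (P : probability T R) (X : V -> T -> space).
Hypothesis UX : uniform_independent P X.

Let mX v : measurable_fun setT (X v). Proof. by case: UX. Qed.
Let uX := uniform_independent_family UX.

Lemma uniform_flip (B : pred V) : uniform_family (fun v t => flip B (X ^~ t) v) P.
Proof.
move=> A mA; pose A' v := if B v then (fun x => - x) @^-1` A v else A v.
have mA' v : measurable (A' v).
  rewrite /A'; case: (B v) => //.
  by rewrite -[X in measurable X]setTI; exact: measurable_opp3.
have -> : \bigcap_(v in [set: V]) ((fun t => flip B (X ^~ t) v) @^-1` A v) =
    \bigcap_(v in [set: V]) (X v @^-1` A' v).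
  by apply: eq_bigcap => // v _; rewrite /flip /A' /preimage; case: (B v).
rewrite (uX mA'); apply: eq_bigr => v _; rewrite /A'; case: (B v); last by [].
exact: (uniform_sphereN (mA v)).
Qed.

Lemma probability_flip (B : pred V) (C : set placements) : measurable C ->
  P [set t | C (flip B (X ^~ t))] = P [set t | C (X ^~ t)].
Proof.
move=> mC.
have mF v : measurable_fun setT (fun t => flip B (X ^~ t) v).
  rewrite /flip; case: (B v) => //.
  have h := measurableT_comp (@measurable_opp3 R) (mX v); exact: h.
have PT : (P setT < +oo)%E by rewrite (@probability_setT _ _ _ P) ltry.
have h := law_unique mF mX (uniform_flip B) uX PT mC; exact: h.
Qed.

(** The reflection preserves [C] and the law and exchanges the events g < 0 and g > 0, while g = 0
    is null; so the two events have equal mass. *)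
Lemma probability_half (B : pred V) (C : set placements) (g : placements -> R) :
  measurable C -> measurable_fun setT g ->
  (forall f, C (flip B f) <-> C f) -> (forall f, g (flip B f) = - g f) ->
  {ae P, forall t, g (X ^~ t) != 0} ->
  P [set t | C (X ^~ t) /\ g (X ^~ t) < 0] = ((2^-1)%:E * P [set t | C (X ^~ t)])%E.
Proof.
move=> mC mg Cflip gflip g0.
have mp := measurable_placement mX.
have pre (E : set placements) : measurable E -> measurable [set t | E (X ^~ t)].
  by move=> mE; rewrite -[X in measurable X]setTI; exact: mp.
have mlt : measurable [set f | C f /\ g f < 0].
  apply: measurableI => //; rewrite -[X in measurable X]setTI.
  by have := mg measurableT `]-oo, 0[%classic (measurable_itv _); rewrite preimage_itvNyo.
have mgt : measurable [set f | C f /\ 0 < g f].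
  apply: measurableI => //; rewrite -[X in measurable X]setTI.
  by have := mg measurableT `]0, +oo[%classic (measurable_itv _); rewrite preimage_itvoy.
have meq : measurable [set f | C f /\ g f = 0].
  apply: measurableI => //; rewrite -[X in measurable X]setTI.
  exact: mg measurableT [set 0] _.
have [plt pgt peq] := And3 (pre _ mlt) (pre _ mgt) (pre _ meq).
have E1 : P [set t | C (X ^~ t) /\ 0 < g (X ^~ t)] = P [set t | C (X ^~ t) /\ g (X ^~ t) < 0].
  rewrite -(probability_flip B mgt); congr (P _); apply/seteqP.
  by split=> t /=; rewrite gflip oppr_gt0 => -[/Cflip].
have E0 : P [set t | C (X ^~ t) /\ g (X ^~ t) = 0] = 0%E.
  apply/negligibleP => //; apply: negligibleS g0 => t /= [_ ->].
  by rewrite eqxx.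
have -> : [set t | C (X ^~ t)] = ([set t | C (X ^~ t) /\ g (X ^~ t) < 0] `|`
    [set t | C (X ^~ t) /\ 0 < g (X ^~ t)]) `|` [set t | C (X ^~ t) /\ g (X ^~ t) = 0].
  apply/seteqP; split => [t /= Ct|t /= [[[]|[]]|[]]] //.
  by case: (ltgtP (g (X ^~ t)) 0) => ?; [left; left|left; right|right].
have PU A E : measurable A -> measurable E -> A `&` E = set0 -> P (A `|` E) = (P A + P E)%E.
  by move=> mA mE AE; exact: measureU.
rewrite PU//; last 2 first.
- exact: measurableU.
- apply/seteqP; split => // t /= [[[_ h]|[_ h]] [_ h0]]; by rewrite h0 ltxx in h.
rewrite PU//; last first.
  by apply/seteqP; split => // t /= [[_ h] [_ /(lt_trans h)]]; rewrite ltxx.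
rewrite E0 E1 adde0; set p := P _.
have pfin : p \is a fin_num by exact: fin_num_measure.
by rewrite -(fineK pfin) -EFinD -EFinM; congr (_%:E); field.
Qed.

Lemma probability_cross_sign u v w z : uniq [:: u; v; w; z] ->
  P [set t | cross_sign (X u t) (X v t) (X w t) (X z t)] = (8^-1)%:E.
Proof.
move=> un; have [u1 u2 u3 u4] := uniq4 un.
have mdet (a b c : V) : measurable_fun setT (fun f : placements => det3 (f a) (f b) (f c)).
  apply: measurable_dot3; last exact: measurable_coord.
  by apply: measurable_cross3; exact: measurable_coord.
pose ab (f : placements) := det3 (f v) (f w) (f z) * det3 (f u) (f w) (f z).
pose cd (f : placements) := det3 (f u) (f v) (f z) * det3 (f u) (f v) (f w).
pose ac (f : placements) := det3 (f v) (f w) (f z) * det3 (f u) (f v) (f z).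
have mab : measurable_fun setT ab by apply: measurable_funM; exact: mdet.
have mcd : measurable_fun setT cd by apply: measurable_funM; exact: mdet.
have mac : measurable_fun setT ac by apply: measurable_funM; exact: mdet.
have m1 : measurable [set f | ab f < 0].
  have := mab measurableT `]-oo, 0[%classic (measurable_itv _).
  by rewrite setTI preimage_itvNyo.
have m2 : measurable [set f | ab f < 0 /\ cd f < 0].
  apply: measurableI => //; have := mcd measurableT `]-oo, 0[%classic (measurable_itv _).
  by rewrite setTI preimage_itvNyo.
have nz (a b c a' b' c' : V) : uniq [:: a; b; c] -> uniq [:: a'; b'; c'] ->
    {ae P, forall t, det3 (X a t) (X b t) (X c t) * det3 (X a' t) (X b' t) (X c' t) != 0}.
  by move=> h h'; apply: filterS2 (ae_det3 UX h) (ae_det3 UX h') => t; exact: mulf_neq0.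
have [[uv uw uz] [vw vz wz]] : [/\ u != v, u != w & u != z] /\ [/\ v != w, v != z & w != z].
  by move: un; rewrite /= !inE !negb_or => /and3P[/and3P[-> -> ->] /andP[-> ->] /andP[-> _]].
have det3N a b c : ((det3 (- a) b c = - det3 a b c) * (det3 a (- b) c = - det3 a b c) *
    (det3 a b (- c) = - det3 a b c))%type.
  by do !split; rewrite /det3 /dot3 /cross3 /=; ring.
(* A vertex occurring in both determinants of a product contributes its sign twice, so only the two
   vertices not shared by the determinants matter. *)
have flip1 (B : pred V) : (forall f, ab (flip B f) = (-1) ^+ (B u (+) B v) * ab f) /\
    (forall f, cd (flip B f) = (-1) ^+ (B w (+) B z) * cd f) /\
    (forall f, ac (flip B f) = (-1) ^+ (B u (+) B w) * ac f).
  by split; [|split] => f; rewrite /ab /cd /ac /flip; case: (B u); case: (B v); case: (B w); case: (B z);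
    rewrite /= ?det3N; ring.
have abv f : ab (flip (pred1 v) f) = - ab f.
  by rewrite (flip1 _).1 /= eqxx (negbTE uv) expr1 mulN1r.
have cdz : (forall f, ab (flip (pred1 z) f) = ab f) /\ (forall f, cd (flip (pred1 z) f) = - cd f).
  split=> f; first by rewrite (flip1 _).1 /= (negbTE uz) (negbTE vz) mul1r.
  by rewrite (flip1 _).2.1 /= eqxx (negbTE wz) expr1 mulN1r.
have acwz : [/\ forall f, ab (flip (pred2 w z) f) = ab f, forall f, cd (flip (pred2 w z) f) = cd f &
    forall f, ac (flip (pred2 w z) f) = - ac f].
  split=> f; first by rewrite (flip1 _).1 /= (negbTE uz) (negbTE vz) (negbTE uw) (negbTE vw) mul1r.
    by rewrite (flip1 _).2.1 /= !eqxx orbT mul1r.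
  by rewrite (flip1 _).2.2 /= eqxx (negbTE uw) (negbTE uz) expr1 mulN1r.
have p1 := @probability_half (pred1 v) setT ab measurableT mab (fun f => iff_refl _) abv (nz _ _ _ _ _ _ u4 u3).
have p2 := @probability_half (pred1 z) _ cd m1 mcd _ cdz.2 (nz _ _ _ _ _ _ u2 u1).
have p3 := @probability_half (pred2 w z) _ ac m2 mac _ _ (nz _ _ _ _ _ _ u4 u2).
have -> : [set t | cross_sign (X u t) (X v t) (X w t) (X z t)] =
    [set t | (ab (X ^~ t) < 0 /\ cd (X ^~ t) < 0) /\ ac (X ^~ t) < 0].
  by apply/seteqP; split => t /=; [move=> [h1 h2 h3]|move=> [[h1 h2] h3]].
case: acwz => abwz cdwz acN.
rewrite [LHS]p3 => [|f|//]; last by rewrite /= abwz cdwz.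
rewrite p2 => [|f]; last by rewrite /= cdz.1.
have -> : [set t | ab (X ^~ t) < 0] = [set t | [set: placements] (X ^~ t) /\ ab (X ^~ t) < 0].
  by apply/seteqP; split => t //= -[].
rewrite p1.
have -> : P [set t | [set: placements] (X ^~ t)] = 1%E by rewrite -(@probability_setT _ _ _ P).
by rewrite mule1 -!EFinM; congr (_%:E); field.
Qed.

End CrossProbability.

Import HBNNSimple.

Section ExpectedCrossings.
Variables (R : realType).
Local Notation space := (R * R * R)%type.

(** [f] and [g] may be non-measurable, as is relevant for the crossing number. The integral is a
    supremum over simple functions below; multiplying one by the indicator of the complement of [N]
    keeps its integral and brings it below [g] everywhere. *)
Lemma ae_le_integral d (T : measurableType d) (m : {measure set T -> \bar R}) (f g : T -> \bar R) :
  (forall x, 0 <= f x)%E -> (forall x, 0 <= g x)%E -> {ae m, forall x, (f x <= g x)%E} ->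
  (\int[m]_x f x <= \int[m]_x g x)%E.
Proof.
move=> f0 g0 [N [mN N0 fgN]]; rewrite !ge0_integralTE//.
apply: ge_ereal_sup => _ [h /= hf <-].
have mN' : measurable (~` N) by exact: measurableC.
apply: ereal_sup_ubound; exists (proj_nnsfun h mN').
  move=> x; rewrite /proj_nnsfun /= mindicE; have [xN|xN] := boolP (x \in ~` N).
    rewrite mulr1; apply: le_trans (hf x) _.
    apply: contrapT => fg; move: xN; rewrite inE; apply; exact: fgN.
  by rewrite mulr0.
rewrite -!integralT_nnsfun; apply: ae_eq_integral => //.
- by apply/measurable_EFinP; exact: measurable_funPT.
- by apply/measurable_EFinP; exact: measurable_funPT.
exists N; split => // x /= hx; apply: contrapT => xN; apply: hx => _.
by rewrite /proj_nnsfun /= mindicE mem_set ?mulr1.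
Qed.

Lemma ae_eq_integral_ge0 d (T : measurableType d) (m : {measure set T -> \bar R}) (f g : T -> \bar R) :
  (forall x, 0 <= f x)%E -> (forall x, 0 <= g x)%E -> {ae m, forall x, f x = g x} ->
  (\int[m]_x f x = \int[m]_x g x)%E.
Proof.
move=> f0 g0 fg; apply/eqP; rewrite eq_le !ae_le_integral//.
  by apply: filterS fg => x ->.
by apply: filterS fg => x ->.
Qed.

Variables (V : finType) (adj : rel V).
Hypotheses (adj_sym : symmetric adj) (adj_irr : irreflexive adj).
Context d (T : measurableType d) (P : probability T R) (X : V -> T -> space).
Hypothesis UX : uniform_independent P X.

Definition edge_quads : {set V * V * V * V} :=
  [set q | [&& adj q.1.1.1 q.1.1.2, adj q.1.2 q.2 & uniq [:: q.1.1.1; q.1.1.2; q.1.2; q.2]]].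

Let crossing_event (q : V * V * V * V) : set T :=
  [set t | cross_sign (X q.1.1.1 t) (X q.1.1.2 t) (X q.1.2 t) (X q.2 t)].

Let measurable_crossing_event q : measurable (crossing_event q).
Proof.
have mX v : measurable_fun setT (X v) by case: UX.
have mdet a b c : measurable_fun setT (fun t => det3 (X a t) (X b t) (X c t)).
  by apply: measurable_dot3 => //; exact: measurable_cross3.
have mneg (g : T -> R) : measurable_fun setT g -> measurable [set t | g t < 0].
  move=> mg; have := mg measurableT `]-oo, 0[%classic (measurable_itv _).
  by rewrite setTI preimage_itvNyo.
have -> : crossing_event q = [set t | det3 (X q.1.1.2 t) (X q.1.2 t) (X q.2 t) * det3 (X q.1.1.1 t) (X q.1.2 t) (X q.2 t) < 0] `&`
   [set t | det3 (X q.1.1.1 t) (X q.1.1.2 t) (X q.2 t) * det3 (X q.1.1.1 t) (X q.1.1.2 t) (X q.1.2 t) < 0] `&`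
   [set t | det3 (X q.1.1.2 t) (X q.1.2 t) (X q.2 t) * det3 (X q.1.1.1 t) (X q.1.1.2 t) (X q.2 t) < 0].
  by apply/seteqP; split => t /=; [move=> [? ? ?]|move=> [[? ?] ?]].
by do !apply: measurableI; apply: mneg; apply: measurable_funM.
Qed.

Lemma cr_indicator t : spherical_position (X ^~ t) ->
  (cr adj (geodesic_drawing (X ^~ t)))%:R = \sum_(q in edge_quads) 8^-1 * \1_(crossing_event q) t :> R.
Proof.
move=> gt; have sD := geodesic_drawing_simple adj_irr gt.
rewrite -mulr_sumr; apply: (mulfI (_ : 8 != 0 :> R)); first by rewrite pnatr_eq0.
rewrite mulrA mulfV ?pnatr_eq0// mul1r -natrM -(card_crossing_quads adj_sym adj_irr sD).
rewrite -sum1_card natr_sum [LHS]big_mkcond [RHS]big_mkcond /=; apply: eq_bigr => -[[[u v] w] z] _.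
rewrite indicE !inE /=; case: ifPn => [/asboolP c|/asboolP nc].
  have [uv wz un _] := c; rewrite ifT; last by rewrite uv wz; exact: un.
  rewrite mem_set//.
  exact/(crosses_geodesic gt uv wz un).
case: ifP => // /and3P[uv wz un]; rewrite memNset// => c; apply: nc.
exact/(crosses_geodesic gt uv wz un).
Qed.

(** 64 is 8 orderings per crossing times the reciprocal 8 of the crossing probability. *)
Lemma expected_crossingsE :
  expected_crossings adj P X = (#|edge_quads|%:R / 64)%:E.
Proof.
rewrite /expected_crossings unlock.
transitivity (\int[P]_t (\sum_(q <- enum edge_quads) ((8^-1)%:E * (\1_(crossing_event q) t)%:E)))%E.
  apply: ae_eq_integral_ge0.
  - by move=> t; rewrite lee_fin.
  - by move=> t; apply: sume_ge0 => q _; rewrite mule_ge0// lee_fin ?invr_ge0.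
  - apply: filterS (ae_spherical_position UX) => t gt.
    by rewrite (cr_indicator gt) -sumEFin -big_enum /=; apply: eq_bigr => q _; rewrite EFinM.
rewrite ge0_integral_sum//; last first.
  by move=> q; apply: measurable_funeM; apply/measurable_EFinP; exact: measurable_indic.
rewrite (eq_big_seq (fun=> (64^-1)%:E)) => [|q]; last first.
  rewrite mem_enum inE => /and3P[_ _ un]; rewrite ge0_integralZl//; last first.
    by apply/measurable_EFinP; exact: measurable_indic.
  rewrite integral_indic// setIT.
  transitivity ((8^-1)%:E * (8^-1)%:E : \bar R)%E.
    by congr (_ * _)%E; exact: probability_cross_sign.
  by rewrite -EFinM; congr (_%:E); field.
by rewrite big_enum /= sumEFin sumr_const mulr_natl.
Qed.
End ExpectedCrossings.

(** * Asymptotics *)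

Section QuadCounting.
Local Open Scope nat_scope.

Lemma card_retract (S Q : finType) (P : pred Q) (g : S -> Q) (h : Q -> S) :
  (forall s, P (g s)) -> cancel g h -> (forall q, P q -> g (h q) = q) ->
  \sum_q (P q : nat) = #|S|.
Proof.
move=> Pg gK hK; transitivity #|[set g s | s : S]%SET|.
  rewrite -sum1_card [RHS]big_mkcond /=; apply: eq_bigr => q _.
  have -> : (q \in [set g s | s : S]%SET) = P q.
    by apply/imsetP/idP => [[s _ ->] //|Pq]; exists (h q); rewrite ?hK.
  by case: (P q).
by rewrite card_imset //; exact: can_inj gK.
Qed.

Lemma card_sum (Q : finType) (P : pred Q) : #|[set q | P q]%SET| = \sum_q (P q : nat).
Proof.
by rewrite -sum1_card big_mkcond /=; apply: eq_bigr => q _; rewrite inE; case: (P q).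
Qed.

Section Quads.
Variable T : finType.
Local Notation quad := (T * T * T * T)%type.
Implicit Type q : quad.

Definition eq12 q := q.1.1.1 == q.1.1.2.
Definition eq13 q := q.1.1.1 == q.1.2.
Definition eq14 q := q.1.1.1 == q.2.
Definition eq23 q := q.1.1.2 == q.1.2.
Definition eq24 q := q.1.1.2 == q.2.
Definition eq34 q := q.1.2 == q.2.

Local Ltac retract g h :=
  rewrite (@card_retract _ quad _ g h);
  [ by rewrite ?card_prod; try lia
  | move=> s; rewrite /eq12 /eq13 /eq14 /eq23 /eq24 /eq34 /= ?eqxx //
  | by do ?case
  | by move=> [[[a b] c] e]; rewrite /eq12 /eq13 /eq14 /eq23 /eq24 /eq34 /=;
     do ?[case/andP => /eqP ->]; move=> /eqP -> ].

Lemma sum_eq12 : \sum_(q : quad) (eq12 q : nat) = #|T| ^ 3.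
Proof. retract (fun s : T * T * T => (s.1.1, s.1.1, s.1.2, s.2)) (fun q : quad => (q.1.1.1, q.1.2, q.2)). Qed.

Lemma sum_eq13 : \sum_(q : quad) (eq13 q : nat) = #|T| ^ 3.
Proof. retract (fun s : T * T * T => (s.1.1, s.1.2, s.1.1, s.2)) (fun q : quad => (q.1.1.1, q.1.1.2, q.2)). Qed.

Lemma sum_eq14 : \sum_(q : quad) (eq14 q : nat) = #|T| ^ 3.
Proof. retract (fun s : T * T * T => (s.1.1, s.1.2, s.2, s.1.1)) (fun q : quad => (q.1.1.1, q.1.1.2, q.1.2)). Qed.

Lemma sum_eq23 : \sum_(q : quad) (eq23 q : nat) = #|T| ^ 3.
Proof. retract (fun s : T * T * T => (s.1.1, s.1.2, s.1.2, s.2)) (fun q : quad => (q.1.1.1, q.1.2, q.2)). Qed.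

Lemma sum_eq24 : \sum_(q : quad) (eq24 q : nat) = #|T| ^ 3.
Proof. retract (fun s : T * T * T => (s.1.1, s.1.2, s.2, s.1.2)) (fun q : quad => (q.1.1.1, q.1.1.2, q.1.2)). Qed.

Lemma sum_eq34 : \sum_(q : quad) (eq34 q : nat) = #|T| ^ 3.
Proof. retract (fun s : T * T * T => (s.1.1, s.1.2, s.2, s.2)) (fun q : quad => (q.1.1.1, q.1.1.2, q.2)). Qed.

Lemma sum_eq12_34 : \sum_(q : quad) (eq12 q && eq34 q : nat) = #|T| ^ 2.
Proof. retract (fun s : T * T => (s.1, s.1, s.2, s.2)) (fun q : quad => (q.1.1.1, q.2)). Qed.

Lemma sum_eq123 : \sum_(q : quad) (eq12 q && eq23 q : nat) = #|T| ^ 2.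
Proof. retract (fun s : T * T => (s.1, s.1, s.1, s.2)) (fun q : quad => (q.1.2, q.2)). Qed.

Lemma sum_eq124 : \sum_(q : quad) (eq12 q && eq24 q : nat) = #|T| ^ 2.
Proof. retract (fun s : T * T => (s.1, s.1, s.2, s.1)) (fun q : quad => (q.2, q.1.2)). Qed.

Lemma sum_eq134 : \sum_(q : quad) (eq13 q && eq34 q : nat) = #|T| ^ 2.
Proof. retract (fun s : T * T => (s.1, s.2, s.1, s.1)) (fun q : quad => (q.2, q.1.1.2)). Qed.

Lemma sum_eq234 : \sum_(q : quad) (eq23 q && eq34 q : nat) = #|T| ^ 2.
Proof. retract (fun s : T * T => (s.2, s.1, s.1, s.1)) (fun q : quad => (q.2, q.1.1.1)). Qed.

Lemma sum_eq1234 : \sum_(q : quad) (eq12 q && (eq23 q && eq34 q) : nat) = #|T|.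
Proof. retract (fun s : T => (s, s, s, s)) (fun q : quad => q.2). Qed.

Lemma sum_quads : \sum_(q : quad) 1 = #|T| ^ 4.
Proof. by rewrite sum1_card !card_prod; lia. Qed.

Definition alternating q := ~~ eq12 q && ~~ eq34 q.

Definition no_three_equal q := [&& ~~ (eq12 q && eq23 q), ~~ (eq12 q && eq24 q),
  ~~ (eq13 q && eq34 q) & ~~ (eq23 q && eq34 q)].

Lemma sum_alternating : \sum_(q : quad) (alternating q : nat) + 2 * #|T| ^ 3 = #|T| ^ 4 + #|T| ^ 2.
Proof.
rewrite -sum_quads -sum_eq12_34 mul2n -addnn -{1}sum_eq12 -sum_eq34 -!big_split /=.
by apply: eq_bigr => q _; rewrite /alternating; case: (eq12 q); case: (eq34 q).
Qed.

(** A quadruple with exactly three equal entries violates one condition and a constant one violates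
    all four; the excess of three per constant quadruple is the term [3 * #|T|]. *)
Lemma sum_no_three_equal :
  \sum_(q : quad) (no_three_equal q : nat) + 4 * #|T| ^ 2 = #|T| ^ 4 + 3 * #|T|.
Proof.
have -> : 4 * #|T| ^ 2 = \sum_(q : quad) ((eq12 q && eq23 q) + (eq12 q && eq24 q) +
    (eq13 q && eq34 q) + (eq23 q && eq34 q)).
  by rewrite !big_split /= sum_eq123 sum_eq124 sum_eq134 sum_eq234; move: (_ ^ 2) => x; lia.
rewrite -sum_quads -[in RHS]sum_eq1234 big_distrr -!big_split /=; apply: eq_bigr => -[[[a b] c] e] _.
rewrite /no_three_equal /eq12 /eq13 /eq14 /eq23 /eq24 /eq34 /=.
case: (eqVneq a b) => [<-|ab] /=.
  by case: (eqVneq a c) => [<-|ac] /=; case: (a == e).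
case: (eqVneq a c) => [<-|ac] /=; first by rewrite [b == a]eq_sym (negbTE ab); case: (a == e).
by case: (b == c); case: (c == e).
Qed.

(** Each of the six possible coincidences has [#|T| ^ 3] quadruples, so distinctness only affects
    lower order terms. *)
Lemma sum_le_uniq (P : pred quad) : \sum_(q : quad) (P q : nat) <=
  \sum_(q : quad) (P q && uniq [:: q.1.1.1; q.1.1.2; q.1.2; q.2] : nat) + 6 * #|T| ^ 3.
Proof.
have -> : 6 * #|T| ^ 3 = \sum_(q : quad) (eq12 q + eq13 q + eq14 q + eq23 q + eq24 q + eq34 q).
  rewrite !big_split /= sum_eq12 sum_eq13 sum_eq14 sum_eq23 sum_eq24 sum_eq34; move: (_ ^ 3) => x; lia.
rewrite -big_split /=; apply: leq_sum => q _.
rewrite !inE -[q.1.1.1 == _]/(eq12 q) -[q.1.1.1 == _]/(eq13 q) -[q.1.1.1 == _]/(eq14 q).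
rewrite -[q.1.1.2 == _]/(eq23 q) -[q.1.1.2 == _]/(eq24 q) -[q.1.2 == _]/(eq34 q).
by case: (P q); case: (eq12 q); case: (eq13 q); case: (eq14 q); case: (eq23 q); case: (eq24 q); case: (eq34 q).
Qed.

End Quads.

Lemma sum_pattern (I J : finType) (P : pred (I * I * I * I)) :
  \sum_(q : (I * J) * (I * J) * (I * J) * (I * J)) (P (q.1.1.1.1, q.1.1.2.1, q.1.2.1, q.2.1) : nat) =
  (\sum_p (P p : nat)) * #|J| ^ 4.
Proof.
pose g (s : (I * I * I * I) * (J * J * J * J)) :=
  ((s.1.1.1.1, s.2.1.1.1), (s.1.1.1.2, s.2.1.1.2), (s.1.1.2, s.2.1.2), (s.1.2, s.2.2)).
pose h (q : (I * J) * (I * J) * (I * J) * (I * J)) :=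
  ((q.1.1.1.1, q.1.1.2.1, q.1.2.1, q.2.1), (q.1.1.1.2, q.1.1.2.2, q.1.2.2, q.2.2)).
have gK : cancel g h by move=> [[[[? ?] ?] ?] [[[? ?] ?] ?]].
have hK : cancel h g by move=> [[[[? ?] [? ?]] [? ?]] [? ?]].
rewrite (reindex g) /=; last by exists h => ? _.
rewrite big_distrl /= -(pair_bigA _ (fun p (_ : J * J * J * J) => P (p.1.1.1, p.1.1.2, p.1.2, p.2) : nat)) /=.
apply: eq_bigr => -[[[a b] c] e] _ /=.
by rewrite -sum_quads big_distrr /=; apply: eq_bigr => t _; rewrite muln1.
Qed.
End QuadCounting.

Section Asymptotics.
Variables (R : realType) (r : nat).

Lemma card_edge_quads n :
  (#|edge_quads (balanced_multipartite r n)| <=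
    (\sum_(p : 'I_r * 'I_r * 'I_r * 'I_r) (alternating p : nat)) * n ^ 4 <=
    #|edge_quads (balanced_multipartite r n)| + 6 * r ^ 3 * n ^ 3)%N.
Proof.
have sum_le (Q : finType) (P P' : pred Q) : (forall q, P q -> P' q) -> (\sum_q (P q : nat) <= \sum_q (P' q : nat))%N.
  by move=> PP; apply: leq_sum => q _; case: (P q) (PP q) => // ->.
have := @sum_pattern 'I_r 'I_n (@alternating 'I_r); rewrite card_ord => <-.
have -> : #|edge_quads (balanced_multipartite r n)| =
    (\sum_(q : ('I_r * 'I_n) * ('I_r * 'I_n) * ('I_r * 'I_n) * ('I_r * 'I_n))
      (alternating (q.1.1.1.1, q.1.1.2.1, q.1.2.1, q.2.1) &&
       uniq [:: q.1.1.1; q.1.1.2; q.1.2; q.2] : nat))%N.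
  rewrite /edge_quads card_sum; apply: eq_bigr => q _.
  by rewrite /balanced_multipartite /alternating /eq12 /eq34 /= -!andbA.
apply/andP; split; first by apply: sum_le => q /andP[].
apply: leq_trans (sum_le_uniq _) _; rewrite leq_add2l card_prod !card_ord expnMn; lia.
Qed.

Let part n (v : 'I_r * 'I_n) : nat := v.1.
Let rank n (v : 'I_r * 'I_n) : nat := v.1 * n + v.2.

Lemma card_spread_quads n :
  (#|spread_quads (@part n)| <=
    (\sum_(p : 'I_r * 'I_r * 'I_r * 'I_r) (no_three_equal p : nat)) * n ^ 4 <=
    #|spread_quads (@part n)| + 6 * r ^ 3 * n ^ 3)%N.
Proof.
have sum_le (Q : finType) (P P' : pred Q) : (forall q, P q -> P' q) -> (\sum_q (P q : nat) <= \sum_q (P' q : nat))%N.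
  by move=> PP; apply: leq_sum => q _; case: (P q) (PP q) => // ->.
have := @sum_pattern 'I_r 'I_n (@no_three_equal 'I_r); rewrite card_ord => <-.
have -> : #|spread_quads (@part n)| =
    (\sum_(q : ('I_r * 'I_n) * ('I_r * 'I_n) * ('I_r * 'I_n) * ('I_r * 'I_n))
      (no_three_equal (q.1.1.1.1, q.1.1.2.1, q.1.2.1, q.2.1) &&
       uniq [:: q.1.1.1; q.1.1.2; q.1.2; q.2] : nat))%N.
  rewrite /spread_quads card_sum; apply: eq_bigr => -[[[u v] w] z] _.
  by rewrite andbC.
apply/andP; split; first by apply: sum_le => q /andP[].
apply: leq_trans (sum_le_uniq _) _; rewrite leq_add2l card_prod !card_ord expnMn; lia.
Qed.

Lemma CR_multipartite n : (24 * CR R (balanced_multipartite r n))%N = #|spread_quads (@part n)|.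
Proof.
have -> : balanced_multipartite r n = part_adj (@part n) by [].
apply: (@CR_spread R _ (@part n) (@rank n)).
- move=> [u1 u2] [v1 v2]; rewrite /rank /= => E.
  have n0 : (0 < n)%N by case: n u2 {v2 E} => [[]|].
  have e1 : u1 = v1.
    by apply: val_inj; move/(congr1 (divn^~ n)): E; rewrite /= !divnMDl// !divn_small ?ltn_ord// !addn0.
  by congr (_, _) => //; apply: val_inj; move: E; rewrite e1 => /addnI.
- move=> [u1 u2] [v1 v2]; rewrite /rank /part /= => lt.
  have n0 : (0 < n)%N by case: n u2 {v2 lt} => [[]|].
  have h1 := ltn_ord u2; have h2 := ltn_ord v2; rewrite leqNgt; apply/negP => h3.
  have : (v1.+1 * n <= u1 * n)%N by rewrite leq_mul2r h3 orbT.
  by rewrite mulSn; lia.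
Qed.

Lemma cvg_quartic (u : nat -> nat) (a c : nat) :
  (forall n, u n <= a * n ^ 4 <= u n + c * n ^ 3)%N ->
  (u n)%:R / (n%:R ^+ 4) @[n --> \oo] --> (a%:R : R).
Proof.
move=> H.
have inv0 : (n%:R^-1 : R) @[n --> \oo] --> (0 : R).
  rewrite -(cvg_shiftS (fun n : nat => n%:R^-1 : R)); exact: cvg_harmonic.
have lo : (a%:R - c%:R * n%:R^-1 : R) @[n --> \oo] --> (a%:R : R).
  rewrite -[X in _ --> X]subr0 -[X in _ - X](mulr0 c%:R); apply: cvgB; first exact: cvg_cst.
  by apply: cvgM; [exact: cvg_cst|exact: inv0].
apply: (@squeeze_cvgr _ _ _ _ (fun n => a%:R - c%:R * n%:R^-1 : R) (fun=> a%:R)); last 2 first.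
- exact: lo.
- exact: cvg_cst.
near=> n; have n0 : (0 < n)%N by near: n; exact: nbhs_infty_gt.
have n0R : (0 : R) < n%:R by rewrite ltr0n.
have /andP[h1 h2] := H n; rewrite ler_pdivrMr ?exprn_gt0// ler_pdivlMr ?exprn_gt0//; apply/andP; split.
  have -> : (a%:R - c%:R / n%:R) * n%:R ^+ 4 = a%:R * n%:R ^+ 4 - c%:R * n%:R ^+ 3 :> R.
    by field; rewrite gt_eqF.
  by rewrite lerBlDr -!natrX -!natrM -natrD ler_nat.
by rewrite -natrX -natrM ler_nat.
Unshelve. all: by end_near. Qed.

Lemma sum_alternatingE : ((\sum_(p : 'I_r * 'I_r * 'I_r * 'I_r) (alternating p : nat))%N)%:R =
  r%:R ^+ 4 + r%:R ^+ 2 - 2 * r%:R ^+ 3 :> R.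
Proof.
have := @sum_alternating 'I_r; rewrite card_ord => E.
by rewrite -!natrX -natrM -natrD -E natrD addrK.
Qed.

Lemma sum_no_three_equalE : ((\sum_(p : 'I_r * 'I_r * 'I_r * 'I_r) (no_three_equal p : nat))%N)%:R =
  r%:R ^+ 4 + 3 * r%:R - 4 * r%:R ^+ 2 :> R.
Proof.
have := @sum_no_three_equal 'I_r; rewrite card_ord => E.
by rewrite -!natrX -!natrM -natrD -E natrD addrK.
Qed.

End Asymptotics.

Theorem theorem1p7 (R : realType) (r : nat) (hr : (2 <= r)%N)
    (d : nat -> measure_display) (T : forall n, measurableType (d n))
    (P : forall n, probability (T n) R)
    (X : forall n, 'I_r * 'I_n -> T n -> R * R * R)
    (hX : forall n, uniform_independent (P n) (X n)) :
  (expected_crossings (balanced_multipartite r n) (P n) (X n)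
     / (CR R (balanced_multipartite r n))%:R%:E)%E
    @[n --> \oo] --> (zeta R r)%:E.
Proof.
pose N n := #|edge_quads (balanced_multipartite r n)|.
pose C n := CR R (balanced_multipartite r n).
have adj_sym n : symmetric (balanced_multipartite r n) by move=> u v; rewrite /balanced_multipartite eq_sym.
have adj_irr n : irreflexive (balanced_multipartite r n) by move=> u; rewrite /balanced_multipartite eqxx.
(* These factor as r^2 (r - 1)^2 and r (r - 1) (r^2 + r - 3), whose common factor r (r - 1) cancels
   in [zeta]. *)
set a : R := r%:R ^+ 4 + r%:R ^+ 2 - 2 * r%:R ^+ 3.
set b : R := r%:R ^+ 4 + 3 * r%:R - 4 * r%:R ^+ 2.
have r2 : (2 : R) <= r%:R by rewrite ler_nat.
have b_gt0 : 0 < b.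
  have -> : b = r%:R * (r%:R - 1) * (r%:R ^+ 2 + r%:R - 3) by rewrite /b; ring.
  by rewrite !mulr_gt0//; nra.
have cN : (N n)%:R / (n%:R ^+ 4) @[n --> \oo] --> (a : R).
  by rewrite /a -sum_alternatingE; apply: cvg_quartic => n; exact: card_edge_quads.
have cC : (24 * C n)%:R / (n%:R ^+ 4) @[n --> \oo] --> (b : R).
  rewrite /b -sum_no_three_equalE; apply: (cvg_quartic (c := 6 * r ^ 3)) => n.
  by rewrite CR_multipartite; exact: card_spread_quads.
(* 3 / 8 is 24 / 64: the denominator is normalised as 24 times CR and the numerator carries the 1 /
   64 of [expected_crossingsE]. *)
have lim : 3 / 8 * ((N n)%:R / (n%:R ^+ 4) / ((24 * C n)%:R / (n%:R ^+ 4))) @[n --> \oo] --> zeta R r.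
  have -> : zeta R r = 3 / 8 * (a / b).
    have b0 : r%:R ^+ 4 + 3 * r%:R - 4 * r%:R ^+ 2 != 0 :> R by rewrite gt_eqF.
    have z0 : r%:R ^+ 2 + r%:R - 3 != 0 :> R by apply: lt0r_neq0; nra.
    by rewrite /zeta /a /b; field; rewrite b0 z0.
  apply: cvgM; first exact: cvg_cst.
  by apply: cvgM => //; apply: cvgV => //; rewrite gt_eqF.
(* Since [b] is positive, CR is eventually positive, which makes the quotient in [\bar R] eventually
   a finite real. *)
have C_gt0 : \forall n \near \oo, (0 < C n)%N.
  apply: filterS (cvgr_gt _ cC _ b_gt0) => n; rewrite lt0n; apply: contraTneq => ->.
  by rewrite muln0 mul0r ltxx.
have E n : (0 < C n)%N -> (expected_crossings (balanced_multipartite r n) (P n) (X n)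
     / (CR R (balanced_multipartite r n))%:R%:E)%E = ((N n)%:R / 64 / (C n)%:R)%:E.
  move=> C0; rewrite (expected_crossingsE (adj_sym n) (adj_irr n) (hX n)) -/(C n) -/(N n).
  have -> : (((C n)%:R : R)%:E^-1 = ((C n)%:R^-1)%:E)%E by rewrite /inve pnatr_eq0 gtn_eqF.
  by rewrite -EFinM.
apply: cvg_EFin.
  by apply: filterS C_gt0 => n /E ->.
apply: cvg_trans lim; apply: near_eq_cvg; near=> n.
have n0 : (0 < n)%N by near: n; exact: nbhs_infty_gt.
have C0 : (0 < C n)%N by near: n.
rewrite /= E//= natrM; field.
by rewrite !pnatr_eq0 -!lt0n n0 C0.
Unshelve. all: by end_near. Qed.
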